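(* Let $n,m,k\ge 1$ be integers, $r\in(0,1)$, $r_1>r$, and $v\in\mathbb{R}^n$ with $\|v\|\le 1$. Let $q$ be a holomorphic function whose domain contains the complex disk $\mathbb{D}_{1+r_1}$ of radius $1+r_1$ centered at the origin, such that $q(X)\in\mathbb{R}^{n\times n}$ for $X\in\mathcal{B}^{n\times n}$, and let $g:\mathbb{R}^n\to\mathbb{R}^m$ satisfy $g\in C^k(\bar B^n(2);\mathbb{R}^m)$. Assume that $q$ and $g$ are both bounded by $1$. Define $$H(X)=g\big(q(X)v\big),\qquad X\in\mathcal{B}^{n\times n}.$$ Let $\varepsilon\in(0,1)$. Then there exist a constant $C=C(k,n,r)$ (depending only on $k,n,r$) and a general operator recurrent network $H_\theta$ of level $K=2$, depth $L\le L_0$ and width $W\le W_0$ such that $$\sup_{X\in\mathcal{B}^{n\times n}}\|H(X)-H_\theta(X)\|_{\mathbb{R}^m}\le\varepsilon ,$$ where $$L_0=C\left(\log\left(\frac{4\|g\|_{C^1(\bar B^n(2))}}{r\varepsilon}\right)+\log\left(\frac{4^{k+1}\|g\|_{C^k(\bar B^n(2))}}{\varepsilon}\right)+1\right)$$ and $$W_0=C\,m\,n\left(\frac{\varepsilon}{4^{k+1}\|g\|_{C^k(\bar B^n(2))}}\right)^{-n/k}\left(\log\left(\frac{4^{k+1}\|g\|_{C^k(\bar B^n(2))}}{\varepsilon}\right)+1\right).$$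
   Context: $\mathcal{B}^{n\times n}=\{X\in\mathbb{R}^{n\times n}:\|X\|_{\mathbb{R}^n\to\mathbb{R}^n}\le1\}$ (operator norm); $\bar B^n(R)$ is the closed Euclidean ball of radius $R$ in $\mathbb{R}^n$. $\|g\|_{C^k(\bar B^n(2))}=\max_{y\in\bar B^n(2)}\max_{|\alpha|\le k}\|D^\alpha g(y)\|_{\mathbb{R}^m}$. The matrix $q(X)$ is defined by the holomorphic functional calculus, $q(X)=\sum_{j\ge0}a_jX^j$ with $a_j$ the Taylor coefficients of $q$ at $0$. A general operator recurrent network of level $K$ and depth $L$ is a function $X\mapsto h_L$, where $h_0$ is a fixed initial vector, $h_{j}=0$ for $j<0$, and for $1\le\ell\le L$ $$h_\ell=b^{\ell,0}+\sum_{k=1}^K\big(A^{\ell,k,0}h_{\ell-k}+B^{\ell,k,0}Xh_{\ell-k}\big)+\phi_\ell\Big[b^{\ell,1}+\sum_{k=1}^K\big(A^{\ell,k,1}h_{\ell-k}+B^{\ell,k,1}Xh_{\ell-k}\big)\Big].$$ Here the bias vectors $b^{\ell,i}$ and weight matrices $A^{\ell,k,i},B^{\ell,k,i}$ are the parameters of the network (they do not depend on $X$), and $\phi_\ell$ acts componentwise as a leaky rectifier $y\mapsto\max(y,\eta_\ell y)$ with some $\eta_\ell\in[0,1]$ ($\eta_\ell=0$ is the standard ReLU). In this statement the dimension of the hidden state $h_\ell\in\mathbb{R}^{d_\ell}$ may vary with $\ell$, the width is $\max_\ell d_\ell$, the output dimension is $d_L=m$, and a term $B^{\ell,k,i}Xh_{\ell-k}$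 may be nonzero only if $d_{\ell-k}=n$ (weight matrices have the corresponding rectangular sizes).
   Formalization: The bounds proved are L ≤ max(1, L_0) and W ≤ max(m, W_0): for g = 0 the logarithms are undefined, and for g very small compared with ε both L_0 and W_0 are negative, while every network has depth at least 1 and width at least m. *)

(* Defs.v *)
From mathcomp Require Import all_boot all_order all_algebra complex.
From mathcomp Require Import all_classical all_reals all_analysis.

Set Implicit Arguments.
Unset Strict Implicit.
Unset Printing Implicit Defensive.

Import Order.TTheory GRing.Theory Num.Theory.
Import numFieldNormedType.Exports.

Local Open Scope classical_set_scope.
Local Open Scope ring_scope.
Local Open Scope complex_scope.

Section Euclidean.
Context {R : realType}.

(* The library norm on matrices is the sup norm; it induces the same topology. *)
Definition enorm (p : nat) (u : 'cV[R]_p) : R :=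
  Num.sqrt (\sum_(i < p) u i 0 ^+ 2).

Definition eball (p : nat) (rad : R) : set 'cV[R]_p := [set y | enorm y < rad].

Definition cball (p : nat) (rad : R) : set 'cV[R]_p := [set y | enorm y <= rad].

Definition opnorm (n : nat) (X : 'M[R]_n) : R :=
  sup [set enorm (X *m u) | u in @cball n 1].

Definition contractions (n : nat) : set 'M[R]_n := [set X | opnorm X <= 1].

End Euclidean.

Section HolomorphicCalculus.
Context {R : realType}.

Definition holomorphic_on (D : set R[i]) (q : R[i] -> R[i]) : Prop :=
  forall z : R[i], D z -> derivable (q : R[i]^o -> R[i]^o) z 1.

Definition cdisk (rad : R) : set R[i] := [set z | `|z| < rad%:C].

Definition taylor_coef (q : R[i] -> R[i]) (j : nat) : R[i] :=
  derive1n j (q : R[i]^o -> R[i]^o) 0 / j`!%:R.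

(* Convergence of matrices is entrywise convergence.  The series has complex
   coefficients, so its sum is a priori a complex matrix. *)
Definition holo_calc (n : nat) (q : R[i] -> R[i]) (X : 'M[R]_n) : 'M[R[i]]_n :=
  \matrix_(a, b) lim ((fun N : nat =>
    \sum_(j < N) taylor_coef q j * ((X ^+ j) a b)%:C : R[i]^o) @ \oo).

Definition real_mx (n p : nat) (Z : 'M[R[i]]_(n, p)) : Prop :=
  forall a b, complex.Im (Z a b) = 0.

Definition Re_mx (n p : nat) (Z : 'M[R[i]]_(n, p)) : 'M[R]_(n, p) :=
  map_mx (@complex.Re R) Z.

End HolomorphicCalculus.

Section ClosedBallCk.
Context {R : realType}.
Variables (n m : nat).
Implicit Types g : 'cV[R]_n -> 'cV[R]_m.

Definition partial (i : 'I_n) g : 'cV[R]_n -> 'cV[R]_m :=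
  fun y => 'D_(delta_mx i 0) g y.

Definition mderiv (al : {ffun 'I_n -> nat}) g : 'cV[R]_n -> 'cV[R]_m :=
  foldr (fun i f => iter (al i) (partial i) f) g (enum 'I_n).

Definition extends_to_cball (rad : R) g : Prop :=
  exists E : 'cV[R]_n -> 'cV[R]_m,
    {within @cball R n rad, continuous E} /\
    (forall y, eball rad y -> E y = g y).

Fixpoint Ck_open (k : nat) (rad : R) g : Prop :=
  extends_to_cball rad g /\
  match k with
  | 0 => True
  | k'.+1 => forall i : 'I_n,
      (forall y, eball rad y -> derivable g y (delta_mx i 0)) /\
      Ck_open k' rad (partial i g)
  end.

(* C^k on the closed ball: C^k in its interior, all partial derivatives of order
   at most k extending continuously to the closed ball. *)
Definition Ck_cball (k : nat) (rad : R) g : Prop :=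
  {within @cball R n rad, continuous g} /\ Ck_open k rad g.

(* D^al g at a point of the closed ball, boundary included: the value of the
   continuous extension. *)
Definition mderiv_ext (rad : R) (al : {ffun 'I_n -> nat}) g (y : 'cV[R]_n) :
    'cV[R]_m :=
  lim (mderiv al g @ within (@eball R n rad) (nbhs y)).

Definition Ck_norm (k : nat) (rad : R) g : R :=
  sup [set t | exists (al : {ffun 'I_n -> nat}) (y : 'cV[R]_n),
    [/\ (\sum_(i < n) al i <= k)%N, cball rad y
      & t = enorm (mderiv_ext rad al g y)]].

End ClosedBallCk.

Section Network.
Context {R : realType}.

(* Only layers 0 <= l <= depth and lags 1 <= k <= K matter; entries of the
   families outside this range are never used.  In bias, wA and wB the boolean
   is the superscript i: false for the linear part, true for the part inside the
   rectifier. *)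
Record orn (n m K : nat) := Orn {
  depth : nat;
  depth_gt0 : (0 < depth)%N;
  dim : nat -> nat;
  dim_out : dim depth = m;
  init : 'cV[R]_(dim 0);
  bias : forall l : nat, bool -> 'cV[R]_(dim l);
  wA : forall l k : nat, bool -> 'M[R]_(dim l, dim (l - k));
  wB : forall l k : nat, bool -> 'M[R]_(dim l, n);
  slope : nat -> R;
  slope_itv : forall l : nat, 0 <= slope l <= 1
}.

Definition leaky (eta y : R) : R := Num.max y (eta * y).

Variables (n m K : nat) (N : orn n m K).

Definition width : nat := \max_(l < (depth N).+1) dim N l.

(* conform_mx 0 h is h when h has dimension n and 0 otherwise, so that
   the term B X h is present only when it makes sense.  The condition k <= l
   encodes h_j = 0 for j < 0. *)
Definition affine_part (X : 'M[R]_n) (l : nat) (h : forall j, 'cV[R]_(dim N j))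
    (i : bool) : 'cV[R]_(dim N l) :=
  bias N l i +
  \sum_(1 <= k < K.+1 | (k <= l)%N)
    (wA N l k i *m h (l - k)%N
     + wB N l k i *m (X *m conform_mx (0 : 'cV[R]_n) (h (l - k)%N))).

Definition layer (X : 'M[R]_n) (l : nat) (h : forall j, 'cV[R]_(dim N j)) :
    'cV[R]_(dim N l) :=
  affine_part X l h false + map_mx (leaky (slope N l)) (affine_part X l h true).

(* states X l j is h_j for j <= l, and 0 for j > l. *)
Fixpoint states (X : 'M[R]_n) (l : nat) : forall j, 'cV[R]_(dim N j) :=
  match l with
  | 0 => dfwith (fun j => 0 : 'cV[R]_(dim N j)) 0%N (init N)
  | l'.+1 => dfwith (states X l') l'.+1 (layer X l'.+1 (states X l'))
  end.

Definition network (X : 'M[R]_n) : 'cV[R]_m :=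
  castmx (dim_out N, erefl 1%N) (states X (depth N) (depth N)).

End Network.

Arguments orn R n m K : clear implicits.

(* When g is very small compared with eps these quantities drop below 1, resp.
   below m, or are negative, whereas every network has depth >= 1 and width
   >= dim_out = m.  Bounds on a network should therefore be read as bounds by
   Num.max 1 (depth_bound ...) and Num.max m%:R (width_bound ...). *)
Definition depth_bound {R : realType} (n m k : nat) (r eps C : R)
    (g : 'cV[R]_n -> 'cV[R]_m) : R :=
  C * (ln (4 * Ck_norm 1 2 g / (r * eps))
       + ln (4 ^+ k.+1 * Ck_norm k 2 g / eps) + 1).

Definition width_bound {R : realType} (n m k : nat) (eps C : R)
    (g : 'cV[R]_n -> 'cV[R]_m) : R :=
  C * m%:R * n%:R
  * (eps / (4 ^+ k.+1 * Ck_norm k 2 g)) `^ (- (n%:R / k%:R))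
  * (ln (4 ^+ k.+1 * Ck_norm k 2 g / eps) + 1).

(* Main.v *)
Require Import Defs.
From mathcomp Require Import all_boot all_order all_algebra complex.
From mathcomp Require Import all_classical all_reals all_analysis.
From mathcomp Require Import ring lra zify.

Set Implicit Arguments.
Unset Strict Implicit.
Unset Printing Implicit Defensive.

Import Order.TTheory GRing.Theory Num.Theory.
Import numFieldNormedType.Exports.

Local Open Scope classical_set_scope.
Local Open Scope ring_scope.
Local Open Scope complex_scope.

(** The network first computes, in one layer per coefficient, a Taylor polynomial
    [p(X) v] of [q(X) v] by Horner's scheme, and then applies to it a network that
    approximates [g].

    - _The Taylor polynomial._  Since [q] is bounded by 1 on a disk of radius larger than
      [1 + r], its Taylor coefficients decay like [(1 + r) ^ -j], so [p(X) v] converges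
      geometrically to [q(X) v] for a contraction [X] ([holo_calc_tail]), and
      [O (ln (1 / eps))] layers suffice.  The constant must not depend on [q], and the
      coefficient bounds alone would only place [p(X) v] in a ball of radius about [1 / r],
      outside the domain of [g].  Von Neumann's inequality is what brings it back into a
      ball of radius [5 / 4] ([von_neumann], [tpoly_ball]).  It is deduced from the fact
      that the Toeplitz matrix of the Taylor coefficients of a function bounded by 1 is a
      contraction ([toeplitz_contraction]), which in turn is the mean over a circle of a
      pointwise inequality.

    - _Complex analysis._  Holomorphy is complex differentiability, and Taylor coefficients
      are defined by iterated derivatives.  They are identified with means over circles
      ([taylor_coef_mean]) through Goursat's lemma, the invariance of means over concentric
      circles ([cmean_annulus]) and Cauchy's formula ([cauchy_formula]).

    - _The function g._  On the ball of radius [3 / 2], [g] is within [O (N ^ -k)] of a sum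
      of Taylor polynomials localized by a partition of unity on a grid of mesh [1 / N]
      ([local_taylor_approx]).  This is a linear combination of [O (N ^ n)] products of
      [n + k] factors, each a piecewise linear function of one coordinate.

    - _Products._  Rectifiers square numbers in [[0, 1]] with error [4 ^ -s] in [O (s)]
      layers, by iterating the tent map ([sqaP]); polarization gives products ([mulAP]).
      Computing all products in parallel costs a width proportional to [N ^ n] and a depth
      proportional to [s] ([computes_products]).

    With [N] of the order of [(G / eps) ^ (1 / k)] for the [C^k] norm [G] of [g], and with
    [s] and the degree of [p] logarithmic in [1 / eps], this gives the bounds on depth and
    width.  If [g] is at most [eps] on the ball of radius [3 / 2] the zero network is used
    instead; otherwise both norms of [g] exceed [eps], and the logarithms in the bounds are
    positive. *)

(** * Modulus and differentiability of complex functions *)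

Section Modulus.
Context {R : realType}.
Implicit Types z w : R[i].

Definition cabs z : R := ComplexField.Normc.normc z.

Lemma normE z : `|z| = (cabs z)%:C.
Proof. by case: z. Qed.

Lemma cabs_ge0 z : 0 <= cabs z.
Proof. by case: z => a b; apply: sqrtr_ge0. Qed.

Lemma cabsM z w : cabs (z * w) = cabs z * cabs w.
Proof. exact: ComplexField.Normc.normcM. Qed.

Lemma cabs0 : cabs 0 = 0. Proof. exact: ComplexField.Normc.normc0. Qed.
Lemma cabs1 : cabs 1 = 1. Proof. exact: ComplexField.Normc.normc1. Qed.

Lemma cabsD z w : cabs (z + w) <= cabs z + cabs w.
Proof. exact: le_normcD. Qed.

Lemma cabsN z : cabs (- z) = cabs z.
Proof. exact: normcN. Qed.

Lemma cabsC z w : cabs (z - w) = cabs (w - z).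
Proof. by rewrite -cabsN opprB. Qed.

Lemma cabsV z : cabs z^-1 = (cabs z)^-1.
Proof. exact: ComplexField.Normc.normcV. Qed.

Lemma cabsX z n : cabs (z ^+ n) = cabs z ^+ n.
Proof. by elim: n => [|n IH]; rewrite ?expr0 ?cabs1// !exprS cabsM IH. Qed.

Lemma cabs_eq0 z : (cabs z == 0) = (z == 0).
Proof.
apply/eqP/eqP => [|->]; last exact: cabs0.
exact: ComplexField.Normc.eq0_normc.
Qed.

Lemma cabs_gt0 z : (0 < cabs z) = (z != 0).
Proof. by rewrite lt_neqAle cabs_ge0 andbT eq_sym cabs_eq0. Qed.

Lemma cabs_real (x : R) : cabs x%:C = `|x|.
Proof. by rewrite /cabs /= expr0n/= addr0 sqrtr_sqr. Qed.

Lemma cabs_i : cabs 'i%C = 1.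
Proof. by rewrite /cabs /= expr0n/= add0r expr1n sqrtr1. Qed.

Lemma sqr_cabs z : cabs z ^+ 2 = complex.Re z ^+ 2 + complex.Im z ^+ 2.
Proof. by case: z => a b /=; rewrite sqr_sqrtr// addr_ge0// sqr_ge0. Qed.

Lemma Re_le_cabs z : `|complex.Re z| <= cabs z.
Proof.
rewrite -(@ler_pXn2r _ 2)// ?nnegrE ?cabs_ge0//.
by rewrite real_normK ?num_real// sqr_cabs lerDl sqr_ge0.
Qed.

Lemma Im_le_cabs z : `|complex.Im z| <= cabs z.
Proof.
rewrite -(@ler_pXn2r _ 2)// ?nnegrE ?cabs_ge0//.
by rewrite real_normK ?num_real// sqr_cabs lerDr sqr_ge0.
Qed.

Lemma cabs_le_ReIm z : cabs z <= `|complex.Re z| + `|complex.Im z|.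
Proof.
rewrite -(@ler_pXn2r _ 2)// ?nnegrE ?cabs_ge0// ?addr_ge0//.
rewrite sqr_cabs sqrrD !real_normK ?num_real// -addrA lerD2l lerDr.
by rewrite mulrn_wge0// mulr_ge0.
Qed.

Lemma cabsB_ge z w : cabs z - cabs w <= cabs (z - w).
Proof. by rewrite lerBlDr -[X in cabs X <= _](subrK w) cabsD. Qed.

Lemma gt0_complex (e : R[i]) : 0 < e -> exists2 x : R, 0 < x & e = x%:C.
Proof.
case: e => a b; rewrite ltcE/= => /andP[/eqP-> a0]; by exists a.
Qed.

Lemma nbhs_cabsP (P : set R[i]) z :
  (\forall w \near (z : R[i]^o), P w) <->
  exists2 d : R, 0 < d & forall w, cabs (w - z) < d -> P w.
Proof.
split.
- move=> /nbhs_ballP[e /= /gt0_complex[d d0 ->] H].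
  exists d => // w wz; apply: H; rewrite -ball_normE/= /ball_.
  by rewrite normE ltcR cabsC.
- move=> [d d0 H]; apply/nbhs_ballP; exists d%:C => /=; first by rewrite ltcR.
  move=> w; rewrite -ball_normE/= normE ltcR cabsC; exact: H.
Qed.

Lemma cderP (F : R[i] -> R[i]) z :
  derivable (F : R[i]^o -> R[i]^o) z 1 <->
  exists d : R[i], forall e : R, 0 < e -> exists2 del : R, 0 < del &
    forall h, cabs h < del -> cabs (F (z + h) - F z - d * h) <= e * cabs h.
Proof.
split.
- move=> Fd; pose D : R[i] := 'D_1 (F : R[i]^o -> R[i]^o) z; exists D => e e0.
  have e0' : 0 < e%:C by rewrite ltcR.
  have /cvgrPdist_le /(_ _ e0') := Fd.
  rewrite near_withinE => /nbhs_cabsP[d d0 H].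
  exists d => // h hd.
  have [->|h0] := eqVneq h 0.
    by rewrite addr0 subrr mulr0 subrr cabs0 mulr0.
  have HD : cabs (D - h^-1 * (F (h + z) - F z)) <= e.
    have hd0 : cabs (h - 0) < d by rewrite subr0.
    by have := H h hd0 h0; rewrite normE lecR /GRing.scale/= mulr1.
  rewrite (_ : F (z + h) - F z - D * h = - ((D - h^-1 * (F (h + z) - F z)) * h)).
    by rewrite cabsN cabsM ler_wpM2r ?cabs_ge0.
  by rewrite (addrC z) mulrBl mulrAC mulVf// mul1r opprB.
- move=> [d Hd]; apply/cvg_ex; exists d; apply/cvgrPdist_le => e' /gt0_complex[e e0 ->].
  have [del del0 H] := Hd e e0.
  rewrite near_withinE; apply/nbhs_cabsP; exists del => // h; rewrite subr0 => hd h0.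
  rewrite normE lecR /GRing.scale/= mulr1.
  have := H h hd.
  rewrite (_ : F (z + h) - F z - d * h = - ((d - h^-1 * (F (h + z) - F z)) * h)).
    by rewrite cabsN cabsM ler_pM2r// cabs_gt0.
  by rewrite (addrC z) mulrBl mulrAC mulVf// mul1r opprB.
Qed.

Lemma ccontP (T : topologicalType) (F : T -> R[i]) (t : T) :
  {for t, continuous (F : T -> R[i]^o)} <->
  forall e : R, 0 < e -> \forall w \near t, cabs (F w - F t) < e.
Proof.
split.
- move=> Fc e e0; have e0' : 0 < e%:C by rewrite ltcR.
  have /cvgrPdist_lt /(_ _ e0') := Fc.
  by apply: filterS => w; rewrite normE ltcR cabsC.
- move=> H; apply/cvgrPdist_lt => e' /gt0_complex[e e0 ->].
  by apply: filterS (H e e0) => w; rewrite normE ltcR cabsC.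
Qed.

Lemma Re_cont (T : topologicalType) (F : T -> R[i]) (t : T) :
  {for t, continuous (F : T -> R[i]^o)} ->
  {for t, continuous (fun x => complex.Re (F x))}.
Proof.
move=> /ccontP Fc; apply/cvgrPdist_lt => e e0; apply: filterS (Fc e e0) => w.
apply: le_lt_trans; rewrite cabsC.
by apply: le_trans (Re_le_cabs _); case: (F t) (F w) => [a b] [c d].
Qed.

Lemma Im_cont (T : topologicalType) (F : T -> R[i]) (t : T) :
  {for t, continuous (F : T -> R[i]^o)} ->
  {for t, continuous (fun x => complex.Im (F x))}.
Proof.
move=> /ccontP Fc; apply/cvgrPdist_lt => e e0; apply: filterS (Fc e e0) => w.
apply: le_lt_trans; rewrite cabsC.
by apply: le_trans (Im_le_cabs _); case: (F t) (F w) => [a b] [c d].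
Qed.

Lemma mkC_cont (T : topologicalType) (f g : T -> R) (t : T) :
  {for t, continuous f} -> {for t, continuous g} ->
  {for t, continuous ((fun x => f x +i* g x) : T -> R[i]^o)}.
Proof.
move=> fc gc; apply/ccontP => e e0.
have e20 : 0 < e / 2 by rewrite divr_gt0.
have /cvgrPdist_lt /(_ _ e20) f1 := fc.
have /cvgrPdist_lt /(_ _ e20) g1 := gc.
near=> w; apply: le_lt_trans (cabs_le_ReIm _) _ => /=.
rewrite [ltRHS]splitr ltrD// distrC; first by near: w.
by near: w.
Unshelve. all: by end_near. Qed.

End Modulus.
Arguments cabs {R} z : simpl never.

(** * Integrals of complex functions over segments *)

Section ComplexIntegral.
Context {R : realType}.
Implicit Types (f : R -> R) (F : R -> R[i]).

Notation mu := (@lebesgue_measure R).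

Definition rint f (a b : R) : R := \int[mu]_(x in `[a, b]) f x.

Definition contc (a b : R) f := forall x, a <= x <= b -> {for x, continuous f}.

Lemma contc_integrable a b f : contc a b f -> mu.-integrable `[a, b] (EFin \o f).
Proof.
move=> fc; apply: continuous_compact_integrable; first exact: segment_compact.
apply/subspace_continuousP => x; rewrite /= in_itv/= => xab.
apply: cvg_within_filter; exact: fc.
Qed.

Lemma rintD a b f g : contc a b f -> contc a b g ->
  rint (fun x => f x + g x) a b = rint f a b + rint g a b.
Proof. by move=> fc gc; rewrite /rint RintegralD//; exact: contc_integrable. Qed.

Lemma rintB a b f g : contc a b f -> contc a b g ->
  rint (fun x => f x - g x) a b = rint f a b - rint g a b.
Proof. by move=> fc gc; rewrite /rint RintegralB//; exact: contc_integrable. Qed.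

Lemma rintZ a b k f : contc a b f ->
  rint (fun x => k * f x) a b = k * rint f a b.
Proof. by move=> fc; rewrite /rint RintegralZl//; exact: contc_integrable. Qed.

Lemma rint_cst a b k : a <= b -> rint (fun=> k) a b = k * (b - a).
Proof.
move=> ab; rewrite /rint Rintegral_cst//=.
by rewrite lebesgue_measure_itv/= lte_fin; case: ltgtP ab => // -> _; rewrite subrr.
Qed.

Lemma rint_ge0 a b f : (forall x, a <= x <= b -> 0 <= f x) -> 0 <= rint f a b.
Proof. by move=> f0; apply: Rintegral_ge0 => x /=; rewrite in_itv/=; exact: f0. Qed.

Lemma rint_le a b f g : contc a b f -> contc a b g ->
  (forall x, a <= x <= b -> f x <= g x) -> rint f a b <= rint g a b.
Proof.
move=> fc gc fg; apply: le_Rintegral.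
- by [].
- exact: contc_integrable.
- exact: contc_integrable.
- by move=> x /=; rewrite in_itv/=; exact: fg.
Qed.

Lemma contc_cst a b k : contc a b (fun=> k).
Proof. by move=> x _; exact: cvg_cst. Qed.

Lemma contcS a b c d f : a <= c -> d <= b -> contc a b f -> contc c d f.
Proof.
move=> ac db fc x /andP[cx xd]; apply: fc.
by rewrite (le_trans ac cx) (le_trans xd db).
Qed.

Lemma rint_norm_le a b f M : a <= b -> contc a b f ->
  (forall x, a <= x <= b -> `|f x| <= M) -> `|rint f a b| <= M * (b - a).
Proof.
move=> ab fc fM; rewrite -(rint_cst _ ab).
apply: le_trans (le_normr_Rintegral _ (contc_integrable fc)) _ => //.
apply: rint_le => //; last exact: contc_cst.
by move=> x /fc fx; exact: (cvg_norm fx).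
Qed.

Lemma rint_split a b c f : contc a b f -> a <= c <= b ->
  rint f a b = rint f a c + rint f c b.
Proof.
move=> fc /andP[ac cb].
have := @Rintegral_itvB R f (BLeft a) (BRight b) c (contc_integrable fc).
rewrite !bnd_simp /rint => /(_ ac cb) /(canRL (subrK _)) ->.
rewrite addrC Rintegral_itv_obnd_cbnd//.
have := contc_integrable (contcS ac (lexx b) fc).
by apply: integrableS => //; apply: subset_itvr; rewrite bnd_simp.
Qed.

Lemma rint_id a b : a <= b -> rint id a b = (b ^+ 2 - a ^+ 2) / 2.
Proof.
rewrite le_eqVlt => /predU1P[->|ab].
  by rewrite subrr mul0r /rint set_itv1 Rintegral_set1.
rewrite /rint /Rintegral (@continuous_FTC2 _ id (fun x => x ^+ 2 / 2))//.
- by rewrite /= -mulrBl.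
- by apply: continuous_subspaceT => x; exact: cvg_id.
- have dF x : derivable (fun x : R => x ^+ 2 / 2) x 1.
    by apply: derivableM; [exact: exprn_derivable|exact: derivable_cst].
  have cF x : {for x, continuous (fun x : R => x ^+ 2 / 2)}.
    by apply: differentiable_continuous; apply/derivable1_diffP.
  split=> //; first exact: cvg_at_right_filter (cF a).
  exact: cvg_at_left_filter (cF b).
- move=> x _; rewrite derive1Mr; last exact: exprn_derivable.
  by rewrite exp_derive1 expr1 -mulr_natl mulrAC mulfV// mul1r.
Qed.

Lemma eq_rint a b f g : (forall x, a <= x <= b -> f x = g x) ->
  rint f a b = rint g a b.
Proof.
by move=> fg; apply: eq_Rintegral => x; rewrite inE/= in_itv/=; exact: fg.
Qed.

Definition cint F (a b : R) : R[i] :=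
  rint (fun x => complex.Re (F x)) a b +i* rint (fun x => complex.Im (F x)) a b.

Definition ccontc (a b : R) F :=
  forall x, a <= x <= b -> {for x, continuous (F : R -> R[i]^o)}.

Lemma ccontcRe a b F : ccontc a b F -> contc a b (fun x => complex.Re (F x)).
Proof. by move=> Fc x xab; apply/Re_cont/Fc. Qed.

Lemma ccontcIm a b F : ccontc a b F -> contc a b (fun x => complex.Im (F x)).
Proof. by move=> Fc x xab; apply/Im_cont/Fc. Qed.

Lemma eq_cint a b F G : (forall x, a <= x <= b -> F x = G x) ->
  cint F a b = cint G a b.
Proof. by move=> FG; congr Complex; apply: eq_rint => x /FG ->. Qed.

Lemma cintD a b F G : ccontc a b F -> ccontc a b G ->
  cint (fun x => F x + G x) a b = cint F a b + cint G a b.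
Proof.
move=> Fc Gc; have := (ccontcRe Fc, ccontcIm Fc, ccontcRe Gc, ccontcIm Gc).
case=> -[[F1 F2] G1] G2; rewrite /cint; apply/eqP; rewrite eq_complex /=.
rewrite -!rintD//; apply/andP; split; apply/eqP/eq_rint => x _.
  by case: (F x) (G x) => [? ?] [? ?].
by case: (F x) (G x) => [? ?] [? ?].
Qed.

Lemma contcZ a b k f : contc a b f -> contc a b (fun x => k * f x).
Proof. by move=> fc x /fc fx; apply: cvgM => //; exact: cvg_cst. Qed.

Lemma cintZ a b k F : ccontc a b F ->
  cint (fun x => k * F x) a b = k * cint F a b.
Proof.
move=> Fc; have [F1 F2] := (ccontcRe Fc, ccontcIm Fc).
case: k => k l; rewrite /cint; apply/eqP; rewrite eq_complex /= -!rintZ//.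
rewrite -rintB ?(contcZ _ _)//; try exact: contcZ.
rewrite -rintD; try exact: contcZ.
by apply/andP; split; apply/eqP/eq_rint => x _; case: (F x).
Qed.

Lemma ccontc_cst a b k : ccontc a b (fun=> k).
Proof. by move=> x _; exact: cvg_cst. Qed.

Lemma cint_cst a b k : a <= b -> cint (fun=> k) a b = (b - a)%:C * k.
Proof.
move=> ab; rewrite /cint !rint_cst//; case: k => k l.
by apply/eqP; rewrite eq_complex/= !mul0r subr0 addr0 !(mulrC (b - a)) !eqxx.
Qed.

Lemma cint_split a b c F : ccontc a b F -> a <= c <= b ->
  cint F a b = cint F a c + cint F c b.
Proof.
move=> Fc acb; have [F1 F2] := (ccontcRe Fc, ccontcIm Fc).
by rewrite /cint (rint_split F1 acb) (rint_split F2 acb).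
Qed.

(** The factor 2 comes from bounding the real and the imaginary part separately; it only
    affects constants. *)
Lemma cint_le a b F M : a <= b -> ccontc a b F ->
  (forall x, a <= x <= b -> cabs (F x) <= M) ->
  cabs (cint F a b) <= 2 * M * (b - a).
Proof.
move=> ab Fc FM; have [F1 F2] := (ccontcRe Fc, ccontcIm Fc).
apply: le_trans (cabs_le_ReIm _) _ => /=.
rewrite -mulrA mulr_natl mulr2n lerD// rint_norm_le// => x /FM; apply: le_trans.
  exact: Re_le_cabs.
exact: Im_le_cabs.
Qed.

Lemma cint_id a b : a <= b -> cint (fun x => x%:C) a b = ((b ^+ 2 - a ^+ 2) / 2)%:C.
Proof.
by move=> ab; rewrite /cint /= -(rint_id ab) rint_cst// mul0r.
Qed.

End ComplexIntegral.

(** * Goursat's lemma *)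

Section Bisection.
Context {R : realType}.

Lemma nested_point (x : nat -> R) (u : R) : 0 <= u ->
  (forall n, x n <= x n.+1 /\ x n.+1 + u / 2 ^+ n.+1 <= x n + u / 2 ^+ n) ->
  exists z, forall n, x n <= z <= x n + u / 2 ^+ n.
Proof.
move=> u0 H.
have incr m k : x m <= x (m + k)%N.
  elim: k => [|k IH]; first by rewrite addn0.
  by rewrite addnS (le_trans IH)// (H _).1.
have decr m k : x (m + k)%N + u / 2 ^+ (m + k) <= x m + u / 2 ^+ m.
  elim: k => [|k IH]; first by rewrite addn0.
  by rewrite addnS (le_trans _ IH)// (H _).2.
have p n : 0 <= u / 2 ^+ n by rewrite divr_ge0// exprn_ge0.
have cross m n : x m <= x n + u / 2 ^+ n.
  have [mn|/ltnW nm] := leqP m n.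
    rewrite -(subnKC mn); apply: (le_trans (incr m (n - m)%N)).
    by rewrite lerDl.
  rewrite -(subnKC nm); apply: le_trans (decr n (m - n)%N).
  by rewrite lerDl.
exists (sup [set x n | n in setT]) => n; apply/andP; split.
- apply: ub_le_sup; last by exists n.
  by exists (x 0%N + u / 2 ^+ 0) => _ [m _ <-].
- apply: ge_sup; first by exists (x 0%N), 0%N.
  by move=> _ [m _ <-].
Qed.

Lemma pow2_small (u d : R) : 0 < d -> exists N, forall n, (N <= n)%N -> u / 2 ^+ n < d.
Proof.
move=> d0; pose N := Num.truncn (`|u| / d); exists N.+1 => n Nn.
rewrite ltr_pdivrMr ?exprn_gt0//.
apply: le_lt_trans (ler_norm _) _; rewrite mulrC -ltr_pdivrMr//.
apply: lt_le_trans (_ : N.+1%:R <= _); first by rewrite truncnS_gt.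
rewrite -natrX ler_nat; apply: leq_trans Nn _.
by apply: ltnW; rewrite ltn_expl.
Qed.

(** [P x y u v] speaks of the rectangle with lower left corner [(x, y)] and sides [u],
    [v].  If it failed, it would fail for some quarter, then for some quarter of that
    quarter, and these nested rectangles would shrink to a point around which [P] holds
    for all small rectangles. *)
Lemma rect_bisection (P : R -> R -> R -> R -> Prop) (x0 y0 u0 v0 : R) :
  0 <= u0 -> 0 <= v0 ->
  (forall x y u v, P x y (u / 2) (v / 2) -> P (x + u / 2) y (u / 2) (v / 2) ->
     P x (y + v / 2) (u / 2) (v / 2) -> P (x + u / 2) (y + v / 2) (u / 2) (v / 2) ->
     x0 <= x -> x + u <= x0 + u0 -> y0 <= y -> y + v <= y0 + v0 ->
     0 <= u -> 0 <= v -> P x y u v) ->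
  (forall a b, x0 <= a <= x0 + u0 -> y0 <= b <= y0 + v0 ->
    exists2 d, 0 < d & forall x y u v, x <= a <= x + u -> y <= b <= y + v ->
     x0 <= x -> x + u <= x0 + u0 -> y0 <= y -> y + v <= y0 + v0 ->
     u < d -> v < d -> P x y u v) ->
  P x0 y0 u0 v0.
Proof.
move=> u00 v00 Hsplit Hloc; apply: contrapT => nP0.
pose U n := u0 / 2 ^+ n; pose V n := v0 / 2 ^+ n.
have US n : U n / 2 = U n.+1 by rewrite /U exprSr invfM mulrA.
have VS n : V n / 2 = V n.+1 by rewrite /V exprSr invfM mulrA.
have U0 n : 0 <= U n by rewrite divr_ge0// exprn_ge0.
have V0 n : 0 <= V n by rewrite divr_ge0// exprn_ge0.
have U2 n : U n = U n.+1 + U n.+1 by rewrite -US -splitr.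
have V2 n : V n = V n.+1 + V n.+1 by rewrite -VS -splitr.
pose inr n (p : R * R) := [/\ x0 <= p.1, p.1 + U n <= x0 + u0,
   y0 <= p.2 & p.2 + V n <= y0 + v0].
pose bad n (p : R * R) := ~ P p.1 p.2 (U n) (V n) /\ inr n p.
pose nxt n (p p' : R * R) := [/\ p.1 <= p'.1, p'.1 + U n.+1 <= p.1 + U n,
   p.2 <= p'.2 & p'.2 + V n.+1 <= p.2 + V n].
have step (np : nat * (R * R)) : exists p', bad np.1 np.2 ->
    bad np.1.+1 p' /\ nxt np.1 np.2 p'.
  case: np => n [x y] /=; apply: contrapT => nex.
  have [nP [/= h1 h2 h3 h4]] : bad n (x, y).
    by apply: contrapT => nb; apply: nex; exists (0, 0) => /nb.
  have sub p' : nxt n (x, y) p' -> P p'.1 p'.2 (U n.+1) (V n.+1).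
    move=> np'; apply: contrapT => nPp'; apply: nex; exists p' => _; split=> //.
    split=> //; case: np' => /= k1 k2 k3 k4; split.
    - exact: le_trans k1. - exact: le_trans h2.
    - exact: le_trans k3. - exact: le_trans h4.
  have := (U2 n, V2 n, U0 n.+1, V0 n.+1); case=> -[[e1 e2] e3] e4.
  apply: nP; apply: Hsplit => //; rewrite ?US ?VS.
  - by apply: (sub (x, y)); split => /=; lra.
  - by apply: (sub (x + U n.+1, y)); split => /=; lra.
  - by apply: (sub (x, y + V n.+1)); split => /=; lra.
  - by apply: (sub (x + U n.+1, y + V n.+1)); split => /=; lra.
have [f fP] := choice step.
pose s := fix s n := if n is n'.+1 then f (n', s n') else (x0, y0).
have sb n : bad n (s n).
  elim: n => [|n IH]; last by have [] := fP (n, s n) IH.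
  by split; rewrite /= ?/U ?/V ?expr0 ?divr1//; split => /=; rewrite /U /V ?expr0 ?divr1.
have sn n : nxt n (s n) (s n.+1) by have [] := fP (n, s n) (sb n).
have [a aP] : exists a, forall n, (s n).1 <= a <= (s n).1 + U n.
  by apply: (@nested_point (fun n => (s n).1)) => // n; case: (sn n).
have [b bP] : exists b, forall n, (s n).2 <= b <= (s n).2 + V n.
  by apply: (@nested_point (fun n => (s n).2)) => // n; case: (sn n).
have aI : x0 <= a <= x0 + u0 by have := aP 0%N; rewrite /= /U expr0 divr1.
have bI : y0 <= b <= y0 + v0 by have := bP 0%N; rewrite /= /V expr0 divr1.
have [d d0 dP] := Hloc a b aI bI.
have [N1 H1] := pow2_small u0 d0; have [N2 H2] := pow2_small v0 d0.
pose n := maxn N1 N2.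
have [nP [? ? ? ?]] := sb n; apply: nP; apply: dP => //.
- by apply: H1; rewrite leq_maxl.
- by apply: H2; rewrite leq_maxr.
Qed.

End Bisection.

Section Goursat.
Context {R : realType}.
Implicit Types H : R[i] -> R[i].

Definition inrect (a b c d : R) (z : R[i]) :=
  a <= complex.Re z <= b /\ c <= complex.Im z <= d.

Definition contr a b c d H :=
  forall z, inrect a b c d z -> {for z, continuous (H : R[i]^o -> R[i]^o)}.

(** The integral of [H] along the boundary of a rectangle, counterclockwise. *)
Definition bint H a b c d : R[i] :=
  cint (fun x => H (x +i* c)) a b - cint (fun x => H (x +i* d)) a b +
  'i%C * (cint (fun y => H (b +i* y)) c d - cint (fun y => H (a +i* y)) c d).

Lemma contr_h a b c d H y : contr a b c d H -> c <= y <= d ->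
  ccontc a b (fun x => H (x +i* y)).
Proof.
move=> Hc cyd x xab.
apply: (@continuous_comp _ _ _ (fun x : R => x +i* y : R[i]^o) (H : R[i]^o -> R[i]^o)).
  by apply: mkC_cont; [exact: cvg_id|exact: cvg_cst].
exact: Hc.
Qed.

Lemma contr_v a b c d H x : contr a b c d H -> a <= x <= b ->
  ccontc c d (fun y => H (x +i* y)).
Proof.
move=> Hc xab y ycd.
apply: (@continuous_comp _ _ _ (fun y : R => x +i* y : R[i]^o) (H : R[i]^o -> R[i]^o)).
  by apply: mkC_cont; [exact: cvg_cst|exact: cvg_id].
exact: Hc.
Qed.

Lemma bint_splitx H a b c d e : c <= d -> contr a b c d H -> a <= e <= b ->
  bint H a b c d = bint H a e c d + bint H e b c d.
Proof.
move=> cd Hc aeb; rewrite /bint.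
rewrite (cint_split (contr_h Hc _) aeb) ?lexx//.
rewrite [X in _ - X](cint_split (contr_h Hc _) aeb) ?lexx ?cd//.
by ring.
Qed.

Lemma bint_splity H a b c d e : a <= b -> contr a b c d H -> c <= e <= d ->
  bint H a b c d = bint H a b c e + bint H a b e d.
Proof.
move=> ab Hc ced; rewrite /bint.
rewrite (cint_split (contr_v Hc _) ced) ?lexx ?ab//.
rewrite [X in _ * (_ - X)](cint_split (contr_v Hc _) ced) ?lexx ?ab//.
by ring.
Qed.

Lemma bintD H G a b c d : a <= b -> c <= d -> contr a b c d H -> contr a b c d G ->
  bint (fun z => H z + G z) a b c d = bint H a b c d + bint G a b c d.
Proof.
move=> ab cd Hc Gc; rewrite /bint.
have [c1 c2] : c <= c <= d /\ c <= d <= d by rewrite !lexx cd.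
have [a1 a2] : a <= a <= b /\ a <= b <= b by rewrite !lexx ab.
rewrite (cintD (contr_h Hc c1) (contr_h Gc c1)) (cintD (contr_h Hc c2) (contr_h Gc c2)).
rewrite (cintD (contr_v Hc a1) (contr_v Gc a1)) (cintD (contr_v Hc a2) (contr_v Gc a2)).
by ring.
Qed.

Lemma bint_affine (al be : R[i]) a b c d : a <= b -> c <= d ->
  bint (fun z => al + be * z) a b c d = 0.
Proof.
move=> ab cd; rewrite /bint.
have idc (p q : R) : ccontc p q (fun x => x%:C).
  by move=> x _; apply: mkC_cont; [exact: cvg_id|exact: cvg_cst].
have idcZ (p q : R) k : ccontc p q (fun x => k * x%:C).
  by move=> x xpq; apply: cvgM; [exact: cvg_cst|exact: (idc p q)].
have hx (p q y : R) : p <= q -> cint (fun x => al + be * (x +i* y)) p q =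
   (q - p)%:C * (al + be * 'i%C * y%:C) + be * ((q ^+ 2 - p ^+ 2) / 2)%:C.
  move=> pq; rewrite -(cint_cst _ pq) -(cint_id pq) -cintZ// -cintD//.
  - by apply: eq_cint => x _; rewrite (complexE (x +i* y))/=; ring.
  - exact: ccontc_cst.
have hy (p q x : R) : p <= q -> cint (fun y => al + be * (x +i* y)) p q =
   (q - p)%:C * (al + be * x%:C) + (be * 'i%C) * ((q ^+ 2 - p ^+ 2) / 2)%:C.
  move=> pq; rewrite -(cint_cst _ pq) -(cint_id pq) -cintZ// -cintD//.
  - by apply: eq_cint => y _; rewrite (complexE (x +i* y))/=; ring.
  - exact: ccontc_cst.
by rewrite !hx// !hy// !rmorphB/=; ring.
Qed.

Lemma bint_le H M a b c d : a <= b -> c <= d -> contr a b c d H ->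
  (forall z, inrect a b c d z -> cabs (H z) <= M) ->
  cabs (bint H a b c d) <= 4 * M * ((b - a) + (d - c)).
Proof.
move=> ab cd Hc HM.
have h y : c <= y <= d -> cabs (cint (fun x => H (x +i* y)) a b) <= 2 * M * (b - a).
  by move=> ycd; apply: cint_le => //; [exact: (contr_h Hc)|move=> x xab; apply: HM].
have v x : a <= x <= b -> cabs (cint (fun y => H (x +i* y)) c d) <= 2 * M * (d - c).
  by move=> xab; apply: cint_le => //; [exact: (contr_v Hc)|move=> y ycd; apply: HM].
have [c1 c2] : c <= c <= d /\ c <= d <= d by rewrite !lexx cd.
have [a1 a2] : a <= a <= b /\ a <= b <= b by rewrite !lexx ab.
have := (h c c1, h d c2, v a a1, v b a2) => -[[[h1 h2] h3] h4].
apply: le_trans (cabsD _ _) _; rewrite cabsM cabs_i mul1r.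
have k1 := cabsD (cint (fun x => H (x +i* c)) a b) (- cint (fun x => H (x +i* d)) a b).
have k2 := cabsD (cint (fun y => H (b +i* y)) c d) (- cint (fun y => H (a +i* y)) c d).
rewrite !cabsN in k1 k2; nra.
Qed.

Lemma bint_quarters H a b c d e f : a <= e <= b -> c <= f <= d -> contr a b c d H ->
  bint H a b c d = bint H a e c f + bint H e b c f + bint H a e f d + bint H e b f d.
Proof.
move=> aeb cfd Hc; have /andP[ae eb] := aeb; have /andP[cf fd] := cfd.
have ab := le_trans ae eb; have cd := le_trans cf fd.
rewrite (bint_splity ab Hc cfd).
have Hc1 : contr a b c f H.
  by move=> z [h1 /andP[h2 h3]]; apply: Hc; split; rewrite // h2 (le_trans h3).
have Hc2 : contr a b f d H.
  by move=> z [h1 /andP[h2 h3]]; apply: Hc; split; rewrite // h3 (le_trans _ h2).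
by rewrite (bint_splitx cf Hc1 aeb) (bint_splitx fd Hc2 aeb) addrA.
Qed.

Lemma contrS a b c d a' b' c' d' H : a <= a' -> b' <= b -> c <= c' -> d' <= d ->
  contr a b c d H -> contr a' b' c' d' H.
Proof.
move=> aa bb cc dd Hc z [/andP[h1 h2] /andP[h3 h4]]; apply: Hc; split.
  by rewrite (le_trans aa) ?(le_trans _ bb).
by rewrite (le_trans cc) ?(le_trans _ dd).
Qed.

Lemma derivable_cont H (z : R[i]) : derivable (H : R[i]^o -> R[i]^o) z 1 ->
  {for z, continuous (H : R[i]^o -> R[i]^o)}.
Proof. by move=> /derivable1_diffP/differentiable_continuous. Qed.

(** Around each point [H] is affine up to [e |z - p|], and affine functions have boundary
    integral 0, so the integral over a small rectangle is at most [4 e (u + v) ^ 2].  This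
    bound is compatible with cutting into quarters, hence it holds for the whole
    rectangle. *)
Lemma goursat H a b c d : a <= b -> c <= d ->
  (forall z, inrect a b c d z -> derivable (H : R[i]^o -> R[i]^o) z 1) ->
  bint H a b c d = 0.
Proof.
move=> ab cd Hd; have Hc : contr a b c d H by move=> z /Hd /derivable_cont.
suff small e : 0 < e -> cabs (bint H a b c d) <= 4 * e * ((b - a) + (d - c)) ^+ 2.
  apply/eqP; rewrite -cabs_eq0; apply/eqP/le_anti; rewrite cabs_ge0 andbT.
  apply/ler_addgt0Pr => e e0; rewrite add0r.
  set s := (b - a + (d - c)) ^+ 2 in small.
  have s0 : 0 <= s by rewrite sqr_ge0.
  have s1 : 0 < 4 * (s + 1) by lra.
  have := small (e / (4 * (s + 1))) (divr_gt0 e0 s1) => /le_trans -> //.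
  rewrite (_ : 4 * _ * s = e * (s / (s + 1))); last by field; rewrite gt_eqF//; lra.
  by rewrite ger_pMr// ler_pdivrMr ?mul1r ?lerDl//; lra.
move=> e0.
pose P x y u v := cabs (bint H x (x + u) y (y + v)) <= 4 * e * (u + v) ^+ 2.
suff : P a c (b - a) (d - c) by rewrite /P (addrC a) subrK (addrC c) subrK.
apply: (@rect_bisection _ P) => //; rewrite ?subr_ge0//.
- move=> x y u v P1 P2 P3 P4 h1 h2 h3 h4 u0 v0.
  have Hc' : contr x (x + u) y (y + v) H.
    by apply: contrS Hc => //; rewrite ?(le_trans h2) ?(le_trans h4) //; lra.
  rewrite /P (@bint_quarters _ _ _ _ _ (x + u / 2) (y + v / 2))//; [|lra..].
  have ex (w t : R) : w + t = w + t / 2 + t / 2 by lra.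
  move: P1 P2 P3 P4; rewrite /P -!ex => P1 P2 P3 P4.
  have [t1 t2] := (cabsD (bint H x (x + u / 2) y (y + v / 2)) (bint H (x + u / 2) (x + u) y (y + v / 2)),
     cabsD (bint H x (x + u / 2) (y + v / 2) (y + v)) (bint H (x + u / 2) (x + u) (y + v / 2) (y + v))).
  rewrite -addrA; apply: le_trans (cabsD _ _) _.
  apply: le_trans (lerD t1 t2) _.
  apply: le_trans (lerD (lerD P1 P2) (lerD P3 P4)) _.
  by rewrite le_eqVlt; apply/orP; left; apply/eqP; field.
- move=> p q pI qI.
  have zI : inrect a b c d (p +i* q) by rewrite /inrect/=; split; lra.
  have /cderP[D HD] := Hd _ zI; have [del del0 Hdel] := HD e e0.
  exists (del / 2); first by rewrite divr_gt0.
  move=> x y u v pxu qyv h1 h2 h3 h4 ud vd; rewrite /P.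
  have u0 : x <= x + u by lra.
  have v0 : y <= y + v by lra.
  have Hc' : contr x (x + u) y (y + v) H.
    by apply: contrS Hc => //; lra.
  pose al := H (p +i* q) - D * (p +i* q).
  pose G z := H z - (al + D * z).
  have Ac : contr x (x + u) y (y + v) (fun z => al + D * z).
    move=> z _.
    have c1 : {for z, continuous ((fun=> al) : R[i]^o -> R[i]^o)} by exact: cst_continuous.
    have c2 : {for z, continuous ((fun=> D) : R[i]^o -> R[i]^o)} by exact: cst_continuous.
    have c3 : {for z, continuous (id : R[i]^o -> R[i]^o)} by move=> ?; exact: cvg_id.
    exact: (continuousD c1 (continuousM c2 c3)).
  have Gc : contr x (x + u) y (y + v) G.
    by move=> z zr; exact: (continuousB (Hc' z zr) (Ac z zr)).
  have -> : bint H x (x + u) y (y + v) = bint G x (x + u) y (y + v).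
    have GE : (fun z => G z + (al + D * z)) = H.
      by apply/funext => z; rewrite /G subrK.
    by rewrite -[RHS]addr0 -(bint_affine al D u0 v0) -(bintD u0 v0 Gc Ac) GE.
  rewrite (_ : 4 * e * (u + v) ^+ 2 = 4 * (e * (u + v)) * ((x + u - x) + (y + v - y))); last by ring.
  apply: bint_le => // z [z1 z2].
  have hz : cabs (z - (p +i* q)) <= u + v.
    apply: le_trans (cabs_le_ReIm _) _; case: z z1 z2 => z1 z2 /= h5 h6.
    by apply: lerD; rewrite ler_norml; apply/andP; split; lra.
  have zd : cabs (z - (p +i* q)) < del by lra.
  have := Hdel _ zd; rewrite (addrC _ (z - _)) subrK => k.
  have -> : G z = H z - H (p +i* q) - D * (z - (p +i* q)) by rewrite /G /al; ring.
  by apply: le_trans k _; rewrite ler_pM2l.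
Qed.

End Goursat.

(** * The complex exponential *)

Section ComplexExp.
Context {R : realType}.

Lemma is_derive_eps (f : R -> R) (x d : R) : is_derive x 1 f d ->
  forall e, 0 < e -> exists2 del, 0 < del &
    forall h, `|h| < del -> `|f (x + h) - f x - d * h| <= e * `|h|.
Proof.
move=> fd e e0.
have Fd : derivable f x 1 by case: fd.
have dE : 'D_1 f x = d by case: fd.
have /cvgrPdist_le /(_ _ e0) := Fd.
rewrite near_withinE => /nbhs_ballP[del /= del0 H].
exists del => // h hd.
have [->|h0] := eqVneq h 0.
  by rewrite addr0 subrr mulr0 subrr normr0 mulr0.
have HD : `|d - h^-1 * (f (h + x) - f x)| <= e.
  have hd0 : ball 0 del h by rewrite -ball_normE/= sub0r normrN.
  by have := H h hd0 h0; rewrite -/('D_1 f x) -dE /GRing.scale/= mulr1.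
rewrite (_ : f (x + h) - f x - d * h = - ((d - h^-1 * (f (h + x) - f x)) * h)).
  by rewrite normrN normrM ler_wpM2r.
by rewrite (addrC x) mulrBl mulrAC mulVf// mul1r opprB.
Qed.

Definition cexp (w : R[i]) : R[i] :=
  (expR (complex.Re w) * cos (complex.Im w)) +i*
  (expR (complex.Re w) * sin (complex.Im w)).

Lemma cexpD w z : cexp (w + z) = cexp w * cexp z.
Proof.
case: w z => a b [c d]; apply/eqP; rewrite eq_complex /= expRD cosD sinD.
by apply/andP; split; apply/eqP; ring.
Qed.

Lemma cabs_cexp w : cabs (cexp w) = expR (complex.Re w).
Proof.
rewrite /cabs /cexp /= !exprMn -mulrDr cos2Dsin2 mulr1 sqrtr_sqr ger0_norm ?expR_ge0//.
Qed.

Lemma cexp_near0 (e : R) : 0 < e -> exists2 del : R, 0 < del &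
  forall h, cabs h < del -> cabs (cexp h - 1 - h) <= e * cabs h.
Proof.
move=> e0; pose e1 := Num.min (e / 8) 1.
have e10 : 0 < e1 by rewrite lt_min ltr01 andbT divr_gt0.
have e1e : e1 <= e / 8 by rewrite ge_min lexx.
have e11 : e1 <= 1 by rewrite ge_min lexx orbT.
have [d1 d10 H1] := is_derive_eps (is_derive_expR 0) e10.
have [d2 d20 H2] := is_derive_eps (is_derive_cos 0) e10.
have [d3 d30 H3] := is_derive_eps (is_derive_sin 0) e10.
pose del := Num.min (Num.min d1 d2) (Num.min d3 (e1 / 2)).
exists del; first by rewrite !lt_min d10 d20 d30 divr_gt0.
move=> h; rewrite !lt_min => /andP[/andP[hd1 hd2] /andP[hd3 hd4]].
have Ra := Re_le_cabs h; have Ib := Im_le_cabs h.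
apply: le_trans (cabs_le_ReIm _) _.
case: h => a b in hd1 hd2 hd3 hd4 Ra Ib *; rewrite /= in Ra Ib *.
set c := cabs _ in hd1 hd2 hd3 hd4 Ra Ib *.
have := H1 a (le_lt_trans Ra hd1); have := H2 b (le_lt_trans Ib hd2).
have := H3 b (le_lt_trans Ib hd3).
rewrite !add0r expR0 cos0 sin0 oppr0 mul0r !mul1r !subr0 ?addr0 => h3 h2 h1.
have c0 : 0 <= c by exact: cabs_ge0.
have m0 : e1 * `|a| <= `|a| by rewrite ler_piMl.
have E3 : `|expR a| <= 3.
  rewrite (_ : expR a = (expR a - 1 - a) + (1 + a)); last by ring.
  apply: le_trans (ler_normD _ _) _.
  have := ler_normD 1 a; rewrite normr1 => h4.
  lra.
have E1 : `|expR a - 1| <= 2 * c.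
  rewrite (_ : expR a - 1 = (expR a - 1 - a) + a); last by ring.
  apply: le_trans (ler_normD _ _) _; lra.
have -> : expR a * cos b - 1 - a = (expR a - 1 - a) + expR a * (cos b - 1) by ring.
rewrite ?oppr0 ?addr0.
have -> : expR a * sin b - b = expR a * (sin b - b) + (expR a - 1) * b by ring.
have k1 := ler_normD (expR a - 1 - a) (expR a * (cos b - 1)).
have k2 := ler_normD (expR a * (sin b - b)) ((expR a - 1) * b).
rewrite !normrM in k1 k2.
have m1 : `|expR a| * `|cos b - 1| <= 3 * (e1 * c).
  by rewrite ler_pM// (le_trans h2)// ler_pM2l.
have m2 : `|expR a| * `|sin b - b| <= 3 * (e1 * c).
  by rewrite ler_pM// (le_trans h3)// ler_pM2l.
have m3 : `|expR a - 1| * `|b| <= 2 * c * c by rewrite ler_pM.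
have m4 : e1 * `|a| <= e1 * c by rewrite ler_pM2l.
have m5 : 2 * c * c <= e1 * c by nra.
have m6 : 8 * (e1 * c) <= e * c by nra.
lra.
Qed.

Lemma derivable_cexp w : derivable (cexp : R[i]^o -> R[i]^o) w 1.
Proof.
apply/cderP; exists (cexp w) => e e0.
have w0 : 0 < cabs (cexp w) by rewrite cabs_cexp expR_gt0.
have [del del0 H] := cexp_near0 (divr_gt0 e0 w0); exists del => // h /H hh.
rewrite (_ : _ - _ - _ = cexp w * (cexp h - 1 - h)); last by rewrite cexpD; ring.
by rewrite cabsM -ler_pdivlMl// mulrA (mulrC _ e).
Qed.

Definition polar (t theta : R) : R[i] := (t * cos theta) +i* (t * sin theta).

Lemma cexp_ln (t theta : R) : 0 < t -> cexp (ln t +i* theta) = polar t theta.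
Proof. by move=> t0; rewrite /cexp /= lnK. Qed.

Lemma cabs_polar t theta : cabs (polar t theta) = `|t|.
Proof. by rewrite /cabs /polar /= !exprMn -mulrDr cos2Dsin2 mulr1 sqrtr_sqr. Qed.

Lemma polar_cont t theta : {for theta, continuous (polar t : R -> R[i]^o)}.
Proof.
apply: mkC_cont.
  apply: continuousM; [exact: cst_continuous|exact: continuous_cos].
apply: continuousM; [exact: cst_continuous|exact: continuous_sin].
Qed.

(** The strip is half a period high: the boundary lines of a closed strip of height [2 pi]
    have the same image. *)
Lemma cexp_inj_half (a : R) (z1 z2 : R[i]) : a = 0 \/ a = pi ->
  a <= complex.Im z1 <= a + pi -> a <= complex.Im z2 <= a + pi ->
  cexp z1 = cexp z2 -> z1 = z2.
Proof.
move=> a01 i1 i2 E.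
have Er : complex.Re z1 = complex.Re z2.
  by apply: expR_inj; rewrite -!cabs_cexp E.
case: z1 z2 i1 i2 E Er => x1 y1 [x2 y2] /= i1 i2 E Er; subst x2; congr Complex.
move: E => [/(mulfI _) E _].
have {}E : cos y1 = cos y2 by apply: E; rewrite gt_eqF ?expR_gt0.
case: a01 => aE; subst a.
  by apply: cos_inj => //; rewrite in_itv/=; lra.
have cpi (y : R) : cos (pi *+ 2 - y) = cos y.
  by rewrite addrC cosD2pi cosN.
have : pi *+ 2 - y1 = pi *+ 2 - y2.
  by apply: cos_inj; rewrite ?cpi// in_itv/= mulr2n; lra.
lra.
Qed.

End ComplexExp.

(** * Means over circles *)

Section CircleMean.
Context {R : realType}.
Implicit Types F G H : R[i] -> R[i].

Local Notation derivC F z := (derivable (F : R[i]^o -> R[i]^o) z 1).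
Local Notation contC F z := {for z, continuous (F : R[i]^o -> R[i]^o)}.

(** Cutting a square of half side [del] around the exceptional point [p] leaves four
    rectangles to which [goursat] applies, while the square contributes [O(del)] because
    [H] is bounded near [p].  The square is truncated when [p] is close to the boundary,
    so some of the four rectangles may be degenerate. *)
Lemma goursat_exc H a b c d : a <= b -> c <= d -> contr a b c d H ->
  (forall z1 z2, inrect a b c d z1 -> inrect a b c d z2 ->
     ~ derivC H z1 -> ~ derivC H z2 -> z1 = z2) ->
  bint H a b c d = 0.
Proof.
move=> ab cd Hc Huniq.
have [[p [pI pnd]]|none] := pselect (exists p, inrect a b c d p /\ ~ derivC H p); last first.
  have Hd z : inrect a b c d z -> derivC H z.
    by move=> zI; apply: contrapT => nd; apply: none; exists z.
  exact: goursat ab cd Hd.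
have Hd z : inrect a b c d z -> z != p -> derivC H z.
  by move=> zI /eqP zp; apply: contrapT => nd; apply: zp; exact: Huniq.
pose M := cabs (H p) + 1.
have /ccontP /(_ 1 ltr01) /nbhs_cabsP[d0 d00 Hnear] := Hc p pI.
have HM z : cabs (z - p) < d0 -> cabs (H z) <= M.
  move=> /Hnear k; have := cabsB_ge (H z) (H p); rewrite /M; lra.
have M0 : 0 < M by rewrite /M; have := cabs_ge0 (H p); lra.
suff small del : 0 < del -> del < d0 / 2 -> cabs (bint H a b c d) <= 16 * M * del.
  apply/eqP; rewrite -cabs_eq0; apply/eqP/le_anti; rewrite cabs_ge0 andbT.
  apply/ler_addgt0Pr => e e0; rewrite add0r.
  pose del := Num.min (d0 / 4) (e / (16 * M)).
  have d1 : 0 < del by rewrite lt_min !divr_gt0// mulr_gt0.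
  have d2 : del < d0 / 2.
    by apply: le_lt_trans (_ : d0 / 4 < _); [rewrite ge_min lexx|lra].
  apply: le_trans (small _ d1 d2) _.
  have : del <= e / (16 * M) by rewrite ge_min lexx orbT.
  by rewrite ler_pdivlMr ?mulr_gt0// mulrC.
move=> del0 deld.
case: p => p q in pI pnd Hd M HM M0 Hnear *; case: pI => /= /andP[ap pb] /andP[cq qd].
pose e1 := Num.max a (p - del); pose e2 := Num.min b (p + del).
pose f1 := Num.max c (q - del); pose f2 := Num.min d (q + del).
have e1a : a <= e1 by rewrite le_max lexx.
have e1p : e1 <= p by rewrite ge_max ap/=; lra.
have e2p : p <= e2 by rewrite le_min pb/=; lra.
have e2b : e2 <= b by rewrite ge_min lexx.
have f1c : c <= f1 by rewrite le_max lexx.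
have f1q : f1 <= q by rewrite ge_max cq/=; lra.
have f2q : q <= f2 by rewrite le_min qd/=; lra.
have f2d : f2 <= d by rewrite ge_min lexx.
have e1d : p - del <= e1 by rewrite le_max lexx orbT.
have e2d : e2 <= p + del by rewrite ge_min lexx orbT.
have f1d : q - del <= f1 by rewrite le_max lexx orbT.
have f2d' : f2 <= q + del by rewrite ge_min lexx orbT.
have sub a' b' c' d' : a <= a' -> b' <= b -> c <= c' -> d' <= d -> contr a' b' c' d' H.
  by move=> h1 h2 h3 h4; exact: contrS Hc.
have zero a' b' c' d' : a <= a' -> a' <= b' -> b' <= b -> c <= c' -> c' <= d' -> d' <= d ->
    (b' < p \/ p < a' \/ d' < q \/ q < c') -> bint H a' b' c' d' = 0.
  move=> h1 h2 h3 h4 h5 h6 h7; apply: goursat => // z [z1 z2].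
  apply: Hd; first by split; lra.
  by apply/eqP => zE; move: z1 z2; rewrite zE /=; lra.
have degx x c' d' : c' <= d' -> a <= x <= b -> c <= c' -> d' <= d -> bint H x x c' d' = 0.
  move=> h1 h2 h3 h4; have hc : contr x x c' d' H by apply: sub; lra.
  have xx : x <= x <= x by rewrite lexx.
  by have := bint_splitx h1 hc xx => /eqP; rewrite -subr_eq0 opprD addNKr oppr_eq0 => /eqP.
have degy y a' b' : a' <= b' -> c <= y <= d -> a <= a' -> b' <= b -> bint H a' b' y y = 0.
  move=> h1 h2 h3 h4; have hc : contr a' b' y y H by apply: sub; lra.
  have yy : y <= y <= y by rewrite lexx.
  by have := bint_splity h1 hc yy => /eqP; rewrite -subr_eq0 opprD addNKr oppr_eq0 => /eqP.
have L : bint H a e1 c d = 0.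
  have [aE|aN] := eqVneq a e1; first by rewrite -aE degx//; lra.
  apply: zero => //; try lra; left.
  by move: aN; rewrite /e1; case: (leP a (p - del)) => //; lra.
have Rr : bint H e2 b c d = 0.
  have [aE|aN] := eqVneq b e2; first by rewrite -aE degx//; lra.
  apply: zero => //; try lra; right; left.
  by move: aN; rewrite /e2; case: (leP b (p + del)) => //; lra.
have B : bint H e1 e2 c f1 = 0.
  have [aE|aN] := eqVneq c f1; first by rewrite -aE degy//; lra.
  apply: zero => //; try lra; right; right; left.
  by move: aN; rewrite /f1; case: (leP c (q - del)) => //; lra.
have T : bint H e1 e2 f2 d = 0.
  have [aE|aN] := eqVneq d f2; first by rewrite -aE degy//; lra.
  apply: zero => //; try lra; right; right; right.
  by move: aN; rewrite /f2; case: (leP d (q + del)) => //; lra.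
have -> : bint H a b c d = bint H e1 e2 f1 f2.
  rewrite (@bint_splitx _ H a b c d e1)//; last by lra.
  rewrite L add0r (@bint_splitx _ H e1 b c d e2)//; [|by apply: sub; lra|lra].
  rewrite Rr addr0 (@bint_splity _ H e1 e2 c d f1); [|lra|by apply: sub; lra|lra].
  rewrite B add0r (@bint_splity _ H e1 e2 f1 d f2); [|lra|by apply: sub; lra|lra].
  by rewrite T addr0.
apply: (@le_trans _ _ (4 * M * ((e2 - e1) + (f2 - f1)))).
  apply: bint_le; [lra|lra|by apply: sub; lra|].
  case=> x y [/= h1 h2]; apply: HM; apply: le_lt_trans (cabs_le_ReIm _) _ => /=.
  have k1 : `|x - p| <= del by rewrite ler_norml; lra.
  have k2 : `|y - q| <= del by rewrite ler_norml; lra.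
  lra.
nra.
Qed.

Lemma pi2_gt0 : 0 < pi *+ 2 :> R.
Proof. by rewrite pmulrn_lgt0// pi_gt0. Qed.

Definition cmean (F : R[i] -> R[i]) (t : R) : R[i] :=
  ((pi *+ 2)^-1)%:C * cint (fun th => F (polar t th)) 0 (pi *+ 2).

Definition circc (t : R) F := forall z, cabs z = t -> contC F z.

Lemma circc_cint t F a b : 0 <= t -> circc t F -> ccontc a b (fun th => F (polar t th)).
Proof.
move=> t0 Fc x _.
apply: (@continuous_comp _ _ _ (polar t : R -> R[i]^o) (F : R[i]^o -> R[i]^o)).
  exact: polar_cont.
by apply: Fc; rewrite cabs_polar ger0_norm.
Qed.

Lemma circcD t F G : circc t F -> circc t G -> circc t (fun z => F z + G z).
Proof. by move=> Fc Gc z zt; exact: (continuousD (Fc z zt) (Gc z zt)). Qed.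

Lemma circcZ t k F : circc t F -> circc t (fun z => k * F z).
Proof. by move=> Fc z zt; apply: (continuousM _ (Fc z zt)); exact: cst_continuous. Qed.

Lemma eq_cmean t F G : 0 <= t -> (forall z, cabs z = t -> F z = G z) ->
  cmean F t = cmean G t.
Proof.
move=> t0 FG; congr (_ * _); apply: eq_cint => x _.
by apply: FG; rewrite cabs_polar ger0_norm.
Qed.

Lemma cmeanD t F G : 0 <= t -> circc t F -> circc t G ->
  cmean (fun z => F z + G z) t = cmean F t + cmean G t.
Proof. by move=> t0 Fc Gc; rewrite /cmean cintD ?mulrDr//; exact: circc_cint. Qed.

Lemma cmeanZ t k F : 0 <= t -> circc t F ->
  cmean (fun z => k * F z) t = k * cmean F t.
Proof. by move=> t0 Fc; rewrite /cmean cintZ 1?mulrCA//; exact: circc_cint. Qed.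

Lemma cmean_cst t k : cmean (fun=> k) t = k.
Proof.
rewrite /cmean cint_cst ?ltW ?pi2_gt0// subr0 mulrA -rmorphM/= mulVf ?mul1r//.
by rewrite gt_eqF// pi2_gt0.
Qed.

Lemma cmean_le t F M : 0 <= t -> circc t F ->
  (forall z, cabs z = t -> cabs (F z) <= M) -> cabs (cmean F t) <= 2 * M.
Proof.
move=> t0 Fc FM; rewrite /cmean cabsM cabs_real ger0_norm ?invr_ge0 ?(ltW pi2_gt0)//.
rewrite ler_pdivrMl ?pi2_gt0// mulrC -[X in _ <= _ * X]subr0.
apply: cint_le; first by rewrite ltW// pi2_gt0.
- exact: circc_cint.
- by move=> x _; apply: FM; rewrite cabs_polar ger0_norm.
Qed.

(** In the variable [log z] the annulus is a rectangle on which [F] is periodic: the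
    integrals over the horizontal sides cancel, and those over the vertical sides are the
    two means.  The rectangle is halved at height [pi] so that each half contains at most
    one logarithm of the exceptional point [w]. *)
Lemma cmean_annulus F (w : R[i]) t0 t1 : 0 < t0 -> t0 <= t1 ->
  (forall z, t0 <= cabs z <= t1 -> contC F z) ->
  (forall z, t0 <= cabs z <= t1 -> z <> w -> derivC F z) ->
  cmean F t0 = cmean F t1.
Proof.
move=> t00 t01 Fc Fd; have t10 := lt_le_trans t00 t01.
pose H z := F (cexp z); pose a := ln t0; pose b := ln t1.
have ab : a <= b by rewrite ler_ln.
have p0 := pi_gt0 R.
have mod z : a <= complex.Re z <= b -> t0 <= cabs (cexp z) <= t1.
  by rewrite cabs_cexp -(@ler_expR _ a) -(@ler_expR _ _ b) /a /b !lnK.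
have Hc : contr a b 0 (pi *+ 2) H.
  move=> z [zr _].
  apply: (@continuous_comp _ _ _ (cexp : R[i]^o -> R[i]^o) (F : R[i]^o -> R[i]^o)).
    exact/derivable_cont/derivable_cexp.
  exact/Fc/mod.
have Hd z : a <= complex.Re z <= b -> cexp z <> w -> derivC H z.
  move=> zr zw; apply/derivable1_diffP.
  apply: (@differentiable_comp _ _ _ _ (cexp : R[i]^o -> R[i]^o) (F : R[i]^o -> R[i]^o)).
    exact/derivable1_diffP/derivable_cexp.
  by apply/derivable1_diffP/Fd => //; exact: mod.
have half c : c = 0 \/ c = pi -> bint H a b c (c + pi) = 0.
  move=> c0pi; have c0 : 0 <= c by case: c0pi => ->; lra.
  have c1 : c + pi <= pi *+ 2 by rewrite mulr2n; case: c0pi => ->; lra.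
  apply: goursat_exc => //; first by lra.
    exact: contrS Hc.
  move=> z1 z2 [r1 i1] [r2 i2] n1 n2.
  have e1 : cexp z1 = w by apply: contrapT => ne; exact: n1 (Hd _ r1 ne).
  have e2 : cexp z2 = w by apply: contrapT => ne; exact: n2 (Hd _ r2 ne).
  by apply: (cexp_inj_half c0pi) => //; rewrite e1 e2.
have : bint H a b 0 (pi *+ 2) = 0.
  rewrite (bint_splity ab Hc (e := pi)); last by rewrite mulr2n; lra.
  have := half 0 (or_introl erefl); rewrite add0r => ->.
  by have := half pi (or_intror erefl); rewrite -mulr2n => ->; rewrite addr0.
rewrite /bint.
have -> : cint (fun x => H (x +i* 0)) a b = cint (fun x => H (x +i* (pi *+ 2))) a b.
  apply: eq_cint => x _; rewrite /H; congr F; rewrite /cexp /=.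
  by rewrite cos2pi sin2pi cos0 sin0.
rewrite subrr add0r => /eqP; rewrite mulf_eq0 => /orP[|].
  by rewrite -cabs_eq0 cabs_i oner_eq0.
rewrite subr_eq0 => /eqP E; rewrite /cmean; congr (_ * _).
under eq_cint do rewrite -(cexp_ln _ t00); under [RHS]eq_cint do rewrite -(cexp_ln _ t10).
by rewrite -/a -/b /H in E *; rewrite E.
Qed.

(** The radius may shrink to 0 by [cmean_annulus], so continuity at the origin is
    enough. *)
Lemma cmean_value F t : 0 < t -> contC F 0 ->
  (forall z, 0 < cabs z <= t -> derivC F z) -> cmean F t = F 0.
Proof.
move=> t0 F0 Fd.
apply/eqP; rewrite -subr_eq0 -cabs_eq0; apply/eqP/le_anti; rewrite cabs_ge0 andbT.
apply/ler_addgt0Pr => e e0; rewrite add0r.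
have /ccontP /(_ _ (divr_gt0 e0 (ltr0n R 2))) /nbhs_cabsP[d d0 Hd] := F0.
pose s := Num.min t (d / 2).
have s0 : 0 < s by rewrite lt_min t0 divr_gt0.
have st : s <= t by rewrite ge_min lexx.
have sd : s < d by apply: le_lt_trans (_ : d / 2 < _); [rewrite ge_min lexx orbT|lra].
have Fd' z : s <= cabs z <= t -> derivC F z.
  by move=> /andP[h1 h2]; apply: Fd; rewrite (lt_le_trans s0 h1).
have Fc z : s <= cabs z <= t -> contC F z by move=> /Fd'/derivable_cont.
rewrite -(cmean_annulus s0 st Fc (w := 0)); last by move=> z /Fd'.
have Fs : circc s F by move=> z zs; apply: Fc; rewrite zs lexx st.
have cc k : circc s (fun=> k) by move=> z _; exact: cst_continuous.
have -> : cmean F s - F 0 = cmean (fun z => F z + - F 0) s.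
  by rewrite (@cmeanD s F (fun=> - F 0) (ltW s0) Fs (cc _)) cmean_cst.
rewrite (_ : e = 2 * (e / 2)); last by lra.
apply: cmean_le; [exact: ltW|exact: (@circcD s F (fun=> - F 0) Fs (cc _))|].
by move=> z zs; apply/ltW/Hd; rewrite subr0 zs.
Qed.

End CircleMean.

(** * Cauchy's formula *)

Section Cauchy.
Context {R : realType}.
Implicit Types F G H : R[i] -> R[i].

Local Notation derivC F z := (derivable (F : R[i]^o -> R[i]^o) z 1).
Local Notation contC F z := {for z, continuous (F : R[i]^o -> R[i]^o)}.

Lemma derivC_cst k z : derivC (fun=> k) z.
Proof. exact: derivable_cst. Qed.
Lemma derivC_id z : derivC (fun x => x) z.
Proof. exact: derivable_id. Qed.
Lemma derivCB F G z : derivC F z -> derivC G z -> derivC (fun x => F x - G x) z.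
Proof. exact: derivableB. Qed.
Lemma derivCM F G z : derivC F z -> derivC G z -> derivC (fun x => F x * G x) z.
Proof. exact: derivableM. Qed.
Lemma derivCV F z : F z != 0 -> derivC F z -> derivC (fun x => (F x)^-1) z.
Proof. exact: derivableV. Qed.
Lemma derivCX F n z : derivC F z -> derivC (fun x => F x ^+ n) z.
Proof.
move=> Fd; elim: n => [|n IH]; first exact: derivC_cst.
rewrite (_ : (fun _ => _) = (fun x => F x * F x ^+ n)); first exact: derivCM.
by apply/funext => x; rewrite exprS.
Qed.

Lemma near_derivC F G z : (exists2 d, 0 < d & forall w, cabs (w - z) < d -> F w = G w) ->
  derivC F z -> derivC G z.
Proof.
move=> nr; apply: near_eq_derivable.
exact/nbhs_cabsP.
Qed.

Lemma kernel_derivC (w z : R[i]) : z != w -> derivC (fun z => z / (z - w)) z.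
Proof.
move=> zw; apply: derivCM; first exact: derivC_id.
apply: derivCV; first by rewrite subr_eq0.
by apply: derivCB; [exact: derivC_id|exact: derivC_cst].
Qed.

Lemma cabs_neq (z w : R[i]) : cabs w < cabs z -> z != w.
Proof. by apply: contraTneq => ->; rewrite ltxx. Qed.

(** The mean is independent of the radius, and [z / (z - w)] tends to 1 on large
    circles. *)
Lemma cmean_kernel (w : R[i]) t : cabs w < t -> cmean (fun z => z / (z - w)) t = 1.
Proof.
move=> wt; have w0 := cabs_ge0 w; have t0 : 0 < t by exact: le_lt_trans wt.
have Kd z : t <= cabs z -> derivC (fun z => z / (z - w)) z.
  by move=> tz; apply/kernel_derivC/cabs_neq/(lt_le_trans wt tz).
apply/eqP; rewrite -subr_eq0 -cabs_eq0; apply/eqP/le_anti; rewrite cabs_ge0 andbT.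
apply/ler_addgt0Pr => e e0; rewrite add0r.
pose T := Num.max t (cabs w + 2 * (cabs w + 1) / e).
have tT : t <= T by rewrite le_max lexx.
have T0 := lt_le_trans t0 tT.
have TT : cabs w + 2 * (cabs w + 1) / e <= T by rewrite le_max lexx orbT.
rewrite (cmean_annulus t0 tT (w := 0)); first last.
- by move=> z /andP[/Kd].
- by move=> z /andP[/Kd/derivable_cont].
have Kc : circc T (fun z => z / (z - w)).
  by move=> z zT; apply/derivable_cont/Kd; rewrite zT.
have cc k : circc T (fun=> k) by move=> z _; exact: cst_continuous.
have -> : cmean (fun z => z / (z - w)) T - 1 = cmean (fun z => z / (z - w) + - 1) T.
  by rewrite (@cmeanD _ T (fun z => z / (z - w)) (fun=> - 1) (ltW T0) Kc (cc _)) cmean_cst.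
rewrite (_ : e = 2 * (e / 2)); last by lra.
apply: cmean_le; [exact: ltW|exact: (@circcD _ T (fun z => z / (z - w)) (fun=> - 1) Kc (cc _))|].
move=> z zT.
have zw : z - w != 0 by rewrite subr_eq0 cabs_neq// zT (lt_le_trans wt).
have -> : z / (z - w) + -1 = w / (z - w) by field.
rewrite cabsM cabsV ler_pdivrMr ?cabs_gt0//.
have := cabsB_ge z w; rewrite zT => h.
apply: le_trans (_ : e / 2 * (2 * (cabs w + 1) / e) <= _).
  by rewrite (_ : e / 2 * _ = cabs w + 1); [lra|field; rewrite gt_eqF].
by rewrite ler_pM2l; lra.
Qed.

Variables (rho : R) (q : R[i] -> R[i]).
Hypothesis q_hol : forall z, cabs z < rho -> derivC q z.

(** The function [G z = z (q z - q w) / (z - w)], completed at [w] by [w q'(w)], is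
    holomorphic except perhaps at [w], where it is continuous; so its mean is [G 0 = 0].
    Splitting the numerator leaves the mean of [q z (z / (z - w))] minus [q w] times
    the mean of the kernel, which is 1. *)
Theorem cauchy_formula (w : R[i]) t : 0 < t < rho -> cabs w < t ->
  cmean (fun z => q z * (z / (z - w))) t = q w.
Proof.
move=> /andP[t0 tr] wt.
have [->|w0] := eqVneq w 0.
  rewrite (eq_cmean (G := q)) ?ltW//.
    apply: cmean_value => //; last by move=> z /andP[_ zt]; exact/q_hol/(le_lt_trans zt).
    by apply/derivable_cont/q_hol; rewrite cabs0 (lt_trans t0).
  by move=> z zt; rewrite subr0 mulfV ?mulr1// -cabs_gt0 zt.
have [D HD] := (cderP q w).1 (q_hol (lt_trans wt tr)).
pose G z := if z == w then D * w else (q z - q w) / (z - w) * z.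
have Gd z : cabs z < rho -> z <> w -> derivC G z.
  move=> zr /eqP zw.
  apply: (@near_derivC (fun z => (q z - q w) / (z - w) * z)).
    exists (cabs (z - w)); first by rewrite cabs_gt0 subr_eq0.
    move=> y yz; rewrite /G ifN//; apply: contraTneq yz => ->.
    by rewrite cabsC ltxx.
  apply: derivCM; last exact: derivC_id.
  apply: derivCM; first by apply: derivCB; [exact: q_hol|exact: derivC_cst].
  apply: derivCV; first by rewrite subr_eq0.
  by apply: derivCB; [exact: derivC_id|exact: derivC_cst].
have Gc z : cabs z < rho -> contC G z.
  move=> zr; have [zw|/eqP zw] := eqVneq z w; last by apply/derivable_cont/Gd.
  subst z; apply/ccontP => e e0.
  (* G z - D w = (difference quotient - D) w + difference quotient (z - w) *)
  pose B := cabs w + cabs D + 1.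
  have B0 : 0 < B by rewrite /B; have := cabs_ge0 w; have := cabs_ge0 D; lra.
  pose e1 := Num.min 1 (e / (4 * B)).
  have e10 : 0 < e1 by rewrite lt_min ltr01 divr_gt0// mulr_gt0.
  have e1B : e1 * B <= e / 4.
    by rewrite -ler_pdivlMr// ge_min; apply/orP; right; rewrite invfM mulrA.
  have e11 : e1 <= 1 by rewrite ge_min lexx.
  have [d d0 Hd] := HD e1 e10.
  apply/nbhs_cabsP; exists (Num.min d e1); first by rewrite lt_min d0.
  move=> z; rewrite lt_min => /andP[zd ze].
  rewrite /G eqxx; case: eqVneq => [_|zw]; first by rewrite subrr cabs0.
  have := Hd _ zd; rewrite (addrC w) subrK => h.
  have zw0 : z - w != 0 by rewrite subr_eq0.
  have {}h : cabs ((q z - q w) / (z - w) - D) <= e1.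
    rewrite (_ : _ - D = (q z - q w - D * (z - w)) / (z - w)); last by field.
    by rewrite cabsM cabsV ler_pdivrMr ?cabs_gt0.
  set Q := (q z - q w) / (z - w) in h *.
  rewrite (_ : Q * z - D * w = (Q - D) * w + (Q - D) * (z - w) + D * (z - w)); last by ring.
  have k1 := cabsD ((Q - D) * w + (Q - D) * (z - w)) (D * (z - w)).
  have k2 := cabsD ((Q - D) * w) ((Q - D) * (z - w)).
  rewrite !cabsM in k1 k2.
  have m1 : cabs (Q - D) * cabs w <= e1 * cabs w by rewrite ler_wpM2r ?cabs_ge0.
  have m2 : cabs (Q - D) * cabs (z - w) <= e1 * 1.
    by rewrite ler_pM ?cabs_ge0// (le_trans (ltW ze)).
  have m3 : cabs D * cabs (z - w) <= cabs D * e1 by rewrite ler_wpM2l ?cabs_ge0// ltW.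
  rewrite /B in e1B; nra.
pose s := cabs w / 2.
have s0 : 0 < s by rewrite divr_gt0// cabs_gt0.
have sw : s < cabs w by rewrite /s; have := cabs_gt0 w; rewrite w0; lra.
have st : s <= t by rewrite ltW// (lt_trans sw).
have G0 : cmean G t = 0.
  rewrite -(cmean_annulus s0 st (w := w)); first last.
  - by move=> z /andP[_ zt]; apply: Gd; exact: le_lt_trans tr.
  - by move=> z /andP[_ zt]; apply: Gc; exact: le_lt_trans tr.
  rewrite cmean_value//; first by rewrite /G eq_sym (negPf w0) mulr0.
  - by apply: Gc; rewrite cabs0 (lt_trans t0).
  - move=> z /andP[_ zs]; apply: Gd; first by rewrite (le_lt_trans zs)// (le_lt_trans st).
    by move=> zw; move: zs; rewrite zw leNgt sw.
have kc : circc t (fun z => z / (z - w)).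
  by move=> z zt; apply/derivable_cont/kernel_derivC/cabs_neq; rewrite zt.
have qc : circc t q by move=> z zt; apply/derivable_cont/q_hol; rewrite zt.
have qkc : circc t (fun z => q z * (z / (z - w))).
  by move=> z zt; exact: (continuousM (qc z zt) (kc z zt)).
have ckc : circc t (fun z => (- q w) * (z / (z - w))).
  by move=> z zt; apply: (continuousM _ (kc z zt)); exact: cst_continuous.
apply/eqP; rewrite -subr_eq0; apply/eqP; rewrite -[RHS]G0.
rewrite -[X in _ - X]mulr1 -(cmean_kernel wt) -mulNr -cmeanZ ?ltW// -cmeanD ?ltW//.
apply: eq_cmean; first exact: ltW.
move=> z zt; have zw : z != w by rewrite cabs_neq// zt.
by rewrite /G (negPf zw); field; rewrite subr_eq0.
Qed.

End Cauchy.

(** * Taylor coefficients as circle means *)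

Section TaylorCoef.
Context {R : realType}.
Implicit Types F G H : R[i] -> R[i].

Local Notation derivC F z := (derivable (F : R[i]^o -> R[i]^o) z 1).

Lemma derive1_eps F (z d : R[i]) (C e0 : R) : 0 < e0 -> 0 <= C ->
  (forall h, cabs h < e0 -> cabs (F (z + h) - F z - d * h) <= C * cabs h ^+ 2) ->
  derive1 (F : R[i]^o -> R[i]^o) z = d.
Proof.
move=> e00 C0 H.
rewrite /derive1; apply/cvg_lim => //; apply/cvgrPdist_le => e' /gt0_complex[e e_gt0 ->].
rewrite near_withinE; apply/nbhs_cabsP.
exists (Num.min e0 (e / (C + 1))); first by rewrite lt_min e00 divr_gt0//; lra.
move=> h; rewrite subr0 lt_min => /andP[h1 h2] h0.
rewrite normE lecR /GRing.scale/=.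
have hp : 0 < cabs h by rewrite cabs_gt0.
rewrite -(ler_pM2r hp) -cabsM.
rewrite (_ : (d - h^-1 * _) * h = - (F (z + h) - F z - d * h)).
  rewrite cabsN (le_trans (H h h1))// expr2 mulrA ler_pM2r//.
  have C1 : 0 < C + 1 by lra.
  move: h2; rewrite ltr_pdivlMr// => h2; nra.
by rewrite (addrC z) mulrBl mulrAC mulVf// mul1r [RHS]opprB.
Qed.

(** Meant for the resolvents [u = (z - w)^-1] and [v = (z - (w + h))^-1].  It is the
    derivative of [w -> (z - w)^-n] with a remainder that is uniform in [z], so that one
    can differentiate under the mean over the circle. *)
Lemma resolvent_pow (B : R) (n : nat) : 0 <= B ->
  exists2 C, 0 <= C & forall h u v : R[i], v - u = h * u * v ->
    cabs u <= B -> cabs v <= B ->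
    cabs (v ^+ n - u ^+ n) <= C * cabs h /\
    cabs (v ^+ n - u ^+ n - n%:R * h * u ^+ n.+1) <= C * cabs h ^+ 2.
Proof.
move=> B0; elim: n => [|n [C C0 IH]].
  exists 0 => // h u v _ _ _.
  by rewrite !expr0 subrr !mul0r subr0 cabs0.
pose K := B ^+ n.+2 + B * C.
have K0 : 0 <= K by rewrite addr_ge0 ?exprn_ge0 ?mulr_ge0.
exists (K + (B * K + B * C)); first by rewrite (addr_ge0 K0)// addr_ge0 ?(mulr_ge0 B0).
move=> h u v uv uB vB; have [IH1 IH2] := IH h u v uv uB vB.
have h0 := cabs_ge0 h; have u0 := cabs_ge0 u; have v0 := cabs_ge0 v.
have P1 : cabs (v ^+ n.+1 - u ^+ n.+1) <= K * cabs h.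
  have -> : v ^+ n.+1 - u ^+ n.+1 = v ^+ n * (v - u) + u * (v ^+ n - u ^+ n).
    by rewrite !exprS; ring.
  apply: le_trans (cabsD _ _) _; rewrite uv !cabsM cabsX mulrDl lerD//.
    rewrite (_ : _ * _ = cabs v ^+ n * (cabs u * cabs v) * cabs h); last by ring.
    apply: ler_wpM2r => //; rewrite -addn2 exprD expr2.
    by rewrite ler_pM ?mulr_ge0 ?exprn_ge0// ?lerXn2r ?nnegrE// ler_pM.
  by rewrite -mulrA ler_pM ?cabs_ge0.
split.
  apply: le_trans P1 _; apply: ler_wpM2r => //.
  by rewrite lerDl addr_ge0 ?mulr_ge0.
have -> : v ^+ n.+1 - u ^+ n.+1 - n.+1%:R * h * u ^+ n.+2 =
    h * u * (v ^+ n.+1 - u ^+ n.+1) + u * (v ^+ n - u ^+ n - n%:R * h * u ^+ n.+1).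
  have E : v ^+ n.+1 = u * v ^+ n + h * u * v ^+ n.+1.
    have vE : v = u + h * u * v by rewrite -uv addrC subrK.
    by rewrite exprS {1}vE; ring.
  by rewrite {1}E -natr1 !exprS; ring.
apply: le_trans (cabsD _ _) _; rewrite !cabsM mulrDl -[leLHS]add0r lerD ?mulr_ge0 ?exprn_ge0//.
rewrite mulrDl lerD//.
  rewrite (_ : B * K * _ = cabs h * B * (K * cabs h)); last by ring.
  by rewrite ler_pM ?mulr_ge0 ?cabs_ge0// ler_wpM2l.
by rewrite -[leRHS]mulrA ler_pM ?cabs_ge0.
Qed.

Lemma near_derive1 F G z d : 0 < d -> (forall w, cabs (w - z) < d -> F w = G w) ->
  derive1 (F : R[i]^o -> R[i]^o) z = derive1 (G : R[i]^o -> R[i]^o) z.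
Proof.
move=> d0 FG; rewrite !derive1E; apply: near_eq_derive.
by apply/nbhs_cabsP; exists d.
Qed.

Variables (rho : R) (q : R[i] -> R[i]).
Hypothesis q_hol : forall z, cabs z < rho -> derivC q z.
Hypothesis q_le1 : forall z, cabs z < rho -> cabs (q z) <= 1.

Definition cker t (k : nat) (w : R[i]) :=
  cmean (fun z => q z * (z * (z - w)^-1 ^+ k.+1)) t.

Lemma cker_circc t k w : 0 < t < rho -> cabs w < t ->
  circc t (fun z => q z * (z * (z - w)^-1 ^+ k.+1)).
Proof.
move=> /andP[t0 tr] wt z zt; apply: derivable_cont.
apply: derivCM; first by apply: q_hol; rewrite zt.
apply: derivCM; first exact: derivC_id.
apply: derivCX; apply: derivCV; first by rewrite subr_eq0 cabs_neq ?zt.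
by apply: derivCB; [exact: derivC_id|exact: derivC_cst].
Qed.

Lemma cmean_comb t (a h : R[i]) (F0 F1 F2 : R[i] -> R[i]) : 0 <= t ->
  circc t F0 -> circc t F1 -> circc t F2 ->
  cmean F0 t - cmean F1 t - a * cmean F2 t * h =
    cmean (fun z => F0 z + (- 1 * F1 z + - (a * h) * F2 z)) t /\
  circc t (fun z => F0 z + (- 1 * F1 z + - (a * h) * F2 z)).
Proof.
move=> t0 f0 f1 f2.
have c1 := circcZ (k := - 1) f1.
have c2 := circcZ (k := - (a * h)) f2.
have c3 := circcD c1 c2.
split; last exact: (circcD f0 c3).
by rewrite (cmeanD t0 f0 c3) (cmeanD t0 c1 c2) (cmeanZ _ t0 f1) (cmeanZ _ t0 f2); ring.
Qed.

(** The linear combination of means is the mean of a linear combination, which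
    [resolvent_pow] bounds pointwise. *)
Lemma cker_eps t k w : 0 < t < rho -> cabs w < t ->
  exists C e0, [/\ 0 <= C, 0 < e0 & forall h, cabs h < e0 ->
    cabs (cker t k (w + h) - cker t k w - k.+1%:R * cker t k.+1 w * h) <= C * cabs h ^+ 2].
Proof.
move=> tr wt; have /andP[t0 _] := tr; have t0' := ltW t0.
pose D := t - cabs w; have D0 : 0 < D by rewrite subr_gt0.
pose B := 2 / D; have B0 : 0 <= B by rewrite divr_ge0 ?ltW.
have [C C0 HC] := resolvent_pow k.+1 B0.
exists (2 * (t * C)), (D / 2); split; [by rewrite !mulr_ge0|by rewrite divr_gt0|].
move=> h hD.
have wht : cabs (w + h) < t by have := cabsD w h; rewrite /D in hD; lra.
have wcc := cker_circc (k := k) tr wt; have whcc := cker_circc (k := k) tr wht.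
have w1cc := cker_circc (k := k.+1) tr wt.
have [E c4] := cmean_comb (k.+1%:R) h t0' whcc wcc w1cc.
rewrite /cker E -mulrA; apply: cmean_le => //.
move=> z zt.
have zw : z - w != 0 by rewrite subr_eq0 cabs_neq// zt.
have zwh : z - (w + h) != 0 by rewrite subr_eq0 cabs_neq// zt.
have uB : cabs (z - w)^-1 <= B.
  rewrite cabsV /B -[leRHS]invrK lef_pV2 ?posrE ?cabs_gt0 ?invr_gt0 ?divr_gt0//.
  rewrite invf_div; have := cabsB_ge z w; rewrite zt -/D; lra.
have vB : cabs (z - (w + h))^-1 <= B.
  rewrite cabsV /B -[leRHS]invrK lef_pV2 ?posrE ?cabs_gt0 ?invr_gt0 ?divr_gt0//.
  rewrite invf_div; have := cabsB_ge z (w + h); have := cabsD w h.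
  rewrite /D in hD *; rewrite zt; lra.
have uv : (z - (w + h))^-1 - (z - w)^-1 = h * (z - w)^-1 * (z - (w + h))^-1.
  by field; rewrite zw zwh.
have {E} [_ E] := HC h _ _ uv uB vB.
set u := (z - w)^-1 in E *; set v := (z - (w + h))^-1 in E *.
rewrite (_ : _ + _ = q z * z * (v ^+ k.+1 - u ^+ k.+1 - k.+1%:R * h * u ^+ k.+2)); last by ring.
rewrite !cabsM zt -[t * _]mul1r -!mulrA ler_pM ?mulr_ge0 ?cabs_ge0//.
  by apply: q_le1; rewrite zt; have /andP[] := tr.
by rewrite ler_pM2l // mulrA.
Qed.

Theorem derive1n_cauchy t k w : 0 < t < rho -> cabs w < t ->
  derive1n k (q : R[i]^o -> R[i]^o) w = k`!%:R * cker t k w.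
Proof.
move=> tr; elim: k w => [|k IH] w wt.
  rewrite derive1n0 /cker fact0 mul1r -(cauchy_formula q_hol tr wt).
  have /andP[t0 _] := tr; apply: eq_cmean; first exact: ltW.
  by move=> z zt; rewrite expr1.
rewrite derive1nS.
rewrite (@near_derive1 _ (fun w => k`!%:R * cker t k w) w (t - cabs w)) ?subr_gt0//; last first.
  move=> y yw; apply: IH; have := cabsB_ge y w; lra.
have [C [e0 [C0 e00 H]]] := cker_eps k tr wt.
apply: (@derive1_eps _ _ _ (cabs k`!%:R * C) e0) => //.
  by rewrite mulr_ge0 ?cabs_ge0.
move=> h /H; move: (cker t k (w + h)) (cker t k w) (cker t k.+1 w) => a b c Hh.
rewrite factS natrM.
have -> : k`!%:R * a - k`!%:R * b - k.+1%:R * k`!%:R * c * h =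
  k`!%:R * (a - b - k.+1%:R * c * h) by ring.
by rewrite cabsM -[leRHS]mulrA ler_wpM2l ?cabs_ge0.
Qed.

Corollary taylor_coef_mean t k : 0 < t < rho ->
  taylor_coef q k = cmean (fun z => q z * (z^-1) ^+ k) t.
Proof.
move=> tr; have /andP[t0 _] := tr.
have k0 : k`!%:R != 0 :> R[i] by rewrite pnatr_eq0 -lt0n fact_gt0.
rewrite /taylor_coef (derive1n_cauchy _ tr) ?cabs0//.
transitivity (cker t k 0); first by apply: (mulIf k0); rewrite divfK// mulrC.
apply: eq_cmean; first exact: ltW.
by move=> z zt; congr (_ * _); rewrite subr0 exprS mulrA mulfV ?mul1r// -cabs_gt0 zt.
Qed.

Lemma circc_qX t (F : R[i] -> R[i]) : t < rho -> circc t F -> circc t (fun z => q z * F z).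
Proof.
move=> tr Fc z zt; apply: (continuousM _ (Fc z zt)).
by apply/derivable_cont/q_hol; rewrite zt.
Qed.

Lemma circcV t k : 0 < t -> circc t (fun z : R[i] => (z^-1) ^+ k).
Proof.
move=> t0 z zt; apply/derivable_cont/derivCX/derivCV/derivC_id.
by rewrite -cabs_gt0 zt.
Qed.

(** Cauchy's estimate; the factor 2 is inherited from [cint_le]. *)
Corollary taylor_coef_le t k : 0 < t < rho -> cabs (taylor_coef q k) <= 2 * t^-1 ^+ k.
Proof.
move=> tr; have /andP[t0 t1] := tr; rewrite (taylor_coef_mean _ tr).
apply: cmean_le; first exact: ltW.
  by apply: circc_qX => //; exact: circcV.
move=> z zt; rewrite cabsM cabsX cabsV zt ler_piMl ?exprn_ge0 ?invr_ge0 ?(ltW t0)//.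
by apply: q_le1; rewrite zt.
Qed.

Corollary cmean_posX t k : 0 < t < rho -> (0 < k)%N -> cmean (fun z => q z * z ^+ k) t = 0.
Proof.
move=> /andP[t0 t1] k0.
have Fd z : cabs z <= t -> derivC (fun z => q z * z ^+ k) z.
  move=> zt; apply: derivCM; first by apply: q_hol; exact: le_lt_trans t1.
  by apply: derivCX; exact: derivC_id.
rewrite cmean_value//; first by rewrite expr0n (negPf (lt0n_neq0 k0)) mulr0.
- by apply/derivable_cont/Fd; rewrite cabs0 ltW.
- by move=> z /andP[_ /Fd].
Qed.

End TaylorCoef.

(** * Euclidean norm and contractions *)

Section EuclideanNorm.
Context {R : realType}.

Definition dot (p : nat) (u w : 'cV[R]_p) : R := \sum_i u i 0 * w i 0.

Lemma dotC p (u w : 'cV[R]_p) : dot u w = dot w u.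
Proof. by apply: eq_bigr => i _; rewrite mulrC. Qed.

Lemma dotDl p (u v w : 'cV[R]_p) : dot (u + v) w = dot u w + dot v w.
Proof. by rewrite -big_split; apply: eq_bigr => i _; rewrite mxE mulrDl. Qed.

Lemma dotZl p a (u w : 'cV[R]_p) : dot (a *: u) w = a * dot u w.
Proof. by rewrite mulr_sumr; apply: eq_bigr => i _; rewrite mxE mulrA. Qed.

Lemma dotDr p (u v w : 'cV[R]_p) : dot w (u + v) = dot w u + dot w v.
Proof. by rewrite !(dotC w) dotDl. Qed.

Lemma dotZr p a (u w : 'cV[R]_p) : dot w (a *: u) = a * dot w u.
Proof. by rewrite !(dotC w) dotZl. Qed.

Lemma dotNr p (u w : 'cV[R]_p) : dot w (- u) = - dot w u.
Proof. by rewrite -scaleN1r dotZr mulN1r. Qed.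

Lemma dotBr p (u v w : 'cV[R]_p) : dot w (u - v) = dot w u - dot w v.
Proof. by rewrite dotDr dotNr. Qed.

Lemma dot0r p (w : 'cV[R]_p) : dot w 0 = 0.
Proof. by rewrite -(scale0r 0) dotZr mul0r. Qed.

Lemma dot_sumr p (I : Type) (s : seq I) (P : pred I) (F : I -> 'cV[R]_p) w :
  dot w (\sum_(i <- s | P i) F i) = \sum_(i <- s | P i) dot w (F i).
Proof.
elim/big_rec2: _ => [|i x y _ <-]; first exact: dot0r.
exact: dotDr.
Qed.

Lemma dot_ge0 p (u : 'cV[R]_p) : 0 <= dot u u.
Proof. by apply: sumr_ge0 => i _; rewrite -expr2 sqr_ge0. Qed.

Lemma enorm_ge0 p (u : 'cV[R]_p) : 0 <= enorm u.
Proof. exact: sqrtr_ge0. Qed.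

Lemma sqr_enorm p (u : 'cV[R]_p) : enorm u ^+ 2 = dot u u.
Proof.
rewrite /enorm sqr_sqrtr; last by apply: sumr_ge0 => i _; rewrite sqr_ge0.
by apply: eq_bigr => i _; rewrite expr2.
Qed.

Lemma enorm_le_sqr p (u : 'cV[R]_p) (c : R) : 0 <= c ->
  (enorm u <= c) = (dot u u <= c ^+ 2).
Proof. by move=> c0; rewrite -sqr_enorm ler_pXn2r// nnegrE enorm_ge0. Qed.

Lemma cauchy_schwarz p (u w : 'cV[R]_p) : `|dot u w| <= enorm u * enorm w.
Proof.
rewrite -(@ler_pXn2r _ 2)// ?nnegrE ?mulr_ge0 ?enorm_ge0//.
rewrite real_normK ?num_real// exprMn !sqr_enorm.
have [u0|u0] := eqVneq (dot u u) 0; last first.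
  have u1 : 0 < dot u u by rewrite lt_neqAle eq_sym u0 dot_ge0.
  have := dot_ge0 (dot u u *: w + (- dot u w) *: u).
  rewrite !(dotDl, dotDr, dotZl, dotZr) (dotC w u) => h.
  have : 0 <= dot u u * (dot u u * dot w w - dot u w ^+ 2).
    by rewrite (le_trans h)// le_eqVlt; apply/orP; left; apply/eqP; ring.
  by rewrite pmulr_rge0// subr_ge0.
suff -> : dot u w = 0 by rewrite expr0n u0 mul0r.
have u00 := psumr_eq0P (fun i (_ : true) => sqr_ge0 (u i 0)).
rewrite /dot big1// => i _.
have /eqP : u i 0 ^+ 2 = 0.
  by apply: u00 => //; rewrite -u0; apply: eq_bigr => j _; rewrite expr2.
by rewrite sqrf_eq0 => /eqP ->; rewrite mul0r.
Qed.

Lemma dot_le p (u w : 'cV[R]_p) : dot u w <= enorm u * enorm w.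
Proof. exact: le_trans (ler_norm _) (cauchy_schwarz _ _). Qed.

Lemma enormD p (u w : 'cV[R]_p) : enorm (u + w) <= enorm u + enorm w.
Proof.
rewrite enorm_le_sqr ?addr_ge0 ?enorm_ge0// sqrrD !sqr_enorm.
rewrite !(dotDl, dotDr) (dotC w u); have := dot_le u w; lra.
Qed.

Lemma enormZ p a (u : 'cV[R]_p) : enorm (a *: u) = `|a| * enorm u.
Proof.
apply/eqP; rewrite -(@eqrXn2 _ 2)// ?mulr_ge0 ?enorm_ge0//.
by rewrite exprMn real_normK ?num_real// !sqr_enorm dotZl dotZr mulrA -expr2.
Qed.

Lemma enormN p (u : 'cV[R]_p) : enorm (- u) = enorm u.
Proof. by rewrite -scaleN1r enormZ normrN1 mul1r. Qed.

Lemma enormB p (u w : 'cV[R]_p) : enorm (u - w) <= enorm u + enorm w.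
Proof. by rewrite -(enormN w) enormD. Qed.

Lemma enormC p (u w : 'cV[R]_p) : enorm (u - w) = enorm (w - u).
Proof. by rewrite -enormN opprB. Qed.

Lemma enorm0 p : enorm (0 : 'cV[R]_p) = 0.
Proof. by rewrite -(scale0r 0) enormZ normr0 mul0r. Qed.

Lemma enorm_sum p (I : Type) (s : seq I) (P : pred I) (F : I -> 'cV[R]_p) :
  enorm (\sum_(i <- s | P i) F i) <= \sum_(i <- s | P i) enorm (F i).
Proof.
elim/big_rec2: _ => [|i x y _ h]; first by rewrite enorm0.
by apply: le_trans (enormD _ _) _; rewrite lerD2l.
Qed.

Lemma coord_le_enorm p (u : 'cV[R]_p) i : `|u i 0| <= enorm u.
Proof.
rewrite -(@ler_pXn2r _ 2)// ?nnegrE ?enorm_ge0// real_normK ?num_real//.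
rewrite sqr_enorm /dot (bigD1 i)//= -expr2 lerDl.
by apply: sumr_ge0 => j _; rewrite -expr2 sqr_ge0.
Qed.

Lemma enorm_delta p (i : 'I_p) : enorm (delta_mx i 0 : 'cV[R]_p) = 1.
Proof.
rewrite /enorm (bigD1 i)//= big1 => [|k ki]; last by rewrite mxE (negPf ki) expr0n.
by rewrite mxE !eqxx expr1n addr0 sqrtr1.
Qed.

Lemma enorm_le_coord p (u : 'cV[R]_p) c : (forall i, `|u i 0| <= c) ->
  enorm u <= p%:R * c.
Proof.
move=> uc.
have -> : u = \sum_i u i 0 *: delta_mx i 0.
  apply/matrixP => i j; rewrite (ord1 j) summxE (bigD1 i)//= big1 => [|k ki].
    by rewrite !mxE !eqxx mulr1 addr0.
  by rewrite !mxE eq_sym (negPf ki) mulr0.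
apply: le_trans (enorm_sum _ _ _) _.
apply: (@le_trans _ _ (\sum_(i < p) c)); last by rewrite sumr_const card_ord mulr_natl.
by apply: ler_sum => i _; rewrite enormZ enorm_delta mulr1.
Qed.

(** Reduces estimates on vector-valued functions to scalar ones. *)
Lemma enorm_dual p (u : 'cV[R]_p) c : 0 <= c ->
  (forall w : 'cV[R]_p, dot w u <= c * enorm w) -> enorm u <= c.
Proof.
move=> c0 H; have := H u; rewrite -sqr_enorm expr2.
have [->|u0] := eqVneq (enorm u) 0; first by [].
by rewrite ler_pM2r// lt_neqAle eq_sym u0 enorm_ge0.
Qed.

Lemma contraction_le n (X : 'M[R]_n) (u : 'cV[R]_n) : contractions X ->
  enorm (X *m u) <= enorm u.
Proof.
move=> XC; have [u0|u0] := eqVneq (enorm u) 0.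
  have -> : u = 0.
    apply/matrixP => i j; rewrite (ord1 j) mxE; apply/eqP; rewrite -normr_le0 -u0.
    exact: coord_le_enorm.
  by rewrite mulmx0 enorm0.
have up : 0 < enorm u by rewrite lt_neqAle eq_sym u0 enorm_ge0.
pose u1 := (enorm u)^-1 *: u.
have u11 : enorm u1 = 1.
  by rewrite enormZ ger0_norm ?invr_ge0 ?enorm_ge0// mulVf.
have uE : u = enorm u *: u1 by rewrite scalerA divff// scale1r.
clearbody u1; rewrite [in leLHS]uE -scalemxAr enormZ ger0_norm ?enorm_ge0// ler_piMr ?enorm_ge0//.
apply: le_trans XC; apply: ub_le_sup; last first.
  by exists u1 => //; rewrite /cball/= u11.
pose K := \sum_i \sum_j `|X i j|.
exists (n%:R * K) => _ [y /= y1 <-].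
apply: enorm_le_coord => i; rewrite mxE.
apply: le_trans (ler_norm_sum _ _ _) _.
apply: (@le_trans _ _ (\sum_j `|X i j|)).
  apply: ler_sum => j _; rewrite normrM ler_piMr//.
  exact: le_trans (coord_le_enorm _ _) y1.
rewrite /K [leRHS](bigD1 i)//= lerDl; apply: sumr_ge0 => k _; exact: sumr_ge0.
Qed.

Lemma contractionX_le n (X : 'M[R]_n) k (u : 'cV[R]_n) : contractions X ->
  enorm (X ^+ k *m u) <= enorm u.
Proof.
move=> XC; elim: k => [|k IH]; first by rewrite expr0 mul1mx.
by rewrite exprS -mulmxA (le_trans (contraction_le _ XC)).
Qed.

End EuclideanNorm.

(** * Toeplitz sums *)

Section Toeplitz.
Context {R : realType}.
Local Notation derivC F z := (derivable (F : R[i]^o -> R[i]^o) z 1).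

Lemma circcX t k : circc t (fun z : R[i] => z ^+ k).
Proof. by move=> z zt; apply/derivable_cont/derivCX/derivC_id. Qed.

Lemma circc_sum t (I : Type) (s : seq I) (F : I -> R[i] -> R[i]) : 0 <= t ->
  (forall i, circc t (F i)) ->
  circc t (fun z => \sum_(i <- s) F i z) /\
  cmean (fun z => \sum_(i <- s) F i z) t = \sum_(i <- s) cmean (F i) t.
Proof.
move=> t0 Fc; elim: s => [|i s [IH1 IH2]].
  rewrite big_nil (_ : (fun z => _) = (fun=> 0)); last by apply/funext => z; rewrite big_nil.
  by split; [move=> z _; exact: cst_continuous|exact: cmean_cst].
rewrite big_cons (_ : (fun z => _) = (fun z => F i z + \sum_(i <- s) F i z)); last first.
  by apply/funext => z; rewrite big_cons.
pose S z := \sum_(i <- s) F i z.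
split; first exact: (@circcD _ t (F i) S (Fc i) IH1).
by rewrite (@cmeanD _ t (F i) S t0 (Fc i) IH1) IH2.
Qed.

Lemma Re_cmean_ge0 t (F : R[i] -> R[i]) : 0 <= t ->
  (forall z, cabs z = t -> 0 <= complex.Re (F z)) -> 0 <= complex.Re (cmean F t).
Proof.
move=> t0 F0; rewrite /cmean /cint /= mul0r subr0.
apply: mulr_ge0; first by rewrite invr_ge0 ltW// pi2_gt0.
by apply: rint_ge0 => x _; apply: F0; rewrite cabs_polar ger0_norm.
Qed.

Lemma ReZ (a : R) (w : R[i]) : complex.Re (a%:C * w) = a * complex.Re w.
Proof. by case: w => c d /=; rewrite mul0r subr0. Qed.

Lemma ReD (z w : R[i]) : complex.Re (z + w) = complex.Re z + complex.Re w.
Proof. by case: z; case: w. Qed.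

Lemma Re_sum (I : Type) (s : seq I) (F : I -> R[i]) :
  complex.Re (\sum_(i <- s) F i) = \sum_(i <- s) complex.Re (F i).
Proof.
by elim: s => [|i s IH]; rewrite ?big_nil ?big_cons// ReD IH.
Qed.

(** The power [e ^ (l - k)] with a signed exponent. *)
Definition unitpow (e : R[i]) (k l : nat) : R[i] :=
  if (l <= k)%N then (e^-1) ^+ (k - l) else e ^+ (l - k).

Lemma unitpowE e k l : cabs e = 1 ->
  unitpow e k l = ((e ^+ k)^*)%C * e ^+ l /\
  complex.Re (e ^+ (maxn k l - minn k l)) = complex.Re (unitpow e k l).
Proof.
move=> e1; have ee : e * (e^*)%C = 1.
  by rewrite -sqr_normc normE e1 expr1n.
have e0 : e != 0 by rewrite -cabs_gt0 e1.
have eV : e^-1 = (e^*)%C by apply: (mulfI e0); rewrite ee mulfV.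
have Re_conj (z : R[i]) : complex.Re (z^*)%C = complex.Re z by case: z.
rewrite /unitpow; case: leqP => lk.
  split; last by rewrite eV -rmorphXn/= Re_conj.
  rewrite eV rmorphXn/= -{2}(subnK lk) exprD -mulrA.
  by rewrite -exprMn (mulrC _ e) ee expr1n mulr1.
split=> //; rewrite -[in RHS](subnK (ltnW lk)) exprD rmorphXn/= mulrCA.
by rewrite -exprMn (mulrC _ e) ee expr1n mulr1.
Qed.

Variables (rho t : R) (q : R[i] -> R[i]).
Hypothesis tr : 0 < t < rho.
Hypothesis q_hol : forall z, cabs z < rho -> derivC q z.
Hypothesis q_le1 : forall z, cabs z < rho -> cabs (q z) <= 1.

(** The Taylor coefficients of [z -> q (t z)], which is bounded by 1 on the unit circle. *)
Definition tcoef (j : nat) : R := complex.Re (taylor_coef q j) * t ^+ j.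

Variables (V : lmodType R) (B : V -> V -> R).
Hypothesis BDl : forall u v w, B (u + v) w = B u w + B v w.
Hypothesis BZl : forall a u w, B (a *: u) w = a * B u w.
Hypothesis BC : forall u w, B u w = B w u.
Hypothesis B0 : forall u, 0 <= B u u.

Let BDr u v w : B w (u + v) = B w u + B w v.
Proof. by rewrite BC BDl !(BC w). Qed.
Let BZr a u w : B w (a *: u) = a * B w u.
Proof. by rewrite BC BZl (BC w). Qed.
Let Bsuml (I : Type) (s : seq I) (F : I -> V) w :
  B (\sum_(i <- s) F i) w = \sum_(i <- s) B (F i) w.
Proof.
elim: s => [|i s IH]; rewrite ?big_nil ?big_cons; last by rewrite BDl IH.
by rewrite -(scale0r 0) BZl mul0r.
Qed.
Let Bsumr (I : Type) (s : seq I) (F : I -> V) w :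
  B w (\sum_(i <- s) F i) = \sum_(i <- s) B w (F i).
Proof. by rewrite BC Bsuml; apply: eq_bigr => i _; rewrite BC. Qed.

(** Put [e_k = c k + i si k], [x = sum_k e_k x_k], [y = sum_k e_k y_k] and
    [a = al + i be], the value of a function bounded by 1.  Then the sum is
    [|a^* x - y| ^ 2 + (1 - |a| ^ 2) |x| ^ 2] for the sesquilinear extension of [B], the
    real and the imaginary parts being written separately. *)
Lemma toeplitz_pointwise (I : Type) (s : seq I) (c si : I -> R) (x y : I -> V) (al be : R) :
  al ^+ 2 + be ^+ 2 <= 1 ->
  0 <= \sum_(k <- s) \sum_(l <- s)
    ((B (x k) (x l) + B (y k) (y l)) * (c k * c l + si k * si l) -
     2 * B (x k) (y l) *
      (al * (c k * c l + si k * si l) - be * (c k * si l - si k * c l))).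
Proof.
move=> ab.
pose P := \sum_(k <- s) c k *: x k; pose S := \sum_(k <- s) si k *: x k.
pose P' := \sum_(k <- s) c k *: y k; pose S' := \sum_(k <- s) si k *: y k.
have BE (f g : I -> R) (u v : I -> V) :
    B (\sum_(k <- s) f k *: u k) (\sum_(k <- s) g k *: v k) =
    \sum_(k <- s) \sum_(l <- s) f k * g l * B (u k) (v l).
  rewrite Bsuml; apply: eq_bigr => k _; rewrite Bsumr; apply: eq_bigr => l _.
  by rewrite BZl BZr mulrA.
have -> : \sum_(k <- s) \sum_(l <- s)
    ((B (x k) (x l) + B (y k) (y l)) * (c k * c l + si k * si l) -
     2 * B (x k) (y l) *
      (al * (c k * c l + si k * si l) - be * (c k * si l - si k * c l))) =
    B P P + B S S + B P' P' + B S' S' - 2 * (al * B P P' + al * B S S' -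
     be * B P S' + be * B S P').
  rewrite /P /S /P' /S' !BE.
  rewrite !mulr_sumr -!big_split -sumrB -!big_split mulr_sumr -sumrB /=; apply: eq_bigr => k _.
  rewrite !mulr_sumr -!big_split -sumrB -!big_split mulr_sumr -sumrB /=; apply: eq_bigr => l _.
  ring.
have -> : B P P + B S S + B P' P' + B S' S' - 2 * (al * B P P' + al * B S S' -
     be * B P S' + be * B S P') =
    B (al *: P + be *: S + (-1) *: P') (al *: P + be *: S + (-1) *: P') +
    B (al *: S + (- be) *: P + (-1) *: S') (al *: S + (- be) *: P + (-1) *: S') +
    (1 - al ^+ 2 - be ^+ 2) * (B P P + B S S).
  rewrite !(BDl, BDr, BZl, BZr) (BC S P) (BC P' P) (BC P' S) (BC S' S) (BC S' P); ring.
apply: addr_ge0; first by apply: addr_ge0; exact: B0.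
apply: mulr_ge0; last by apply: addr_ge0; exact: B0.
by rewrite -addrA -opprD subr_ge0.
Qed.

(** With [e_k = z ^ k / t ^ k] on the circle of radius [t], the mean of the nonnegative
    expression of [toeplitz_pointwise] is [sum B x x + sum B y y - 2 sum B y y]: the means of
    [z ^ k] and of [q z z ^ k] vanish for [0 < k], and those of [q z z ^ -k] are the
    Taylor coefficients.  This is the contractivity of the triangular Toeplitz matrices of
    a function bounded by 1, acting on vectors of any space with a nonnegative form. *)
Theorem toeplitz_contraction (M : nat) (x y : 'I_M -> V) :
  (forall l, y l = \sum_(k < M | (l <= k)%N) tcoef (k - l) *: x k) ->
  \sum_(l < M) B (y l) (y l) <= \sum_(l < M) B (x l) (x l).
Proof.
move=> yE; have /andP[t0 t1] := tr; have t0' := ltW t0.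
have tn0 : t%:C != 0 :> R[i] by rewrite -cabs_gt0 cabs_real normr_gt0 gt_eqF.
pose G (k l : 'I_M) z := unitpow (z / t%:C) k l.
pose E (k l : 'I_M) (z : R[i]) := (z / t%:C) ^+ (maxn k l - minn k l).
pose a (k l : 'I_M) : R := B (x k) (x l) + B (y k) (y l).
pose b (k l : 'I_M) : R := - (2 * B (x k) (y l)).
pose F k l z := (a k l)%:C * E k l z + (b k l)%:C * (q z * G k l z).
have zt0 z : cabs z = t -> z != 0 by move=> zt; rewrite -cabs_gt0 zt.
have Ec k l : circc t (E k l).
  move=> z zt; apply/derivable_cont/derivCX/derivCM; [exact: derivC_id|exact: derivC_cst].
have Gc k l : circc t (G k l).
  move=> z zt; apply: derivable_cont; rewrite /G /unitpow.
  have dz : derivC (fun z => z / t%:C) z by apply: derivCM; [exact: derivC_id|exact: derivC_cst].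
  case: leqP => _; last exact: derivCX.
  by apply/derivCX/derivCV => //; rewrite mulf_neq0 ?invr_eq0// zt0.
have qGc k l : circc t (fun z => q z * G k l z).
  by apply: (circc_qX q_hol) => //; exact: Gc.
have Fc k l : circc t (F k l).
  by apply: circcD; apply: circcZ; [exact: Ec|exact: qGc].
have Emean k l : cmean (E k l) t = (k == l)%:R.
  rewrite cmean_value//.
  - rewrite /E mul0r expr0n subn_eq0; congr (nat_of_bool _)%:R.
    by rewrite geq_max !leq_min !leqnn /= andbT -eqn_leq.
  - apply/derivable_cont/derivCX/derivCM; [exact: derivC_id|exact: derivC_cst].
  - move=> z _; apply/derivCX/derivCM; [exact: derivC_id|exact: derivC_cst].
have Gmean k l : complex.Re (cmean (fun z => q z * G k l z) t) =
    if (l <= k)%N then tcoef (k - l) else 0.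
  rewrite /G /unitpow; case: leqP => lk.
    rewrite (eq_cmean (G := fun z => (t ^+ (k - l))%:C * (q z * (z^-1) ^+ (k - l))))//; last first.
      move=> z zt; rewrite invf_div exprMn rmorphXn/=; ring.
    rewrite cmeanZ//; last by apply: (circc_qX q_hol) => //; exact: circcV.
    by rewrite -(taylor_coef_mean q_hol q_le1 _ tr) ReZ mulrC.
  rewrite (eq_cmean (G := fun z => (t^-1 ^+ (l - k))%:C * (q z * z ^+ (l - k))))//; last first.
    by move=> z zt; rewrite exprMn rmorphXn/= fmorphV; ring.
  rewrite cmeanZ//; last by apply: (circc_qX q_hol) => //; exact: circcX.
  by rewrite (cmean_posX q_hol tr) ?subn_gt0// mulr0.
pose Psi z := \sum_(k < M) \sum_(l < M) F k l z.
have Fkc k := circc_sum (index_enum 'I_M) t0' (Fc k).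
have Psic := circc_sum (index_enum 'I_M) t0' (fun k => (Fkc k).1).
have Psi0 : 0 <= complex.Re (cmean Psi t).
  apply: Re_cmean_ge0 => // z zt.
  have e1 : cabs (z / t%:C) = 1.
    by rewrite cabsM cabsV cabs_real zt ger0_norm// mulfV// gt_eqF.
  set e := z / t%:C in e1.
  have qn : complex.Re (q z) ^+ 2 + complex.Im (q z) ^+ 2 <= 1.
    by rewrite -sqr_cabs expr_le1 ?cabs_ge0// q_le1// zt.
  have := toeplitz_pointwise (index_enum 'I_M) (fun k => complex.Re (e ^+ k))
     (fun k => complex.Im (e ^+ k)) x y qn.
  congr (_ <= _); rewrite Re_sum; apply: eq_bigr => k _; rewrite Re_sum; apply: eq_bigr => l _.
  rewrite /F ReD !ReZ /E -/e (unitpowE k l e1).2 /G -/e (unitpowE k l e1).1.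
  rewrite /a /b; case: (e ^+ k) => c1 s1; case: (e ^+ l) => c2 s2; case: (q z) => al be /=.
  ring.
rewrite (Psic.2) Re_sum in Psi0.
have S1 (k : 'I_M) : complex.Re (cmean (fun z => \sum_(l < M) F k l z) t) =
   \sum_(l < M) (a k l * (k == l)%:R + b k l * (if (l <= k)%N then tcoef (k - l) else 0)).
  rewrite (Fkc k).2 Re_sum; apply: eq_bigr => l _.
  rewrite (cmeanD t0' (circcZ (Ec k l)) (circcZ (qGc k l))).
  rewrite (cmeanZ _ t0' (Ec k l)) (cmeanZ _ t0' (qGc k l)) ReD (ReZ (a k l)) (ReZ (b k l)) Gmean Emean.
  by case: (k == l).
rewrite (eq_bigr _ (fun k _ => S1 k)) in Psi0.
have : \sum_(k < M) \sum_(l < M) (a k l * (k == l)%:R +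
       b k l * (if (l <= k)%N then tcoef (k - l) else 0)) =
   \sum_(k < M) B (x k) (x k) - \sum_(l < M) B (y l) (y l).
  transitivity (\sum_(k < M) a k k + \sum_(l < M) (- (2 * B (y l) (y l)))).
    rewrite [X in _ = _ + X](_ : _ = \sum_(l < M) \sum_(k < M)
        b k l * (if (l <= k)%N then tcoef (k - l) else 0)).
      rewrite [X in _ = _ + X]exchange_big/= -big_split/=.
      apply: eq_bigr => k _; rewrite big_split/=; congr (_ + _).
      rewrite (bigD1 k)//= eqxx mulr1 big1 ?addr0// => l lk.
      by rewrite eq_sym (negPf lk) mulr0.
    apply: eq_bigr => l _; rewrite {1}yE big_mkcond/= Bsuml mulr_sumr -sumrN.
    apply: eq_bigr => k _; case: leqP => _; first by rewrite BZl /b; ring.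
    by rewrite -(scale0r 0) BZl !(mul0r, mulr0) oppr0.
  by rewrite -sumrB -big_split/=; apply: eq_bigr => k _; rewrite /a; ring.
by move=> E1; rewrite E1 subr_ge0 in Psi0.
Qed.

End Toeplitz.

(** * Von Neumann's inequality for Taylor polynomials *)

Section VonNeumann.
Context {R : realType}.
Local Notation derivC F z := (derivable (F : R[i]^o -> R[i]^o) z 1).

Lemma geom_sum_le (x : R) m : 0 <= x < 1 -> \sum_(i < m) x ^+ i <= (1 - x)^-1.
Proof.
move=> /andP[x0 x1]; have x1' : 0 < 1 - x by rewrite subr_gt0.
rewrite -[leRHS]mul1r ler_pdivlMr// mulrC -opprB mulNr -subrX1 opprB.
by rewrite gerBl exprn_ge0.
Qed.

Lemma telescope (f : nat -> R) M : \sum_(i < M) (f i - f i.+1) = f 0%N - f M.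
Proof.
elim: M => [|M IH]; first by rewrite big_ord0 subrr.
by rewrite big_ord_recr/= IH addrA subrK.
Qed.

Variables (rho t : R) (q : R[i] -> R[i]).
Hypothesis t1 : 1 < t.
Hypothesis trho : t < rho.
Hypothesis q_hol : forall z, cabs z < rho -> derivC q z.
Hypothesis q_le1 : forall z, cabs z < rho -> cabs (q z) <= 1.

Let t0 : 0 < t := lt_trans ltr01 t1.
Let tr : 0 < t < rho. Proof. by rewrite t0 trho. Qed.
Let tau := t^-1.
Let tau0 : 0 < tau. Proof. by rewrite invr_gt0. Qed.
Let tau1 : tau < 1. Proof. by rewrite invf_lt1. Qed.

Definition recoef (j : nat) : R := complex.Re (taylor_coef q j).

Lemma recoef_le j : `|recoef j| <= 2 * tau ^+ j.
Proof. exact: le_trans (Re_le_cabs _) (taylor_coef_le q_hol q_le1 j tr). Qed.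

Variable n : nat.
Variables (X : 'M[R]_n) (v : 'cV[R]_n).
Hypothesis XC : contractions X.

(** The real part of the Taylor polynomial of [q] with [m] terms at [X], applied to [v];
    as [X] and [v] are real it only involves the real parts of the coefficients. *)
Definition tpoly (m : nat) : 'cV[R]_n := \sum_(i < m) recoef i *: (X ^+ i *m v).

Let K := 2 / (1 - tau).
Let K0 : 0 < K. Proof. by rewrite divr_gt0// subr_gt0. Qed.

Lemma tpoly_tail m k : enorm (tpoly (m + k) - tpoly m) <= K * tau ^+ m * enorm v.
Proof.
rewrite /tpoly big_split_ord/= addrAC subrr add0r.
apply: le_trans (enorm_sum _ _ _) _.
apply: (@le_trans _ _ (\sum_(i < k) (2 * tau ^+ m * enorm v) * tau ^+ i)).
  apply: ler_sum => i _; rewrite enormZ.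
  rewrite (_ : _ * _ * _ * _ = 2 * tau ^+ (m + i) * enorm v); last by rewrite exprD; ring.
  by rewrite ler_pM ?enorm_ge0// ?recoef_le// contractionX_le.
rewrite -mulr_sumr.
have := @geom_sum_le tau k; rewrite ltW// tau1 => /(_ isT) h.
apply: (@le_trans _ _ (2 * tau ^+ m * enorm v * (1 - tau)^-1)).
  by rewrite ler_wpM2l// !mulr_ge0 ?exprn_ge0 ?enorm_ge0// ltW.
by rewrite /K le_eqVlt; apply/orP; left; apply/eqP; ring.
Qed.

Lemma tpoly_le m : enorm (tpoly m) <= K * enorm v.
Proof.
have := tpoly_tail 0 m; rewrite add0n expr0 mulr1.
by rewrite {2}/tpoly big_ord0 subr0.
Qed.

(** Put [Y = tau X].  The form [B u w = <u, w> - <Y u, Y w>] is nonnegative since [X] is a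
    contraction, and [sum_j B (Y ^ j u) (Y ^ j u)] telescopes to at most [|u| ^ 2].  The
    Toeplitz matrix of [q] sends the vectors [x_j = Y ^ j v], [j < M], to
    [y_l = Y ^ l p_(M - l)] with [p_m] the Taylor polynomial with [m] terms at [X] applied
    to [v].  If all [p_m] were equal, [sum_l B y_l y_l] would telescope to
    [|p_M| ^ 2 - |Y ^ M p_M| ^ 2]; consecutive ones differ by an exponentially small
    vector, whence the loss. *)
Theorem von_neumann M :
  enorm (tpoly M) ^+ 2 <= enorm v ^+ 2 * (1 + (4 * K + 4) / (1 - tau) * tau ^+ M).
Proof.
pose B (u w : 'cV[R]_n) := dot u w - tau ^+ 2 * dot (X *m u) (X *m w).
have BDl u u' w : B (u + u') w = B u w + B u' w.
  by rewrite /B mulmxDr !dotDl; ring.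
have BZl a u w : B (a *: u) w = a * B u w.
  by rewrite /B -scalemxAr !dotZl; ring.
have BC u w : B u w = B w u by rewrite /B dotC (dotC (X *m u)).
have B0 u : 0 <= B u u.
  rewrite /B -!sqr_enorm subr_ge0 -exprMn ler_pXn2r ?nnegrE ?mulr_ge0 ?enorm_ge0 ?(ltW tau0)//.
  apply: (le_trans _ (contraction_le u XC)).
  by rewrite ler_piMl ?enorm_ge0 ?(ltW tau1).
pose x (j : 'I_M) : 'cV[R]_n := tau ^+ j *: (X ^+ j *m v).
pose y (l : 'I_M) : 'cV[R]_n := tau ^+ l *: (X ^+ l *m tpoly (M - l)).
have yE l : y l = \sum_(k < M | (l <= k)%N) tcoef t q (k - l) *: x k.
  rewrite /y /tpoly mulmx_sumr scaler_sumr.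
  rewrite (eq_bigr (fun k : 'I_M => recoef (k - l) *: (tau ^+ l *: (X ^+ k *m v)))); last first.
    move=> k lk; rewrite /x /tcoef !scalerA; congr (_ *: _).
    rewrite -mulrA [tau ^+ k](_ : _ = tau ^+ (k - l) * tau ^+ l); last by rewrite -exprD subnK.
    rewrite [X in _ * X = _]mulrA -exprMn mulfV ?gt_eqF// expr1n mul1r.
    by [].
  rewrite (eq_bigr (fun i : 'I_(M - l) => recoef i *: (tau ^+ l *: (X ^+ (i + l) *m v)))); last first.
    move=> i _; rewrite -scalemxAr mulmxA scalerA [_ * recoef i]mulrC -scalerA.
    by congr (_ *: (_ *: (_ *m _))); rewrite addnC exprD.
  rewrite -(big_mkord (fun k => (l <= k)%N) (fun k => recoef (k - l) *: (tau ^+ l *: (X ^+ k *m v)))).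
  rewrite -(big_mkord xpredT (fun i => recoef i *: (tau ^+ l *: (X ^+ (i + l) *m v)))).
  rewrite [RHS](big_cat_nat (n := l))//= ?(ltnW (ltn_ord l))//.
  rewrite [X in _ = X + _]big_nat_cond [X in _ = X + _]big1 ?add0r; last first.
    by move=> i /andP[/andP[_ il]]; rewrite leqNgt il.
  rewrite -[X in \sum_(X <= _ < M | _) _]add0n big_addn big_nat_cond [RHS]big_nat_cond.
  apply: eq_big => i; first by rewrite leq_addl.
  by move=> _; rewrite addnK.
have Tz := toeplitz_contraction tr q_hol q_le1 BDl BZl BC B0 yE.
pose Nx j := enorm (tau ^+ j *: (X ^+ j *m v)) ^+ 2.
have Bx l : B (x l) (x l) = Nx l - Nx l.+1.
  rewrite /B /x /Nx !sqr_enorm !exprS -scalemxAr mulmxA !(dotZl, dotZr); ring.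
have Sx : \sum_(l < M) B (x l) (x l) <= enorm v ^+ 2.
  rewrite (eq_bigr _ (fun l _ => Bx l)) telescope.
  by rewrite {1}/Nx expr0 scale1r expr0 mul1mx lerBlDr lerDl sqr_ge0.
pose N j := enorm (tau ^+ j *: (X ^+ j *m tpoly (M - j))) ^+ 2.
have By (l : 'I_M) : N l - N l.+1 - (4 * K + 4) * tau ^+ M * enorm v ^+ 2 * tau ^+ l <= B (y l) (y l).
  have lM : (M - l = (M - l.+1).+1)%N by rewrite subnSK.
  set u := X ^+ l.+1 *m tpoly (M - l.+1).
  set d := recoef (M - l.+1) *: (X ^+ l.+1 *m (X ^+ (M - l.+1) *m v)).
  have E : X *m (X ^+ l *m tpoly (M - l)) = u + d.
    by rewrite mulmxA -[X *m _]exprS lM /tpoly big_ord_recr/= mulmxDr -scalemxAr.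
  have uK : enorm u <= K * enorm v.
    exact: le_trans (contractionX_le _ _ XC) (tpoly_le _).
  have dK : enorm d <= 2 * tau ^+ (M - l.+1) * enorm v.
    rewrite enormZ ler_pM ?enorm_ge0// ?recoef_le//.
    by rewrite !(le_trans (contractionX_le _ _ XC)).
  have B1 : B (y l) (y l) = N l - tau ^+ l.+1 ^+ 2 * enorm (u + d) ^+ 2.
    rewrite /B /y /N -scalemxAr E !sqr_enorm !(dotZl, dotZr) (exprS tau l).
    by move: (tau ^+ l) (dot _ _) (dot _ _) => *; ring.
  have N1 : N l.+1 = tau ^+ l.+1 ^+ 2 * enorm u ^+ 2.
    by rewrite /N enormZ exprMn ger0_norm ?exprn_ge0 ?(ltW tau0).
  rewrite B1 N1; set p := tau ^+ (M - l.+1) in dK *.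
  have tM : tau ^+ M = tau ^+ l.+1 * p by rewrite -exprD subnKC.
  have p0 : 0 <= p by rewrite exprn_ge0 ?(ltW tau0).
  have p1 : p <= 1 by rewrite exprn_ile1 ?(ltW tau0) ?(ltW tau1).
  have v0 := enorm_ge0 v; have d0 := enorm_ge0 d; have u0 := enorm_ge0 u.
  have H1 : enorm (u + d) ^+ 2 <= enorm u ^+ 2 + (4 * K + 4) * p * enorm v ^+ 2.
    apply: (@le_trans _ _ ((enorm u + enorm d) ^+ 2)).
      by rewrite ler_pXn2r ?nnegrE ?enorm_ge0 ?addr_ge0 ?enorm_ge0// enormD.
    have m1 : enorm u * enorm d <= (K * enorm v) * (2 * p * enorm v) by rewrite ler_pM.
    have m2 : enorm d * enorm d <= (2 * p * enorm v) * (2 * 1 * enorm v).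
      rewrite ler_pM// (le_trans dK)// ler_wpM2r//; lra.
    rewrite !expr2; nra.
  have s0 : 0 <= tau ^+ l.+1 by rewrite exprn_ge0 ?(ltW tau0).
  have s1 : tau ^+ l.+1 <= tau ^+ l by rewrite exprS ler_piMl ?exprn_ge0 ?(ltW tau0) ?(ltW tau1).
  have H2 : tau ^+ l.+1 ^+ 2 * enorm (u + d) ^+ 2 <=
      tau ^+ l.+1 ^+ 2 * (enorm u ^+ 2 + (4 * K + 4) * p * enorm v ^+ 2).
    by rewrite ler_wpM2l ?sqr_ge0.
  have H3 : tau ^+ l.+1 ^+ 2 * ((4 * K + 4) * p * enorm v ^+ 2) <=
     (4 * K + 4) * tau ^+ M * enorm v ^+ 2 * tau ^+ l.
    rewrite tM; move: (tau ^+ l.+1) s0 s1 => s s0 s1.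
    have -> : s ^+ 2 * ((4 * K + 4) * p * enorm v ^+ 2) =
      (4 * K + 4) * (s * p) * enorm v ^+ 2 * s by ring.
    have k4 : 0 <= 4 * K + 4 by have := K0; lra.
    by rewrite ler_wpM2l// mulr_ge0 ?sqr_ge0// mulr_ge0// mulr_ge0.
  lra.
have Sy : \sum_(l < M) (N l - N l.+1 - (4 * K + 4) * tau ^+ M * enorm v ^+ 2 * tau ^+ l) <=
    \sum_(l < M) B (y l) (y l) by apply: ler_sum => l _; exact: By.
have := le_trans (le_trans (Sy) Tz) Sx.
rewrite sumrB telescope -mulr_sumr.
have NM : N M = 0.
  by rewrite /N subnn /tpoly big_ord0 mulmx0 scaler0 enorm0 expr0n.
rewrite NM subr0 {1}/N expr0 scale1r expr0 mul1mx subn0.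
have := @geom_sum_le tau M; rewrite ltW// tau1 => /(_ isT) h.
set S := \sum_(i < M) _ in h *.
have c0 : 0 <= (4 * K + 4) * tau ^+ M * enorm v ^+ 2.
  have k4 : 0 <= 4 * K + 4 by have := K0; lra.
  by rewrite mulr_ge0 ?sqr_ge0// mulr_ge0// exprn_ge0// ltW.
have := ler_wpM2l c0 h => h' h2.
rewrite mulrDr mulr1.
rewrite (_ : enorm v ^+ 2 * _ = (4 * K + 4) * tau ^+ M * enorm v ^+ 2 * (1 - tau)^-1); last by ring.
lra.
Qed.

End VonNeumann.

(** * The functional calculus as a limit of Taylor polynomials *)

Section HoloCalc.
Context {R : realType}.
Local Notation derivC F z := (derivable (F : R[i]^o -> R[i]^o) z 1).

Lemma geometric_dominated_cvg (u : nat -> R) (C tau : R) : 0 <= tau < 1 ->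
  (forall j, `|u j| <= C * tau ^+ j) ->
  exists l, forall e, 0 < e -> \forall N \near \oo, `|l - \sum_(j < N) u j| <= e.
Proof.
move=> /andP[tau0 tau1] uC.
have uc : cvgn (series u).
  apply: normed_cvg; apply: (@series_le_cvg _ _ (geometric C tau)) => //=.
  - by move=> j; apply: le_trans (uC j).
  - by apply: is_cvg_geometric_series; rewrite ger0_norm.
exists (limn (series u)) => e e0.
have /cvgrPdist_le /(_ e e0) := uc.
by apply: filterS => N; rewrite /series/= big_mkord.
Qed.

Lemma complex_series_lim (c : nat -> R[i]) (C tau : R) : 0 <= tau < 1 ->
  (forall j, cabs (c j) <= C * tau ^+ j) ->
  forall e, 0 < e -> \forall N \near \oo,
    cabs (lim ((fun N : nat => \sum_(j < N) c j : R[i]^o) @ \oo) - \sum_(j < N) c j) <= e.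
Proof.
move=> t01 cC.
have [a Ha] := geometric_dominated_cvg t01 (fun j => le_trans (Re_le_cabs (c j)) (cC j)).
have [b Hb] := geometric_dominated_cvg t01 (fun j => le_trans (Im_le_cabs (c j)) (cC j)).
have Im_sum N : complex.Im (\sum_(j < N) c j) = \sum_(j < N) complex.Im (c j).
  elim: N => [|N IH]; rewrite ?big_ord0 ?big_ord_recr//= -IH.
  by case: (\sum_(j < N) c j) (c N) => [? ?] [? ?].
have H e : 0 < e -> \forall N \near \oo, cabs ((a +i* b) - \sum_(j < N) c j) <= e.
  move=> e0; have e2 : 0 < e / 2 by rewrite divr_gt0.
  near=> N; apply: le_trans (cabs_le_ReIm _) _.
  have hr : `|a - \sum_(j < N) complex.Re (c j)| <= e / 2 by near: N; exact: Ha.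
  have hi : `|b - \sum_(j < N) complex.Im (c j)| <= e / 2 by near: N; exact: Hb.
  move: hr hi; rewrite -Re_sum -Im_sum; case: (\sum_(j < N) c j) => x y /= hr hi.
  lra.
have -> : lim ((fun N : nat => \sum_(j < N) c j : R[i]^o) @ \oo) = a +i* b; last exact: H.
apply/cvg_lim => //; apply/cvgrPdist_le => e' /gt0_complex[e e0 ->].
by apply: filterS (H e e0) => N; rewrite normE lecR.
Unshelve. all: by end_near. Qed.


Variables (rho t : R) (q : R[i] -> R[i]).
Hypothesis t1 : 1 < t.
Hypothesis trho : t < rho.
Hypothesis q_hol : forall z, cabs z < rho -> derivC q z.
Hypothesis q_le1 : forall z, cabs z < rho -> cabs (q z) <= 1.
Variable n : nat.
Variables (X : 'M[R]_n) (v : 'cV[R]_n).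
Hypothesis XC : contractions X.

(** The entries of [X ^ j] are bounded by 1, so the entrywise series of [holo_calc]
    converge geometrically and the bound on finite tails passes to the limit. *)
Lemma holo_calc_tail m :
  enorm (Re_mx (holo_calc q X) *m v - tpoly q X v m) <=
    2 / (1 - t^-1) * t^-1 ^+ m * enorm v.
Proof.
have t0 : 0 < t by rewrite (lt_trans ltr01).
have tr : 0 < t < rho by rewrite t0.
have tau01 : 0 <= t^-1 < 1 by rewrite invr_ge0 (ltW t0)/= invf_lt1.
have Xe j a b : `|(X ^+ j) a b| <= 1.
  have -> : (X ^+ j) a b = (X ^+ j *m (delta_mx b 0 : 'cV[R]_n)) a 0.
    rewrite mxE (bigD1 b)//= big1 ?addr0 => [|i ib]; first by rewrite mxE !eqxx mulr1.
    by rewrite mxE (negPf ib) mulr0.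
  apply: le_trans (coord_le_enorm _ _) _; apply: le_trans (contractionX_le _ _ XC) _.
  by rewrite enorm_delta.
pose c a b j := taylor_coef q j * ((X ^+ j) a b)%:C.
have cC a b j : cabs (c a b j) <= 2 * t^-1 ^+ j.
  rewrite cabsM cabs_real -[leRHS]mulr1 ler_pM ?cabs_ge0//.
  exact: (taylor_coef_le q_hol q_le1 j tr).
have lim_entry e : 0 < e -> \forall N \near \oo, forall ab : 'I_n * 'I_n,
    cabs (holo_calc q X ab.1 ab.2 - \sum_(j < N) c ab.1 ab.2 j) <= e.
  move=> e0; apply: filter_forall => -[a b] /=; rewrite mxE.
  exact: (complex_series_lim tau01 (cC a b) e0).
have tE N (a : 'I_n) : tpoly q X v N a 0 =
    \sum_b complex.Re (\sum_(j < N) c a b j) * v b 0.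
  rewrite /tpoly summxE.
  rewrite (eq_bigr (fun j : 'I_N => \sum_b complex.Re (c a b j) * v b 0)); last first.
    move=> j _; rewrite mxE mxE mulr_sumr; apply: eq_bigr => b _.
    by rewrite mulrA /c [taylor_coef _ _ * _]mulrC ReZ [recoef _ _ * _]mulrC.
  rewrite exchange_big; apply: eq_bigr => b _.
  by rewrite Re_sum mulr_suml.
set w := Re_mx _ *m v.
have w_lim e : 0 < e -> \forall N \near \oo, enorm (w - tpoly q X v N) <= e.
  move=> e0; pose S := n%:R * \sum_b `|v b 0| + 1.
  have S0 : 0 < S by rewrite ltr_wpDl// mulr_ge0// sumr_ge0.
  near=> N.
  have HN : forall ab : 'I_n * 'I_n,
    cabs (holo_calc q X ab.1 ab.2 - \sum_(j < N) c ab.1 ab.2 j) <= e / S.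
    by near: N; apply: lim_entry; rewrite divr_gt0.
  apply: (@le_trans _ _ (n%:R * (\sum_b (e / S) * `|v b 0|))).
    apply: enorm_le_coord => a; rewrite !mxE tE -sumrB.
    apply: le_trans (ler_norm_sum _ _ _) _; apply: ler_sum => b _.
    rewrite -mulrBl normrM ler_wpM2r// mxE.
    apply: le_trans (HN (a, b)); apply: le_trans (Re_le_cabs _) => /=.
    by case: (holo_calc q X a b) (\sum_(j < N) c a b j) => [? ?] [? ?].
  rewrite -mulr_sumr mulrCA -ler_pdivlMl ?divr_gt0// invf_div divfK ?gt_eqF//.
  by rewrite lerDl.
apply/ler_addgt0Pr => e e0.
have : \forall N \near \oo, enorm (w - tpoly q X v m) <= 2 / (1 - t^-1) * t^-1 ^+ m * enorm v + e.
  near=> N.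
  have mN : (m <= N)%N by near: N; exact: nbhs_infty_ge.
  have h1 : enorm (w - tpoly q X v N) <= e by near: N; exact: w_lim.
  have h2 := tpoly_tail t1 trho q_hol q_le1 v XC m (N - m); rewrite subnKC// in h2.
  rewrite -(subrK (tpoly q X v N) w) -addrA.
  by apply: le_trans (enormD _ _) _; rewrite [leRHS]addrC lerD.
by move=> [N _ /(_ N (leqnn N))].
Unshelve. all: by end_near. Qed.

End HoloCalc.

(** * Layered programs as operator recurrent networks *)

Section Programs.
Context {R : realType}.
Variable n : nat.

(** Entries are indexed by natural numbers, so that layers of different dimensions can be
    put in a list without dependent types.  The flag [lX] says whether the linear part
    also contains the term [X h], with the identity as weight matrix. *)
Record lay := Lay {
  ldim : nat;
  lbias : bool -> nat -> R;
  lwt : bool -> nat -> nat -> R;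
  lX : bool }.

Definition mulX (X : 'M[R]_n) (h : nat -> R) (a : nat) : R :=
  if insub a is Some i then \sum_(e < n) X i e * h e else 0.

Definition lin (d : nat) (h : nat -> R) (y : lay) (i : bool) (a : nat) : R :=
  lbias y i a + \sum_(c < d) lwt y i a c * h c.

Definition exec (X : 'M[R]_n) (d : nat) (h : nat -> R) (y : lay) (a : nat) : R :=
  lin d h y false a + (if lX y && (d == n) then mulX X h a else 0) +
  leaky 0 (lin d h y true a).

Fixpoint run (X : 'M[R]_n) (d : nat) (h : nat -> R) (p : seq lay) : nat -> R :=
  if p is y :: p' then run X (ldim y) (exec X d h y) p' else h.

Lemma run_rcons X d h p y :
  run X d h (rcons p y) = exec X (last d (map ldim p)) (run X d h p) y.
Proof. by elim: p d h => //= z p IH d h; rewrite IH. Qed.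

Lemma conform_mx_entry d (u : 'cV[R]_d) (f : nat -> R) (a : 'I_n) :
  (forall c, u c 0 = f c) ->
  conform_mx (0 : 'cV[R]_n) u a 0 = if d == n then f a else 0.
Proof.
move=> uf; have [dn|dn] := eqVneq d n; first by subst d; rewrite conform_mx_id uf.
by rewrite nonconform_mx ?dn// mxE.
Qed.

Variables (m d0 : nat) (h0 : nat -> R) (p : seq lay).
Hypothesis p0 : (0 < size p)%N.
Hypothesis pm : last d0 (map ldim p) = m.

Let y0 := Lay 0 (fun _ _ => 0) (fun _ _ _ => 0) false.
Definition pdim (l : nat) : nat := nth 0%N (d0 :: map ldim p) l.

Lemma pdim_out : pdim (size p) = m.
Proof. by rewrite /pdim -pm -[size p](size_map ldim) -last_nth. Qed.

Lemma slope0 : (0 : R) <= 0 <= (1 : R). Proof. by rewrite lexx ler01. Qed.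

Definition orn_of : orn R n m 2 := @Orn R n m 2 (size p) p0 pdim pdim_out
  (\col_a h0 a)
  (fun l i => \col_a lbias (nth y0 p l.-1) i a)
  (fun l k i => if k == 1%N then \matrix_(a, c) lwt (nth y0 p l.-1) i a c else 0)
  (fun l k i => if [&& k == 1%N, ~~ i & lX (nth y0 p l.-1)]
                then \matrix_(a, c) (a == c :> nat)%:R else 0)
  (fun=> 0)
  (fun=> slope0).

Lemma last_take l : (l <= size p)%N -> last d0 (map ldim (take l p)) = pdim l.
Proof.
move=> lp; rewrite /pdim (last_nth 0%N) map_take size_take size_map.
have -> : (if (l < size p)%N then l else size p) = l.
  by case: ltnP => // pl; apply/eqP; rewrite eqn_leq lp pl.
by case: l lp => //= l lp; rewrite nth_take.
Qed.

Lemma states_run X l : (l <= size p)%N -> forall j, (j <= l)%N ->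
  forall a : 'I_(pdim j), states orn_of X l j a 0 = run X d0 h0 (take j p) a.
Proof.
elim: l => [|l IH] lp j.
  by rewrite leqn0 => /eqP -> a; rewrite /= dfwithin mxE take0.
rewrite leq_eqVlt => /predU1P[->|jl] a; last first.
  rewrite /= dfwithout; first by apply: IH => //; exact: ltnW.
  by rewrite gtn_eqF.
have {}IH := IH (ltnW lp).
rewrite /= dfwithin (take_nth y0)// run_rcons last_take ?(ltnW lp)//.
set h := states orn_of X l.
have hE : forall a' : 'I_(pdim (l.+1 - 1)),
    h (l.+1 - 1)%N a' 0 = run X d0 h0 (take l p) a'.
  move=> a'; rewrite IH; last by rewrite subn1.
  by congr (run _ _ _ (take _ _) _); rewrite subn1.
have affE i : @affine_part _ _ _ _ orn_of X l.+1 h i a 0 =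
    lin (pdim l) (run X d0 h0 (take l p)) (nth y0 p l) i a +
    (if ~~ i && (lX (nth y0 p l) && (pdim l == n)) then mulX X (run X d0 h0 (take l p)) a else 0).
  rewrite /affine_part mxE /= mxE /lin -addrA; congr (_ + _).
  rewrite big_ltn_cond//= big_ltn_cond//= big_geq// addr0.
  rewrite (_ : (if (1 < l.+1)%N then _ else 0) = 0); last first.
    by case: ifP => // _; rewrite !mul0mx addr0.
  rewrite addr0 mxE; congr (_ + _).
    rewrite mxE; move: hE; rewrite /= (_ : pdim l = pdim (l.+1 - 1)); last by rewrite subn1.
    by move=> hE; apply: eq_bigr => c _; rewrite mxE hE.
  case: i => /=; first by rewrite mul0mx mxE.
  case: (lX _) => /=; last by rewrite mul0mx mxE.
  rewrite mxE /mulX; case: insubP => [i ia iE|/negP an].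
    rewrite (bigD1 i)//= big1 ?addr0; last first.
      move=> c ci; rewrite mxE -iE eq_sym.
      by rewrite (_ : (c == i :> nat) = false) ?mul0r//; apply/negbTE.
    rewrite mxE iE eqxx mul1r mxE.
    rewrite (eq_bigr (fun e : 'I_n => X i e *
      (if pdim (l.+1 - 1) == n then run X d0 h0 (take l p) e else 0))); last first.
      by move=> e _; congr (_ * _); exact: (conform_mx_entry e hE).
    rewrite subn1 /=.
    by case: eqP => // _; rewrite big1// => e _; rewrite mulr0.
  rewrite big1; first by case: ifP.
  move=> c _; rewrite mxE (_ : (a == c :> nat) = false) ?mul0r//.
  by apply/negbTE/eqP => ac; apply: an; rewrite ac.
rewrite /layer mxE affE /exec; congr (_ + _).
by rewrite mxE affE addr0.
Qed.

Lemma network_orn_of X (a : 'I_m) :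
  network orn_of X a 0 = run X d0 h0 p a.
Proof.
rewrite /network castmxE /= cast_ord_id.
by rewrite states_run// take_size.
Qed.

Lemma width_orn_of W : (d0 <= W)%N -> all (fun y => ldim y <= W)%N p ->
  (width orn_of <= W)%N.
Proof.
move=> d0W pW; apply/bigmax_leqP => -[l lp] _ /=.
rewrite /pdim; case: l lp => //= l lp.
have [ls|ls] := ltnP l (size p); last by rewrite nth_default// size_map.
rewrite (nth_map y0)//; exact: (all_nthP y0 pW).
Qed.

End Programs.

(** * Functions computed layer by layer *)

Section ReluMaps.
Context {R : realType}.

Definition relu (x : R) : R := Num.max x 0.

Lemma leaky0 (x : R) : leaky 0 x = relu x.
Proof. by rewrite /leaky mul0r. Qed.

Definition affine (T : finType) (f : (T -> R) -> R) : Prop :=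
  exists c (a : T -> R), forall h, f h = c + \sum_t a t * h t.

(** What one coordinate of a layer without a term [X h] can be.  A rectified value can be
    added but not subtracted. *)
Definition relu_map (T : finType) (f : (T -> R) -> R) : Prop :=
  exists al be, [/\ affine al, affine be & forall h, f h = al h + relu (be h)].

Lemma affine_cst (T : finType) (c : R) : affine (fun _ : T -> R => c).
Proof. by exists c, (fun=> 0) => h; rewrite big1 ?addr0// => t _; rewrite mul0r. Qed.

Lemma affine_coord (T : finType) (t : T) : affine (fun h : T -> R => h t).
Proof.
exists 0, (fun s => (s == t)%:R) => h; rewrite add0r (bigD1 t)//= eqxx mul1r.
by rewrite big1 ?addr0// => s /negPf ->; rewrite mul0r.
Qed.

Lemma affineD (T : finType) (f g : (T -> R) -> R) : affine f -> affine g ->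
  affine (fun h => f h + g h).
Proof.
move=> [c [a fE]] [d [b gE]]; exists (c + d), (fun t => a t + b t) => h.
rewrite fE gE addrACA -big_split; congr (_ + _).
by apply: eq_bigr => t _; rewrite mulrDl.
Qed.

Lemma affineZ (T : finType) k (f : (T -> R) -> R) : affine f -> affine (fun h => k * f h).
Proof.
move=> [c [a fE]]; exists (k * c), (fun t => k * a t) => h.
by rewrite fE mulrDr mulr_sumr; congr (_ + _); apply: eq_bigr => t _; rewrite mulrA.
Qed.

Lemma affineB (T : finType) (f g : (T -> R) -> R) : affine f -> affine g ->
  affine (fun h => f h - g h).
Proof.
move=> fa ga; have [c [a fE]] := affineD fa (affineZ (-1) ga).
by exists c, a => h; rewrite -fE mulN1r.
Qed.

Lemma affine_sum (T : finType) (I : Type) (s : seq I) (F : I -> (T -> R) -> R) :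
  (forall i, affine (F i)) -> affine (fun h => \sum_(i <- s) F i h).
Proof.
move=> Fa; elim: s => [|i s [c [a E]]].
  have [c [a E]] := affine_cst T 0; exists c, a => h.
  by rewrite big_nil -E.
have [d [b E']] := affineD (Fa i) (ex_intro _ c (ex_intro _ a E)).
by exists d, b => h; rewrite big_cons E'.
Qed.

Lemma affine_comp (S T : finType) (r : S -> T) (f : (S -> R) -> R) : affine f ->
  affine (fun h : T -> R => f (fun s => h (r s))).
Proof.
move=> [c [a fE]]; have := affineD (affine_cst T c)
  (affine_sum (index_enum S) (fun s => affineZ (a s) (affine_coord (r s)))).
by move=> [d [b E]]; exists d, b => h; rewrite fE -E.
Qed.

Lemma affine_relu_map (T : finType) (f : (T -> R) -> R) : affine f -> relu_map f.
Proof.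
move=> fa; exists f, (fun=> 0); split=> //; first exact: affine_cst.
by move=> h; rewrite /relu maxxx addr0.
Qed.

Lemma relu_map_comp (S T : finType) (r : S -> T) (f : (S -> R) -> R) : relu_map f ->
  relu_map (fun h : T -> R => f (fun s => h (r s))).
Proof.
move=> [al [be [a b E]]].
exists (fun h => al (fun s => h (r s))), (fun h => be (fun s => h (r s))).
by split=> //; exact: affine_comp.
Qed.

End ReluMaps.

Section Computes.
Context {R : realType}.
Variable n : nat.

(** The hidden state is indexed by any finite type, laid out in a layer by [enum_rank], so
    that parallel units and their registers are products and sums of types. *)
Definition computes (W L : nat) (T : finType) (f : 'M[R]_n -> T -> R) : Prop :=
  exists (d0 : nat) (h0 : nat -> R) (p : seq (@lay R)),
  [/\ size p = L, (d0 <= W)%N, all (fun y => ldim y <= W)%N p,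
      last d0 (map (@ldim R) p) = #|T|
    & forall X t, run X d0 h0 p (enum_rank t) = f X t].

Definition decode (T : finType) (a : nat) : option T :=
  omap enum_val (insub a : option 'I_#|T|).

Lemma decodeK (T : finType) (t : T) : decode T (enum_rank t) = Some t.
Proof. by rewrite /decode valK /= enum_rankK. Qed.

Definition at_nat (T : finType) (f : T -> R) (a : nat) : R :=
  if decode T a is Some t then f t else 0.

Lemma at_natE (T : finType) (f : T -> R) t : at_nat f (enum_rank t) = f t.
Proof. by rewrite /at_nat decodeK. Qed.

Lemma computes_init W (T : finType) (h : T -> R) : (#|T| <= W)%N ->
  computes W 0 (fun _ => h).
Proof.
by move=> TW; exists #|T|, (at_nat h), [::]; split=> // X t; rewrite /= at_natE.
Qed.

Lemma sum_enum_rank (T : finType) (F : nat -> R) :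
  \sum_(c < #|T|) F c = \sum_(t : T) F (enum_rank t).
Proof.
rewrite (reindex (@enum_rank T)) //=; exact/onW_bij/enum_rank_bij.
Qed.

Lemma computes_relu W L (T T' : finType) (f : 'M[R]_n -> T -> R)
    (F : (T -> R) -> T' -> R) : computes W L f ->
  (forall t', relu_map (fun h => F h t')) -> (#|T'| <= W)%N ->
  computes W L.+1 (fun X => F (f X)).
Proof.
move=> [d0 [h0 [p [sp d0W pW dp E]]]] FR T'W.
have [ab abE] : exists ab : T' -> (R * (T -> R)) * (R * (T -> R)), forall t' h,
    F h t' = (ab t').1.1 + \sum_t (ab t').1.2 t * h t +
      relu ((ab t').2.1 + \sum_t (ab t').2.2 t * h t).
  suff /choice[ab abE] : forall t', exists ab : (R * (T -> R)) * (R * (T -> R)), forall h,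
    F h t' = ab.1.1 + \sum_t ab.1.2 t * h t + relu (ab.2.1 + \sum_t ab.2.2 t * h t).
    by exists ab.
  move=> t'; have [al [be [[c [a alE]] [c' [a' beE]] FE]]] := FR t'.
  by exists ((c, a), (c', a')) => h; rewrite FE alE beE.
pose pick (i : bool) t' := if i then (ab t').2 else (ab t').1.
pose y := Lay #|T'| (fun i => at_nat (fun t' => (pick i t').1))
  (fun i a c => at_nat (fun t' => at_nat (pick i t').2 c) a) false.
exists d0, h0, (rcons p y); split.
- by rewrite size_rcons sp.
- by [].
- by rewrite all_rcons pW T'W.
- by rewrite map_rcons last_rcons.
- move=> X t'; rewrite run_rcons dp /exec /= addr0 leaky0 abE.
  have linE i : lin #|T| (run X d0 h0 p) y i (enum_rank t') =
      (pick i t').1 + \sum_t (pick i t').2 t * f X t.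
    rewrite /lin /= at_natE; congr (_ + _).
    rewrite (sum_enum_rank T (fun c =>
      at_nat (fun t' => at_nat (pick i t').2 c) (enum_rank t') * run X d0 h0 p c)).
    by apply: eq_bigr => t _; rewrite !at_natE E.
  by rewrite !linE.
Qed.

(** One step of Horner's scheme [f -> b + X f]. *)
Lemma computes_horner W L (f : 'M[R]_n -> 'I_n -> R) (b : 'I_n -> R) :
  computes W L f -> (n <= W)%N ->
  computes W L.+1 (fun X i => b i + \sum_e X i e * f X e).
Proof.
move=> [d0 [h0 [p [sp d0W pW dp E]]]] nW.
pose y : @lay R := Lay n (fun i => if i then (fun=> 0) else at_nat b) (fun _ _ _ => 0) true.
have er (i : 'I_n) : enum_rank i = i :> nat by rewrite enum_rank_ord.
exists d0, h0, (rcons p y); split.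
- by rewrite size_rcons sp.
- by [].
- by rewrite all_rcons pW /= nW.
- by rewrite map_rcons last_rcons card_ord.
- have dn : last d0 (map (@ldim R) p) = n by rewrite dp card_ord.
  move=> X i; rewrite run_rcons dn /exec /= eqxx leaky0 /lin /=.
  have z0 (g : nat -> R) : \sum_(c < n) 0 * g c = 0 by rewrite big1// => c _; rewrite mul0r.
  rewrite !z0 !addr0 /relu maxxx addr0 at_natE /mulX er insubT ?ltn_ord//= => lt.
  congr (_ + _); apply: eq_bigr => e _; rewrite -E er.
  by congr (X _ _ * _); apply: val_inj.
Qed.

Lemma computes_orn W L m (f : 'M[R]_n -> 'I_m -> R) : (0 < L)%N -> computes W L f ->
  exists N : orn R n m 2, [/\ depth N = L, (width N <= W)%N &
    forall X, network N X = \col_i f X i].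
Proof.
move=> L0 [d0 [h0 [p [sp d0W pW dp E]]]].
have p0 : (0 < size p)%N by rewrite sp.
have pm : last d0 (map (@ldim R) p) = m by rewrite dp card_ord.
exists (@orn_of R n m d0 h0 p p0 pm); split=> //; first exact: width_orn_of.
move=> X; apply/matrixP => i j; rewrite (ord1 j) mxE network_orn_of -E.
by rewrite enum_rank_ord.
Qed.

End Computes.

(** * Approximate products by rectifiers *)

Section Squaring.
Context {R : realType}.

Definition tent (x : R) : R := 2 * x - relu (4 * x - 2).

Fixpoint sqa (s : nat) (x : R) : R :=
  if s is s'.+1 then relu (2 * x - 1) + sqa s' (tent x) / 4 else x.

Lemma reluE (x : R) : relu x = if 0 <= x then x else 0.
Proof. by rewrite /relu; case: (leP 0 x) => [/max_idPl|/ltW /max_idPr]. Qed.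

Lemma reluM (c x : R) : 0 <= c -> relu (c * x) = c * relu x.
Proof. by move=> c0; rewrite /relu maxr_pMr// mulr0. Qed.

Lemma tent01 x : 0 <= x <= 1 -> 0 <= tent x <= 1.
Proof. by rewrite /tent reluE; case: (leP 0 (4 * x - 2)) => h; lra. Qed.

(** On [[0, 1]] one has [x ^ 2 = relu (2 x - 1) + (tent x) ^ 2 / 4], and [tent] maps the
    interval to itself, so each level divides the error by 4. *)
Lemma sqaP s x : 0 <= x <= 1 ->
  [/\ 0 <= sqa s x - x ^+ 2, sqa s x - x ^+ 2 <= 4^-1 ^+ s.+1 & sqa s x <= x].
Proof.
elim: s x => [|s IH] x x01 /=.
  rewrite expr1; split; [nra| |by []].
  by have := sqr_ge0 (x - 2^-1); rewrite !expr2; lra.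
have [h1 h2 h3] := IH _ (tent01 x01).
have E : x ^+ 2 = relu (2 * x - 1) + tent x ^+ 2 / 4.
  rewrite /tent (_ : 4 * x - 2 = 2 * (2 * x - 1)) ?reluM//; last by ring.
  by rewrite reluE; case: (leP 0 (2 * x - 1)) => h; field.
rewrite E; split.
- by rewrite opprD addrACA subrr add0r -mulrBl divr_ge0.
- rewrite opprD addrACA subrr add0r -mulrBl [leRHS]exprS mulrC.
  by rewrite ler_wpM2l.
- by move: h3; rewrite /tent !reluE; case: (leP 0 (4 * x - 2)) => k;
    case: (leP 0 (2 * x - 1)) => k' h3; lra.
Qed.

Definition mulA (s : nat) (a b : R) : R :=
  sqa s (`|a + b| / 2) - sqa s (`|a - b| / 2).

(** The polarization [a b = (|a + b| / 2) ^ 2 - (|a - b| / 2) ^ 2] has its arguments in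
    [[0, 1]].  As both squares are approximated from above and within [[0, 1]], the
    difference again lies in [[-1, 1]] and can be multiplied further. *)
Lemma mulAP s a b : `|a| <= 1 -> `|b| <= 1 ->
  `|mulA s a b| <= 1 /\ `|mulA s a b - a * b| <= 4^-1 ^+ s.+1.
Proof.
move=> a1 b1.
have r1 : 0 <= `|a + b| / 2 <= 1.
  by rewrite divr_ge0//=; have := ler_normD a b; lra.
have r2 : 0 <= `|a - b| / 2 <= 1.
  by rewrite divr_ge0//=; have := ler_normB a b; lra.
have [p1 p2 p3] := sqaP s r1; have [q1 q2 q3] := sqaP s r2.
have E : a * b = (`|a + b| / 2) ^+ 2 - (`|a - b| / 2) ^+ 2.
  by rewrite !exprMn !real_normK ?num_real//; field.
rewrite /mulA; split.
  have k1 := sqr_ge0 (`|a + b| / 2); have k2 := sqr_ge0 (`|a - b| / 2).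
  rewrite ler_norml; lra.
by rewrite E ler_norml; lra.
Qed.

(** The hat functions of a grid, the coordinates clipped to [[-1, 1]] and the constant 1
    all have this form, so a network can evaluate any of them in the same layers. *)
Record rfactor (n : nat) := RFactor {
  fcoord : 'I_n; fscale : R; fshift : R; fw1 : R; fw2 : R; fcst : R }.

Definition farg n (phi : rfactor n) (y : 'I_n -> R) : R :=
  fscale phi * y (fcoord phi) + fshift phi.

Definition fval n (phi : rfactor n) (y : 'I_n -> R) : R :=
  let t := farg phi y in
  fcst phi + relu (t + 1) + fw1 phi * relu t + fw2 phi * relu (t - 1).

Definition prodA (s : nat) n (fs : seq (rfactor n)) (y : 'I_n -> R) : R :=
  foldl (fun P phi => mulA s P (fval phi y)) 1 fs.

(** All factors and partial products stay in [[-1, 1]], so the errors add up. *)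
Lemma prodAP s n (fs : seq (rfactor n)) y :
  (forall j phi0, (j < size fs)%N -> `|fval (nth phi0 fs j) y| <= 1) ->
  `|prodA s fs y| <= 1 /\
  `|prodA s fs y - \prod_(phi <- fs) fval phi y| <= (size fs)%:R * 4^-1 ^+ s.+1.
Proof.
elim/last_ind: fs => [|fs phi IH] f1.
  by rewrite /prodA /= big_nil subrr normr0 normr1 mul0r.
have {IH} [j phi0 jfs|IH1 IH2] := IH.
  have := f1 j phi0; rewrite size_rcons nth_rcons jfs; apply; exact: leqW.
have phi1 : `|fval phi y| <= 1.
  by have := f1 (size fs) phi; rewrite size_rcons nth_rcons ltnn eqxx; exact.
rewrite /prodA foldl_rcons -/(prodA s fs y) size_rcons -cats1 big_cat big_seq1/=.
have [m1 m2] := mulAP s IH1 phi1; split=> //.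
set p := prodA s fs y in IH1 IH2 m1 m2 *; set f := fval phi y in phi1 m1 m2 *.
set q := \prod_(_ <- _) _ in IH2 *.
rewrite (_ : mulA s p f - q * f = (mulA s p f - p * f) + (p - q) * f); last by ring.
apply: le_trans (ler_normD _ _) _; rewrite -natr1 [leRHS]mulrDl mul1r [leLHS]addrC lerD//.
by rewrite normrM -[leRHS]mulr1 ler_pM.
Qed.

End Squaring.

Section Units.
Context {R : realType}.
Variables (n : nat) (W : nat) (U : finType).

(** The registers of one multiplication unit: a copy of the input vector, the running
    product [rP], the three rectified values [r0], [r1], [r2] of the current factor, and
    for each of the two squares of the polarization its argument [u1], [u2] and the value
    [a1], [a2] accumulated so far. *)
Definition ureg : finType := ('I_n + (bool * bool * bool))%type.

Local Notation rP := (inr (false, false, false)).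
Local Notation r0 := (inr (false, false, true)).
Local Notation r1 := (inr (false, true, false)).
Local Notation r2 := (inr (false, true, true)).
Local Notation u1 := (inr (true, false, false)).
Local Notation u2 := (inr (true, false, true)).
Local Notation a1 := (inr (true, true, false)).
Local Notation a2 := (inr (true, true, true)).

Definition upd (h : ureg -> R) (vP v0 v1 v2 w1 w2 b1 b2 : R) : ureg -> R := fun t =>
  match t with
  | inl i => h (inl i)
  | rP => vP | r0 => v0 | r1 => v1 | r2 => v2
  | u1 => w1 | u2 => w2 | a1 => b1 | a2 => b2
  end.

Lemma upd_relu (vP v0 v1 v2 w1 w2 b1 b2 : (ureg -> R) -> R) :
  relu_map vP -> relu_map v0 -> relu_map v1 -> relu_map v2 ->
  relu_map w1 -> relu_map w2 -> relu_map b1 -> relu_map b2 ->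
  forall t, relu_map (fun h => upd h (vP h) (v0 h) (v1 h) (v2 h) (w1 h) (w2 h) (b1 h) (b2 h) t).
Proof.
move=> H1 H2 H3 H4 H5 H6 H7 H8 [i|[[[] []] []]] //=.
exact/affine_relu_map/affine_coord.
Qed.

Lemma relu_mapI (f g : (ureg -> R) -> R) : affine f -> affine g ->
  relu_map (fun h => f h + relu (g h)).
Proof. by move=> fa ga; exists f, g. Qed.

Lemma relu_map0 : relu_map (fun _ : ureg -> R => 0).
Proof. exact/affine_relu_map/affine_cst. Qed.

Lemma relu_mapR (g : (ureg -> R) -> R) : affine g -> relu_map (fun h => relu (g h)).
Proof.
move=> ga; exists (fun=> 0), g; split=> //; first exact: affine_cst.
by move=> h; rewrite add0r.
Qed.

(** The layers of one multiplication [P -> mulA s P f].  [opA] rectifies the argument of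
   the factor, [opB] forms the two arguments [|P + f| / 2] and [|P - f| / 2], each [opC] is
   one level of [sqa], and [opD] adds the last level and takes the difference.  As a layer
   cannot subtract a rectified value, [opC] iterates the opposite of the tent map, for
   which [opN] changes the signs beforehand. *)
Definition opA (phi : rfactor n) (h : ureg -> R) : ureg -> R :=
  let t := farg phi (fun i => h (inl i)) in
  upd h (h rP) (relu (t + 1)) (relu t) (relu (t - 1)) 0 0 0 0.

Definition facr (phi : rfactor n) (h : ureg -> R) : R :=
  fcst phi + h r0 + fw1 phi * h r1 + fw2 phi * h r2.

Definition opB (phi : rfactor n) (h : ureg -> R) : ureg -> R :=
  upd h 0 0 0 0
   (- 2^-1 * (h rP + facr phi h) + relu (h rP + facr phi h))
   (- 2^-1 * (h rP - facr phi h) + relu (h rP - facr phi h)) 0 0.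

Definition opN (h : ureg -> R) : ureg -> R :=
  upd h 0 0 0 0 (- 1 * h u1) (- 1 * h u2) 0 0.

Definition opC (j : nat) (h : ureg -> R) : ureg -> R :=
  upd h 0 0 0 0 (2 * h u1 + relu (- 4 * h u1 + - 2)) (2 * h u2 + relu (- 4 * h u2 + - 2))
   (h a1 + relu (2 * 4^-1 ^+ j * (- 1 * h u1 + - 2^-1)))
   (h a2 + relu (2 * 4^-1 ^+ j * (- 1 * h u2 + - 2^-1))).

Definition opD (s : nat) (h : ureg -> R) : ureg -> R :=
  upd h (h a1 + - (4^-1 ^+ s) * h u1 - (h a2 + - (4^-1 ^+ s) * h u2)) 0 0 0 0 0 0 0.

Ltac aff := repeat first [ exact: affine_coord | exact: affine_cst
  | apply: affineB | apply: affineD | apply: affineZ ].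

Lemma affine_facr phi : affine (facr phi).
Proof. rewrite /facr; aff. Qed.

Lemma opA_relu phi t : relu_map (fun h => opA phi h t).
Proof.
apply: upd_relu; try exact: relu_map0; try (apply: relu_mapR; rewrite /farg; aff).
by apply: affine_relu_map; aff.
Qed.

Lemma opB_relu phi t : relu_map (fun h => opB phi h t).
Proof.
have fa := affine_facr phi.
apply: upd_relu; try exact: relu_map0; apply: relu_mapI; repeat first [exact: fa|aff].
Qed.

Lemma opN_relu t : relu_map (fun h => opN h t).
Proof. by apply: upd_relu; try exact: relu_map0; apply: affine_relu_map; aff. Qed.

Lemma opC_relu j t : relu_map (fun h => opC j h t).
Proof. by apply: upd_relu; try exact: relu_map0; apply: relu_mapI; aff. Qed.

Lemma opD_relu s t : relu_map (fun h => opD s h t).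
Proof. by apply: upd_relu; try exact: relu_map0; apply: affine_relu_map; aff. Qed.

Hypothesis UW : (#|{: U * ureg}| <= W)%N.

Lemma computes_units L (h : 'M[R]_n -> U -> ureg -> R) (op : U -> (ureg -> R) -> ureg -> R) :
  (forall u t, relu_map (fun h => op u h t)) ->
  computes W L (fun X (ut : U * ureg) => h X ut.1 ut.2) ->
  computes W L.+1 (fun X (ut : U * ureg) => op ut.1 (h X ut.1) ut.2).
Proof.
move=> opR hc.
apply: (computes_relu (F := fun g (ut : U * ureg) => op ut.1 (fun t => g (ut.1, t)) ut.2) hc) => //.
move=> [u t] /=.
exact: (relu_map_comp (fun t => (u, t)) (opR u t)).
Qed.

(** The units work in parallel, each on its own copy of [y]; the values of the auxiliary
    registers are left unspecified between two multiplications. *)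
Definition units_hold L (y : 'M[R]_n -> 'I_n -> R) (P : 'M[R]_n -> U -> R) : Prop :=
  exists h : 'M[R]_n -> U -> ureg -> R,
  [/\ computes W L (fun X (ut : U * ureg) => h X ut.1 ut.2),
      forall X u i, h X u (inl i) = y X i & forall X u, h X u rP = P X u].

Lemma iter_opC (s : nat) (h : ureg -> R) :
  let h' := foldl (fun h j => opC j h) h (iota 0 s) in
  [/\ forall i, h' (inl i) = h (inl i),
      h' a1 + - (4^-1 ^+ s) * h' u1 = h a1 + sqa s (- h u1) &
      h' a2 + - (4^-1 ^+ s) * h' u2 = h a2 + sqa s (- h u2)].
Proof.
have H j : let h' := foldl (fun h j => opC j h) h (iota j s) in
  [/\ forall i, h' (inl i) = h (inl i),
      h' a1 + - (4^-1 ^+ (j + s)) * h' u1 = h a1 + 4^-1 ^+ j * sqa s (- h u1) &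
      h' a2 + - (4^-1 ^+ (j + s)) * h' u2 = h a2 + 4^-1 ^+ j * sqa s (- h u2)].
  elim: s j h => [|s IH] j h /=.
    by rewrite addn0; split=> //; rewrite mulrN mulNr.
  have [e1 e2 e3] := IH j.+1 (opC j h).
  have T x : 4^-1 ^+ j * (relu (2 * - x - 1) + sqa s (tent (- x)) / 4) =
     relu (2 * 4^-1 ^+ j * (- 1 * x + - 2^-1)) +
     4^-1 ^+ j.+1 * sqa s (- (2 * x + relu (- 4 * x + - 2))).
    rewrite (_ : 2 * 4^-1 ^+ j * _ = 4^-1 ^+ j * (2 * - x - 1)); last by field.
    rewrite reluM; last by rewrite exprn_ge0.
    rewrite (_ : - (2 * x + _) = tent (- x)).
      by rewrite exprSr mulrDr; congr (_ + _); rewrite mulrA mulrAC.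
    by rewrite /tent opprD; congr (_ - relu _); ring.
  split=> //.
  - by rewrite -addSnnS e2 /= T addrA.
  - by rewrite -addSnnS e3 /= T addrA.
have [e1 e2 e3] := H 0%N; split=> //.
  by rewrite -[s in 4^-1 ^+ s]add0n e2 expr0 mul1r.
by rewrite -[s in 4^-1 ^+ s]add0n e3 expr0 mul1r.
Qed.

Lemma half_abs (x : R) : - 2^-1 * x + relu x = `|x| / 2.
Proof. by rewrite reluE; case: ger0P => h; field. Qed.

Lemma units_mul L y P (phi : U -> rfactor n) s : units_hold L y P ->
  units_hold (L + (s + 4)) y (fun X u => mulA s (P X u) (fval (phi u) (y X))).
Proof.
move=> [h [hc hy hP]].
have c1 := computes_units (fun u => opA_relu (phi u)) hc.
have c2 := computes_units (h := fun X u => opA (phi u) (h X u)) (fun u => opB_relu (phi u)) c1.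
pose g0 X u := opB (phi u) (opA (phi u) (h X u)).
have c3 := computes_units (h := g0) (fun _ => opN_relu) c2.
pose g X u := opN (opB (phi u) (opA (phi u) (h X u))).
pose iterC k X u := foldl (fun h j => opC j h) (g X u) (iota 0 k).
have c4 k : computes W (L.+3 + k) (fun X (ut : U * ureg) =>
    foldl (fun h j => opC j h) (g X ut.1) (iota 0 k) ut.2).
  elim: k => [|k IH]; first by rewrite addn0.
  rewrite addnS -[in iota _ _](addn1 k) iotaD.
  have := computes_units (h := iterC k) (fun _ => opC_relu k) IH.
  congr (computes W _ _); apply/funext => X; apply/funext => ut.
  by rewrite foldl_cat.
have c5 := computes_units (h := iterC s) (fun _ => opD_relu s) (c4 s).
rewrite (_ : (L + (s + 4))%N = (L.+3 + s).+1); last by rewrite addnC -!addnA; lia.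
exists (fun X u => opD s (foldl (fun h j => opC j h) (g X u) (iota 0 s))).
split; [exact: c5| |] => X u /=.
- by move=> i; have [-> _ _] := iter_opC s (g X u); rewrite /g /= hy.
- have [_ -> ->] := iter_opC s (g X u); rewrite /g /=.
  rewrite !mulN1r !opprK !add0r !half_abs /mulA hP.
  have -> : facr (phi u) (opA (phi u) (h X u)) = fval (phi u) (y X).
    rewrite /facr /fval /= (_ : farg _ _ = farg (phi u) (y X))//.
    by rewrite /farg hy.
  by [].
Qed.

Lemma units_init L y : computes W L y -> units_hold L.+1 y (fun _ _ => 1).
Proof.
move=> yc.
exists (fun X u t => match t with inl i => y X i | rP => 1 | _ => 0 end); split=> //.
apply: (computes_relu (F := fun h (ut : U * ureg) =>
  match ut.2 with inl i => h i | rP => 1 | _ => 0 end) yc) => // -[u t] /=.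
by case: t => [i|[[[] []] []]]; apply: affine_relu_map; aff.
Qed.

Lemma units_prod L y (fs : U -> seq (rfactor n)) D s : (forall u, size (fs u) = D) ->
  computes W L y ->
  units_hold (L + 1 + D * (s + 4)) y (fun X u => prodA s (fs u) (y X)).
Proof.
move=> fsD yc; have [D0|D0] := posnP D.
  rewrite D0 mul0n addn0 addn1.
  have [h [h1 h2 h3]] := units_init yc; exists h; split=> // X u.
  by rewrite h3 /prodA (size0nil (etrans (fsD u) D0)).
have phi0 (u : U) : @rfactor R n.
  by case: (fs u) (fsD u) => [E|phi _ _]; [rewrite -E in D0|exact: phi].
have H k : (k <= D)%N ->
    units_hold (L + 1 + k * (s + 4)) y (fun X u => prodA s (take k (fs u)) (y X)).
  elim: k => [_|k IH kD].
    rewrite mul0n addn0 addn1.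
    by have [h [h1 h2 h3]] := units_init yc; exists h; split=> // X u; rewrite h3 take0.
  have := units_mul (fun u => nth (phi0 u) (fs u) k) s (IH (ltnW kD)).
  rewrite -addnA -mulSnr => -[h [h1 h2 h3]]; exists h; split=> // X u.
  by rewrite h3 (take_nth (phi0 u)) ?fsD// /prodA foldl_rcons.
have [h [h1 h2 h3]] := H D (leqnn D); exists h; split=> // X u.
by rewrite h3 take_oversize ?fsD.
Qed.

(** Each factor costs [s + 4] layers, whatever the number of units. *)
Theorem computes_products L m (y : 'M[R]_n -> 'I_n -> R) (fs : U -> seq (rfactor n)) D s
    (coef : U -> 'I_m -> R) : (forall u, size (fs u) = D) -> (m <= W)%N ->
  computes W L y ->
  computes W (L + 1 + D * (s + 4)).+1
    (fun X (o : 'I_m) => \sum_u coef u o * prodA s (fs u) (y X)).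
Proof.
move=> fsD mW yc; have [h [hc _ hP]] := units_prod s fsD yc.
have := computes_relu (F := fun g (o : 'I_m) => \sum_u coef u o * g (u, rP)) hc.
rewrite card_ord => /(_ _ mW).
rewrite (_ : (fun X => _) = (fun X o => \sum_u coef u o * prodA s (fs u) (y X))); last first.
  by apply/funext => X; apply/funext => o; apply: eq_bigr => u _; rewrite /= hP.
apply=> o; apply: affine_relu_map; apply: affine_sum => u; aff.
Qed.

End Units.

(** * Bounds on partial derivatives *)

Section CkNorm.
Context {R : realType}.

Lemma entry_le_norm p (u : 'cV[R]_p) i : `|u i 0| <= `|u|.
Proof.
rewrite [leRHS]mx_normrE.
exact: (le_bigmax_cond _ (fun ij : 'I_p * 'I_1 => `|u ij.1 ij.2|) (j := (i, 0))).
Qed.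

Lemma norm_le_entry p (u : 'cV[R]_p) c : 0 <= c -> (forall i, `|u i 0| <= c) -> `|u| <= c.
Proof.
move=> c0 uc; rewrite [leLHS]mx_normrE; apply: bigmax_le => // -[i j] _ /=.
by rewrite (ord1 j).
Qed.

Lemma norm_le_enorm p (u : 'cV[R]_p) : `|u| <= enorm u.
Proof. by apply: norm_le_entry; [exact: enorm_ge0|exact: coord_le_enorm]. Qed.

Lemma enorm_le_norm p (u : 'cV[R]_p) : enorm u <= p%:R * `|u|.
Proof. by apply: enorm_le_coord; exact: entry_le_norm. Qed.

Lemma enorm_continuous p : continuous (@enorm R p).
Proof.
move=> y; apply/(@cvgrPdist_le R R _ (nbhs y) (nbhs_filter y)) => e e0; apply/nbhs_ballP.
have p1 : 0 < p%:R + 1 :> R by rewrite ltr_wpDl.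
exists (e / (p%:R + 1)) => /=; first by rewrite divr_gt0.
move=> z; rewrite -ball_normE/= => yz.
have h : enorm (y - z) <= e.
  apply: le_trans (enorm_le_norm _) _.
  apply: (@le_trans _ _ ((p%:R + 1) * `|y - z|)); first by rewrite ler_wpM2r// lerDl.
  by rewrite mulrC -ler_pdivlMr// ltW.
have := enormD (y - z) z; rewrite subrK => h1.
have := enormD (z - y) y; rewrite subrK (enormC z y) => h2.
by rewrite ler_norml; lra.
Qed.

Lemma cball_compact p (rad : R) : compact (@cball R p rad).
Proof.
pose B := [set x : 'rV[R]_p | enorm x^T <= rad].
have -> : @cball R p rad = trmx @` B.
  apply/seteqP; split => [y yr|_ [x xB <-]//].
  by exists y^T; rewrite /B/= ?trmxK.
have trc : continuous (fun x : 'rV[R]_p => x^T).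
  move=> x; apply/(@cvgrPdist_le R _ _ (nbhs x) (nbhs_filter x)) => e e0; apply/nbhs_ballP.
  exists e => // z; rewrite -ball_normE/= => /ltW xz.
  apply: norm_le_entry; first exact: ltW.
  move=> i; apply: le_trans xz; rewrite !mxE.
  rewrite [leRHS]mx_normrE.
  have := le_bigmax_cond 0 (fun ij : 'I_1 * 'I_p => `|(x - z) ij.1 ij.2|) (j := (0, i)) (P := xpredT) isT.
  by rewrite /= !mxE.
apply: continuous_compact; first exact: continuous_subspaceT.
apply: bounded_closed_compact.
  exists rad; split; first exact: num_real.
  move=> M radM x xB /=; apply: (@le_trans _ _ rad); last exact: ltW.
  apply: le_trans xB; rewrite [leLHS]mx_normrE.
  apply: bigmax_le; first exact: enorm_ge0.
  move=> [i j] _ /=; rewrite (ord1 i).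
  by have := coord_le_enorm x^T j; rewrite mxE.
have -> : B = (fun x : 'rV[R]_p => enorm x^T) @^-1` [set t | t <= rad] by [].
apply: closed_comp; last exact: closed_le.
move=> x _; apply: continuous_comp; [exact: trc|exact: enorm_continuous].
Qed.

Lemma cball_limit_point p (rad : R) (y : 'cV[R]_p) : 0 < rad -> cball rad y ->
  ProperFilter (within (@eball R p rad) (nbhs y)).
Proof.
move=> r0 yr; apply: within_nbhs_proper => A /nbhs_ballP[e /= e0 H].
pose a := Num.min (1 / 2) (e / (2 * (rad + 1))).
have a0 : 0 < a by rewrite lt_min !divr_gt0//; lra.
have a1 : a <= 1 / 2 by rewrite ge_min lexx.
have ae : a * (2 * (rad + 1)) <= e.
  by rewrite -ler_pdivlMr ?ge_min ?lexx ?orbT//; lra.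
have y0 := enorm_ge0 y.
exists ((1 - a) *: y); split.
  rewrite /eball /= enormZ ger0_norm; last by lra.
  by rewrite /cball/= in yr; nra.
apply: H; rewrite -ball_normE/=.
rewrite (_ : y - _ = a *: y); last by rewrite scalerBl scale1r opprB addrC subrK.
apply: le_lt_trans (norm_le_enorm _) _; rewrite enormZ ger0_norm; last by lra.
by rewrite /cball/= in yr; nra.
Qed.

Variables (n m : nat).
Implicit Types g : 'cV[R]_n -> 'cV[R]_m.

Lemma Ck_open_extends k rad g : Ck_open k rad g -> extends_to_cball rad g.
Proof. by case: k => [|k] []. Qed.

Lemma Ck_openS k rad g : Ck_open k.+1 rad g -> Ck_open k rad g.
Proof.
elim: k g => [|k IH] g; first by case.
move=> [gE gD]; split=> // i; have [d1 d2] := gD i; split=> //.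
exact: IH.
Qed.

Lemma Ck_open_le j k rad g : (j <= k)%N -> Ck_open k rad g -> Ck_open j rad g.
Proof.
elim: k => [|k IH]; first by rewrite leqn0 => /eqP ->.
by rewrite leq_eqVlt => /predU1P[->//|jk] /Ck_openS; exact: IH.
Qed.

Lemma Ck_open_iter k a rad g i : (a <= k)%N -> Ck_open k rad g ->
  Ck_open (k - a) rad (iter a (partial i) g).
Proof.
elim: a => [|a IH] ak gC; first by rewrite subn0.
have := IH (ltnW ak) gC; rewrite -(subnSK ak) => -[_ /(_ i) [_ h]].
by rewrite iterS.
Qed.

Lemma Ck_open_foldr k rad g (e : 'I_n -> nat) (l : seq 'I_n) :
  (\sum_(i <- l) e i <= k)%N -> Ck_open k rad g ->
  Ck_open (k - \sum_(i <- l) e i) rad (foldr (fun i f => iter (e i) (partial i) f) g l).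
Proof.
elim: l => [|i l IH]; first by rewrite big_nil subn0.
rewrite big_cons => ek gC /=.
have lk : (\sum_(j <- l) e j <= k)%N by exact: leq_trans (leq_addl _ _) ek.
rewrite addnC subnDA; apply: Ck_open_iter; last exact: IH.
by rewrite leq_subRL//; rewrite addnC in ek.
Qed.

(** The open ball accumulates at each point of the closed one, so the limit that defines
    [mderiv_ext] is the value of any continuous extension. *)
Lemma mderiv_extE k (rad : R) g (al : {ffun 'I_n -> nat}) y : 0 < rad -> Ck_open k rad g ->
  (\sum_(i < n) al i <= k)%N -> forall E, {within @cball R n rad, continuous E} ->
  (forall z, eball rad z -> E z = mderiv al g z) -> cball rad y ->
  mderiv_ext rad al g y = E y.
Proof.
move=> r0 gC alk E Ec EE yr.
have PF := cball_limit_point r0 yr.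
apply/cvg_lim => //.
have Ey : E z @[z --> within (@eball R n rad) (nbhs y)] --> E y.
  have /subspace_continuousP /(_ y yr) h := Ec.
  apply: cvg_trans h; apply: cvg_app => A; rewrite /within /=.
  move=> hA; apply: (@filterS _ (nbhs y) _ [set x | cball rad x -> A x]) => //.
  by move=> z hz zr; apply: hz; exact: ltW.
apply: cvg_trans Ey; apply: near_eq_cvg.
by near=> z; apply: EE; near: z; exact: withinT.
Unshelve. all: by end_near. Qed.

(** The set under the supremum is bounded: there are finitely many multi-indices of order
    at most [k], and each derivative extends continuously to the compact ball. *)
Theorem mderiv_le_Ck_norm k (rad : R) g (al : {ffun 'I_n -> nat}) z :
  0 < rad -> Ck_open k rad g -> (\sum_(i < n) al i <= k)%N -> eball rad z ->
  enorm (mderiv al g z) <= Ck_norm k rad g.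
Proof.
move=> r0 gC alk zr.
have ext (be : {ffun 'I_n -> nat}) : (\sum_(i < n) be i <= k)%N ->
    extends_to_cball rad (mderiv be g).
  move=> bek; apply: (@Ck_open_extends (k - \sum_(i <- enum 'I_n) be i)).
  by apply: Ck_open_foldr => //; rewrite big_enum.
have zr' : cball rad z by exact: ltW.
apply: ub_le_sup; last first.
  exists al, z; split=> //.
  have [E [Ec EE]] := ext al alk.
  by rewrite (mderiv_extE r0 gC alk Ec EE zr') EE.
have bnd (be : {ffun 'I_n -> 'I_k.+1}) : exists M, forall y,
    (\sum_(i < n) be i <= k)%N -> cball rad y ->
    enorm (mderiv_ext rad [ffun i => nat_of_ord (be i)] g y) <= M.
  have [bek|bek] := leqP (\sum_(i < n) be i) k; last by exists 0 => y.
  have bek' : (\sum_(i < n) [ffun i => nat_of_ord (be i)] i <= k)%N.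
    by under eq_bigr do rewrite ffunE.
  have [E [Ec EE]] := ext _ bek'.
  have /compact_bounded [M [Mr HM]] := continuous_compact Ec (@cball_compact n rad).
  exists (m%:R * (M + 1)) => y _ yr.
  rewrite (mderiv_extE r0 gC bek' Ec EE yr); apply: le_trans (enorm_le_norm _) _.
  by rewrite ler_wpM2l//; apply: (HM (M + 1)); [rewrite ltrDl|exists y].
have /choice [M HM] := bnd.
exists (\sum_be `|M be|) => _ [be [y [bek yr ->]]].
have bes i : (be i < k.+1)%N.
  by rewrite ltnS; apply: leq_trans bek; rewrite (bigD1 i)//= leq_addr.
pose be' : {ffun 'I_n -> 'I_k.+1} := [ffun i => Ordinal (bes i)].
have -> : be = [ffun i => nat_of_ord (be' i)] by apply/ffunP => i; rewrite !ffunE.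
have sk : (\sum_(i < n) be' i <= k)%N by under eq_bigr do rewrite ffunE.
apply: le_trans (HM be' y sk yr) _; apply: le_trans (ler_norm _) _.
by rewrite (bigD1 be')//= lerDl sumr_ge0.
Qed.

End CkNorm.

(** * Taylor's formula along a coordinate axis *)

Section Taylor.
Context {R : realType}.

Lemma mean_value_le (f df : R -> R) (h C : R) :
  (forall x : R, `|x| <= `|h| -> is_derive x 1 f (df x)) ->
  (forall x, `|x| <= `|h| -> `|df x| <= C) -> `|f h - f 0| <= C * `|h|.
Proof.
move=> fd dC.
have MV a b : a <= b -> (forall x, a <= x <= b -> `|x| <= `|h|) ->
    `|f b - f a| <= C * `|b - a|.
  move=> ab sub.
  have [||c cab ->] := @MVT_segment R f df a b ab.
  - by move=> x; rewrite in_itv/= => /andP[ax xb]; apply/fd/sub; rewrite !ltW.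
  - apply: derivable_within_continuous => x; rewrite in_itv/= => xab.
    by have := fd x (sub x xab); case.
  by rewrite normrM ler_wpM2r// dC// sub// -in_itv.
have [h0|h0] := leP 0 h.
  rewrite -[X in _ <= _ * `|X|]subr0; apply: MV => // x /andP[x0 xh].
  by rewrite !ger0_norm.
rewrite distrC -[X in _ <= _ * X]normrN -[X in _ <= _ * `|X|]add0r.
apply: MV; first exact: ltW.
by move=> x /andP[hx x0]; rewrite !ler0_norm ?lerN2 ?(ltW h0).
Qed.

Lemma is_derive_monom (c x : R) a :
  is_derive x 1 (fun x => c * x ^+ a.+1 / a.+1`!%:R) (c * x ^+ a / a`!%:R).
Proof.
have -> : (fun x => c * x ^+ a.+1 / a.+1`!%:R) = (c / a.+1`!%:R) *: (@GRing.exp R ^~ a.+1).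
  by apply/funext => z; rewrite /GRing.scale/= mulrAC.
apply: DeriveDef; first exact/derivableZ/exprn_derivable.
rewrite deriveZ; last exact: exprn_derivable.
rewrite exp_derive /GRing.scale/= mulr1 factS natrM.
have a0 : a`!%:R != 0 :> R by rewrite pnatr_eq0 -lt0n fact_gt0.
have a1 : a.+1%:R != 0 :> R by rewrite pnatr_eq0.
move: (a.+1%:R : R) (a`!%:R : R) (x ^+ a) a0 a1 => k l z k0 l0.
by field; rewrite k0 l0.
Qed.

Lemma is_derive_monom0 (c x : R) : is_derive x 1 (fun x : R => c * x ^+ 0 / 0`!%:R) 0.
Proof.
rewrite (_ : (fun _ => _) = cst (c / 0`!%:R)); first exact: is_derive_cst.
by apply/funext => z; rewrite expr0 mulr1.
Qed.

Definition tay (c : nat -> R) K (x : R) : R := \sum_(a < K) c a * x ^+ a / a`!%:R.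

Lemma is_derive_tay c K (x : R) : is_derive x 1 (tay c K.+1) (tay (fun a => c a.+1) K x).
Proof.
elim: K => [|K IH].
  have := is_derive_monom0 (c 0%N) x; rewrite /tay big_ord0.
  by congr is_derive; apply/funext => z; rewrite big_ord_recr big_ord0/= add0r.
have := @is_deriveD _ _ _ _ _ _ _ _ _ IH (is_derive_monom (c K.+1) x K).
rewrite (_ : tay _ K.+1 x = tay (fun a => c a.+1) K x + c K.+1 * x ^+ K / K`!%:R).
  by congr is_derive; apply/funext => z; rewrite /tay [RHS]big_ord_recr.
by rewrite /tay big_ord_recr.
Qed.

(** By induction on [K] with the mean value inequality, which loses the factor [1 / K!] of
    the sharp remainder. *)
Lemma taylor1 K (phi : nat -> R -> R) (G h : R) :
  (forall a (x : R), (a < K)%N -> `|x| <= `|h| -> is_derive x 1 (phi a) (phi a.+1 x)) ->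
  (forall x, `|x| <= `|h| -> `|phi K x| <= G) ->
  `|phi 0%N h - tay (fun a => phi a 0) K h| <= G * `|h| ^+ K.
Proof.
elim: K phi h => [|K IH] phi h dphi bphi.
  by rewrite /tay big_ord0 subr0 expr0 mulr1 bphi.
pose psi x := phi 0%N x - tay (fun a => phi a 0) K.+1 x.
pose dpsi x := phi 1%N x - tay (fun a => phi a.+1 0) K x.
have psi0 : psi 0 = 0.
  rewrite /psi /tay big_ord_recl/= expr0 fact0 mulr1 divr1 big1 ?addr0 ?subrr// => i _.
  by rewrite exprS mul0r mulr0 mul0r.
rewrite -/(psi h) exprSr mulrA (_ : psi h = psi h - psi 0); last by rewrite psi0 subr0.
apply: (@mean_value_le _ dpsi) => x xh.
  apply: is_deriveB; first exact: dphi.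
  exact: is_derive_tay.
have := IH (fun a => phi a.+1) x; rewrite -/(dpsi x) => H.
have G0 : 0 <= G by apply: le_trans (bphi h _).
apply: le_trans (_ : G * `|x| ^+ K <= _); last first.
  by rewrite ler_wpM2l// lerXn2r ?nnegrE.
apply: H => [a y aK yx|y yx].
  by apply: dphi => //; exact: le_trans xh.
by apply: bphi; exact: le_trans xh.
Qed.

Variables (n m : nat).
Implicit Types f g : 'cV[R]_n -> 'cV[R]_m.

Lemma dot_continuous (w : 'cV[R]_m) : continuous (dot w).
Proof.
move=> y; apply/(@cvgrPdist_le R R _ (nbhs y) (nbhs_filter y)) => e e0; apply/nbhs_ballP.
pose c := enorm w * m%:R + 1.
have c0 : 0 < c by rewrite ltr_wpDl// mulr_ge0// enorm_ge0.
exists (e / c) => /=; first by rewrite divr_gt0.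
move=> z; rewrite -ball_normE/= => yz; rewrite -dotBr.
apply: le_trans (cauchy_schwarz _ _) _.
apply: (@le_trans _ _ (c * `|y - z|)); last by rewrite mulrC -ler_pdivlMr// ltW.
rewrite /c mulrDl mul1r -mulrA ler_wpDr// ler_wpM2l ?enorm_ge0//.
exact: enorm_le_norm.
Qed.

Lemma is_derive_dot f (w : 'cV[R]_m) (b v : 'cV[R]_n) (t : R) :
  derivable f (b + t *: v) v ->
  is_derive t 1 (fun t => dot w (f (b + t *: v))) (dot w ('D_v f (b + t *: v))).
Proof.
move=> fd.
have E : (fun h : R => h^-1 *: (dot w (f (b + (h *: 1 + t) *: v)) - dot w (f (b + t *: v)))) =
  (fun h : R => dot w (h^-1 *: (f (h *: v + (b + t *: v)) - f (b + t *: v)))).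
  apply/funext => h; rewrite dotZr dotBr; congr (_ * (dot w (f _) - _)).
  rewrite (_ : h *: 1 = h); last exact: mulr1.
  by rewrite scalerDl addrCA.
have C : (fun h : R => h^-1 *: (dot w (f (b + (h *: 1 + t) *: v)) - dot w (f (b + t *: v)))) @ 0^'
    --> dot w ('D_v f (b + t *: v)).
  by rewrite E; exact: (cvg_comp _ _ fd (@dot_continuous w _)).
apply: DeriveDef; first by apply/cvg_ex; exists (dot w ('D_v f (b + t *: v))).
exact: cvg_lim C.
Qed.

Lemma taylor_line f (i : 'I_n) (b : 'cV[R]_n) K (G h : R) : 0 <= G ->
  (forall a (t : R), (a < K)%N -> `|t| <= `|h| ->
     derivable (iter a (partial i) f) (b + t *: delta_mx i 0) (delta_mx i 0)) ->
  (forall t : R, `|t| <= `|h| -> enorm (iter K (partial i) f (b + t *: delta_mx i 0)) <= G) ->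
  enorm (f (b + h *: delta_mx i 0) -
    \sum_(a < K) (h ^+ a / a`!%:R) *: iter a (partial i) f b) <= G * `|h| ^+ K.
Proof.
move=> G0 fd fb; apply: enorm_dual => [|w]; first by rewrite mulr_ge0 ?exprn_ge0.
pose phi a (t : R) := dot w (iter a (partial i) f (b + t *: delta_mx i 0)).
have := @taylor1 K phi (G * enorm w) h; rewrite /tay mulrAC => H.
apply: le_trans (_ : `|phi 0%N h - \sum_(a < K) phi a 0 * h ^+ a / a`!%:R| <= _).
  apply: le_trans (ler_norm _); rewrite dotBr dot_sumr le_eqVlt; apply/orP; left; apply/eqP.
  congr (_ - _); apply: eq_bigr => a _.
  by rewrite /phi scale0r addr0 dotZr; ring.
apply: H => [a t aK th|t th].
  exact: is_derive_dot (fd a t aK th).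
apply: le_trans (cauchy_schwarz _ _) _.
by rewrite mulrC ler_wpM2r ?enorm_ge0// fb.
Qed.

End Taylor.

(** * Taylor polynomials in several variables *)

Lemma big_iota_ord (V : Type) (idx : V) (op : V -> V -> V) (F : nat -> V) K :
  \big[op/idx]_(a <- iota 0 K) F a = \big[op/idx]_(a < K) F a.
Proof. by rewrite -[in LHS](subn0 K) -/(index_iota 0 K) big_mkord. Qed.

Section TaylorTerms.
Context {R : realType}.
Variables (n m : nat).
Implicit Types f g : 'cV[R]_n -> 'cV[R]_m.

(** A polynomial in [y - x] with vector coefficients.  A monomial is the list of its
    coordinates with repetition: this is the product of factors that a network evaluates. *)
Definition terms := seq ('cV[R]_m * seq 'I_n).

Definition monom (x y : 'cV[R]_n) (s : seq 'I_n) : R := \prod_(i <- s) (y i 0 - x i 0).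

Definition teval (T : terms) (x y : 'cV[R]_n) : 'cV[R]_m :=
  \sum_(t <- T) monom x y t.2 *: t.1.

Definition terms_ok (T : terms) (G : R) (K : nat) (l : seq 'I_n) :=
  forall t, t \in T -> [/\ enorm t.1 <= G, (size t.2 < K)%N & {subset t.2 <= l}].

Lemma foldr_eq_in f (e e' : 'I_n -> nat) (l : seq 'I_n) : {in l, e =1 e'} ->
  foldr (fun i f => iter (e i) (partial i) f) f l =
  foldr (fun i f => iter (e' i) (partial i) f) f l.
Proof.
elim: l => //= i l IH ee; rewrite IH ?ee ?mem_head//.
by move=> j jl; rewrite ee// inE jl orbT.
Qed.

Lemma Ck_open_derivable k rad f i z : Ck_open k.+1 rad f -> eball rad z ->
  derivable f z (delta_mx i 0).
Proof. by move=> [_ /(_ i) [h _]] /h. Qed.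

(** The derivatives are taken in the order in which [mderiv] takes them when [l] is the list
    of all coordinates. *)
Definition deriv_bound (rad : R) (l : seq 'I_n) K f (G : R) :=
  forall e : 'I_n -> nat, (\sum_(i <- l) e i <= K)%N -> forall z, eball rad z ->
    enorm (foldr (fun i f => iter (e i) (partial i) f) f l z) <= G.

Lemma deriv_bound_Ck_norm k rad g : 0 < rad -> Ck_open k rad g ->
  deriv_bound rad (enum 'I_n) k g (Ck_norm k rad g).
Proof.
move=> r0 gC e ek z zr; have := @mderiv_le_Ck_norm R n m k rad g [ffun i => e i] z.
rewrite /mderiv (foldr_eq_in g (e' := e)); last by move=> i _; rewrite ffunE.
apply=> //; rewrite -big_enum; apply: leq_trans ek.
by rewrite leq_eqVlt; apply/orP; left; apply/eqP/eq_bigr => i _; rewrite ffunE.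
Qed.

Lemma Ck_norm_ge0 k rad g : 0 < rad -> Ck_open k rad g -> 0 <= Ck_norm k rad g.
Proof.
move=> r0 gC; have gb : deriv_bound rad (enum 'I_n) k g (Ck_norm k rad g).
  exact: deriv_bound_Ck_norm.
apply: le_trans (gb (fun=> 0%N) _ 0 _).
- exact: enorm_ge0.
- by rewrite big1.
- by rewrite /eball/= enorm0.
Qed.

Lemma deriv_bound_iter rad l i K f G a : uniq (rcons l i) -> (a <= K)%N ->
  deriv_bound rad (rcons l i) K f G -> deriv_bound rad l (K - a) (iter a (partial i) f) G.
Proof.
rewrite rcons_uniq => /andP[il _] aK H e eK z zr.
pose e' j := if j == i then a else e j.
have ee' : {in l, e' =1 e}.
  by move=> j jl; rewrite /e'; case: eqVneq => // ji; rewrite ji (negPf il) in jl.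
have := H e' _ z zr; rewrite foldr_rcons /= (foldr_eq_in _ ee').
rewrite {1}(_ : e' i = a); last by rewrite /e' eqxx.
apply.
rewrite -cats1 big_cat big_seq1 /= (_ : e' i = a); last by rewrite /e' eqxx.
rewrite big_seq.
rewrite (eq_bigr e) => [|j jl]; last by rewrite ee'.
rewrite -big_seq; move: eK aK; set S := \sum_(_ <- _) _; lia.
Qed.

Lemma mem_flatten_mkseq (T : eqType) (F : nat -> seq T) K t :
  t \in flatten (mkseq F K) -> exists2 a, (a < K)%N & t \in F a.
Proof.
by move=> /flattenP[s /mapP[a]]; rewrite mem_iota/= => aK -> ts; exists a.
Qed.

(** One coordinate at a time: Taylor's formula along the last coordinate of [l] has as
    coefficients the derivatives in that direction, to which the induction applies at the
    projected point.  In this way mixed derivatives only occur in the order of [mderiv]. *)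
Theorem taylor_terms rad (x : 'cV[R]_n) (del G : R) : 0 <= del -> 0 <= G ->
  (forall z : 'cV[R]_n, (forall j, `|z j 0 - x j 0| <= del) -> eball rad z) ->
  forall (l : seq 'I_n) K f, uniq l -> Ck_open K rad f -> deriv_bound rad l K f G ->
  exists T : terms, [/\ (size T <= K ^ size l)%N, terms_ok T G K l &
    forall y : 'cV[R]_n, (forall j, `|y j 0 - x j 0| <= del) ->
      (forall j, j \notin l -> y j 0 = x j 0) ->
      enorm (f y - teval T x y) <= (K.+1 ^ size l)%:R * (G * del ^+ K)].
Proof.
move=> del0 G0 box; elim/last_ind => [|l i IH] K f lu fC fb.
  have xb : eball rad x by apply: box => j; rewrite subrr normr0.
  have fx z : eball rad z -> enorm (f z) <= G.
    by move=> zr; apply: (fb (fun=> 0%N)) => //; rewrite big_nil.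
  case: K fC fb => [|K] fC fb.
    exists [::]; split=> // y yx _; rewrite /teval big_nil subr0 expr0 mulr1 mul1r.
    exact/fx/box.
  exists [:: (f x, [::])]; split=> // [t|y _ yx].
    by rewrite inE => /eqP -> /=; split; [exact: fx| |].
  have -> : y = x by apply/matrixP => j k; rewrite (ord1 k); exact: yx.
  rewrite /teval big_seq1 /monom big_nil scale1r subrr enorm0 mul1r.
  by rewrite mulr_ge0 ?exprn_ge0.
have lu' : uniq l by move: lu; rewrite rcons_uniq => /andP[].
have il : i \notin l by move: lu; rewrite rcons_uniq => /andP[].
have /choice[T TP] : forall a, exists T : terms, (a < K)%N ->
   [/\ (size T <= (K - a) ^ size l)%N, terms_ok T G (K - a) l &
    forall y : 'cV[R]_n, (forall j, `|y j 0 - x j 0| <= del) ->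
      (forall j, j \notin l -> y j 0 = x j 0) ->
      enorm (iter a (partial i) f y - teval T x y) <=
      ((K - a).+1 ^ size l)%:R * (G * del ^+ (K - a))].
  move=> a; have [aK|Ka] := ltnP a K; last by exists [::].
  have [|T TP] := IH (K - a)%N (iter a (partial i) f) lu' (Ck_open_iter i (ltnW aK) fC).
    exact: deriv_bound_iter lu (ltnW aK) fb.
  by exists T.
pose shiftT a (t : 'cV[R]_m * seq 'I_n) := ((a`!%:R)^-1 *: t.1, nseq a i ++ t.2).
pose T' : terms := flatten (mkseq (fun a => map (shiftT a) (T a)) K).
have fact1 a : 1 <= a`!%:R :> R by rewrite ler1n fact_gt0.
have fact0 a : 0 < a`!%:R :> R by rewrite ltr0n fact_gt0.
exists T'; split.
- rewrite size_rcons /T' size_flatten /shape -map_comp sumnE big_map big_iota_ord.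
  apply: (@leq_trans (\sum_(a < K) K ^ size l)).
    apply: leq_sum => a _; rewrite /= size_map; have [sT _ _] := TP a (ltn_ord a).
    by apply: leq_trans sT _; case: (size l) => // k; rewrite leq_exp2r// leq_subr.
  by rewrite sum_nat_const card_ord expnS.
- move=> t /mem_flatten_mkseq[a aK /mapP[t' tT ->]] /=.
  have [_ /(_ t' tT) [h1 h2 h3] _] := TP a aK; split.
    rewrite enormZ ger0_norm ?invr_ge0 ?(ltW (fact0 a))//; apply: le_trans h1.
    by rewrite ler_piMl ?enorm_ge0// invf_le1.
    by rewrite size_cat size_nseq -ltn_subRL.
  move=> j; rewrite mem_cat mem_rcons inE => /orP[/nseqP[-> _]|/h3 ->]; first by rewrite eqxx.
  by rewrite orbT.
- move=> y yx yl.
  pose h := y i 0 - x i 0; pose b := y - h *: delta_mx i 0.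
  have bj j : b j 0 = if j == i then x i 0 else y j 0.
    rewrite !mxE eqxx andbT; case: eqVneq => [->|_]; last by rewrite mulr0 subr0.
    by rewrite mulr1 /h opprB addrC subrK.
  have bx j : `|b j 0 - x j 0| <= del.
    by rewrite bj; case: eqVneq => [->|//]; rewrite subrr normr0.
  have bl j : j \notin l -> b j 0 = x j 0.
    move=> jl; rewrite bj; case: eqVneq => [->//|ji]; apply: yl.
    by rewrite mem_rcons inE negb_or ji.
  have seg (t : R) : `|t| <= `|h| -> eball rad (b + t *: delta_mx i 0).
    move=> th; apply: box => j.
    have -> : (b + t *: delta_mx i 0) j 0 = b j 0 + t * (j == i)%:R.
      by rewrite mxE; congr (_ + _); rewrite mxE mxE eqxx andbT.
    rewrite bj; case: eqVneq => [->|ji]; last by rewrite mulr0 addr0.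
    by rewrite mulr1 addrAC subrr add0r; exact: le_trans th (yx i).
  have L1 := @taylor_line R n m f i b K G h G0.
  have {}L1 : enorm (f y - \sum_(a < K) (h ^+ a / a`!%:R) *: iter a (partial i) f b) <=
      G * del ^+ K.
    have -> : y = b + h *: delta_mx i 0 by rewrite /b subrK.
    apply: (le_trans (L1 _ _)).
    - move=> a t aK th; apply: (@Ck_open_derivable (K - a.+1) rad); last exact: seg.
      by rewrite subnSK//; apply: Ck_open_iter => //; exact: ltnW.
    - move=> t th; pose e j := if j == i then K else 0%N.
      have ei : e i = K by rewrite /e eqxx.
      have := fb e _ _ (seg t th); rewrite foldr_rcons /= ei.
      have -> : foldr (fun i0 f0 => iter (e i0) (partial i0) f0) (iter K (partial i) f) l =
                iter K (partial i) f.
        elim: l il {IH lu fb lu' TP yl bl} => //= j l IHl; rewrite inE negb_or => /andP[ij jl].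
        by rewrite IHl// /e eq_sym (negPf ij).
      apply; rewrite -cats1 big_cat big_seq1/= ei big_seq big1 ?add0n// => j jl.
      by rewrite /e; case: eqVneq => // ji; rewrite -ji jl in il.
    - by rewrite ler_wpM2l// lerXn2r ?nnegrE//; exact: yx.
  have TE : teval T' x y = \sum_(a < K) (h ^+ a / a`!%:R) *: teval (T a) x b.
    rewrite /T' /teval big_flatten big_map big_iota_ord.
    apply: eq_bigr => a _; rewrite big_map scaler_sumr !big_seq; apply: eq_bigr => t tT.
    rewrite /shiftT /= !scalerA; congr (_ *: _).
    rewrite /monom big_cat big_nseq /= -/h iter_mulr_1 -mulrA mulrC.
    suff -> : \prod_(j <- t.2) (y j 0 - x j 0) = \prod_(j <- t.2) (b j 0 - x j 0) by ring.
    have [_ /(_ t tT) [_ _ tl] _] := TP a (ltn_ord a).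
    rewrite !big_seq; apply: eq_bigr => j /tl jl; rewrite bj.
    by case: eqVneq => // ji; rewrite -ji jl in il.
  rewrite TE -(subrK (\sum_(a < K) (h ^+ a / a`!%:R) *: iter a (partial i) f b) (f y)).
  rewrite -addrA; apply: le_trans (enormD _ _) _.
  have L2 : enorm (\sum_(a < K) (h ^+ a / a`!%:R) *: iter a (partial i) f b -
       \sum_(a < K) (h ^+ a / a`!%:R) *: teval (T a) x b) <=
     K%:R * ((K.+1 ^ size l)%:R * (G * del ^+ K)).
    rewrite -sumrB (eq_bigr (fun a : 'I_K => (h ^+ a / a`!%:R) *: (iter a (partial i) f b -
      teval (T a) x b))); last by move=> a _; rewrite scalerBr.
    apply: le_trans (enorm_sum _ _ _) _.
    apply: (@le_trans _ _ (\sum_(a < K) ((K.+1 ^ size l)%:R * (G * del ^+ K)))); last first.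
      by rewrite sumr_const card_ord [leRHS]mulr_natl.
    apply: ler_sum => a _; rewrite enormZ.
    have [_ _ /(_ b bx bl) h1] := TP a (ltn_ord a).
    have h2 : `|h ^+ a / a`!%:R| <= del ^+ a.
      rewrite normrM normfV [X in _ / X]ger0_norm ?(ltW (fact0 a))// normrX.
      apply: (@le_trans _ _ (`|h| ^+ a)).
        by rewrite ler_piMr ?exprn_ge0// invf_le1.
      by rewrite lerXn2r ?nnegrE//; exact: yx.
    apply: le_trans (ler_pM _ _ h2 h1) _ => //; first exact: enorm_ge0.
    rewrite [leLHS](_ : _ = ((K - a).+1 ^ size l)%:R * (G * (del ^+ a * del ^+ (K - a)))); last by ring.
    rewrite -exprD subnKC ?(ltnW (ltn_ord a))// ler_wpM2r ?mulr_ge0 ?exprn_ge0//.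
    rewrite ler_nat; case: (size l) => // k; rewrite leq_exp2r//; lia.
  apply: le_trans (lerD L1 L2) _.
  rewrite size_rcons expnS natrM -natr1.
  have e1 : 1 <= (K.+1 ^ size l)%:R :> R by rewrite ler1n expn_gt0.
  have g0 : 0 <= G * del ^+ K by rewrite mulr_ge0 ?exprn_ge0.
  move: (K%:R : R) ((K.+1 ^ size l)%:R : R) (G * del ^+ K) e1 g0 => k e g e1 g0.
  have : g <= e * g by rewrite ler_peMl.
  move=> h1; have -> : (k + 1) * e * g = k * (e * g) + e * g by ring.
  by rewrite [leLHS]addrC lerD2l.
Qed.

End TaylorTerms.

(** * Localized Taylor polynomials *)

Section Localization.
Context {R : realType}.
Variable n : nat.

Definition vfun (y : 'cV[R]_n) : 'I_n -> R := fun i => y i 0.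

(** The hat function centred at [c / N - 2] that vanishes outside distance [1 / N]. *)
Definition hatf (N : nat) (i : 'I_n) (c : nat) : rfactor n :=
  RFactor i N%:R ((2 * N)%:R - c%:R) (-2) 1 (0 : R).

Definition clipf (x : 'cV[R]_n) (i : 'I_n) : rfactor n := RFactor i 1 (- x i 0) 0 (-1) (-1).

Definition onef (i : 'I_n) : rfactor n := RFactor i 0 (- 1) 0 0 (1 : R).

Definition hat (t : R) : R := relu (t + 1) - 2 * relu t + relu (t - 1).

Lemma hat_ge0 t : 0 <= hat t.
Proof.
rewrite /hat !reluE; case: (leP 0 t); case: (leP 0 (t + 1)); case: (leP 0 (t - 1)); lra.
Qed.

Lemma hat_le1 t : hat t <= 1.
Proof.
rewrite /hat !reluE; case: (leP 0 t); case: (leP 0 (t + 1)); case: (leP 0 (t - 1)); lra.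
Qed.

Lemma hat_supp t : hat t != 0 -> `|t| <= 1.
Proof.
apply: contra_neqT; rewrite -ltNge ltr_normr => h.
rewrite /hat !reluE; case: (leP 0 t); case: (leP 0 (t + 1)); case: (leP 0 (t - 1)); lra.
Qed.

(** A hat is a second difference of [relu], so the sum over the grid telescopes. *)
Lemma hat_sum (M : nat) (t : R) : 0 <= t <= M%:R -> \sum_(c < M.+1) hat (t - c%:R) = 1.
Proof.
move=> /andP[t0 tM].
pose f (c : nat) := relu (t - c%:R + 1) - relu (t - c%:R).
rewrite (eq_bigr (fun c : 'I_M.+1 => f c - f c.+1)); last first.
  move=> c _; rewrite /hat /f -[c.+1%:R]natr1.
  rewrite (_ : t - (c%:R + 1) + 1 = t - c%:R); last by ring.
  by rewrite (_ : t - (c%:R + 1) = t - c%:R - 1); ring.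
rewrite telescope /f subr0 -[M.+1%:R]natr1 !reluE.
case: (leP 0 t); last by lra.
case: (leP 0 (t + 1)); last by lra.
case: (leP 0 (t - (M%:R + 1) + 1)); case: (leP 0 (t - (M%:R + 1))); lra.
Qed.

Lemma fval_hat N i c (y : 'cV[R]_n) :
  fval (hatf N i c) (vfun y) = hat (N%:R * y i 0 + (2 * N)%:R - c%:R).
Proof. by rewrite /fval /hat /farg /= add0r mul1r addrA mulNr. Qed.

Lemma fval_one i (y : 'I_n -> R) : fval (onef i) y = 1.
Proof.
rewrite /fval /farg /= !mul0r !addr0 add0r addNr /relu maxxx addr0; by [].
Qed.

Lemma fval_clip_le (x : 'cV[R]_n) i (y : 'I_n -> R) : `|fval (clipf x i) y| <= 1.
Proof.
rewrite /fval /= mul0r addr0; set t := farg _ _; rewrite ler_norml !reluE.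
by case: (leP 0 (t + 1)); case: (leP 0 (t - 1)); lra.
Qed.

Lemma fval_clip (x y : 'cV[R]_n) i : `|y i 0 - x i 0| <= 1 ->
  fval (clipf x i) (vfun y) = y i 0 - x i 0.
Proof.
rewrite /fval /farg /= mul0r addr0 mul1r /vfun ler_norml; set t := _ - _ => h.
by rewrite !reluE; case: (leP 0 (t + 1)); case: (leP 0 (t - 1)); lra.
Qed.

Lemma fval_hat_le N i c (y : 'I_n -> R) : `|fval (hatf N i c) y| <= 1.
Proof.
have -> : fval (hatf N i c) y = hat (farg (hatf N i c) y).
  by rewrite /fval /hat /= add0r mul1r mulNr.
by rewrite ger0_norm ?hat_ge0// hat_le1.
Qed.

End Localization.

Section Approximation.
Context {R : realType}.
Variables (n m k N : nat).
Hypothesis n0 : (0 < n)%N.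
Hypothesis nN : (4 * n < N)%N.

Definition cell : finType := {ffun 'I_n -> 'I_(4 * N).+1}.

Definition center (p : cell) : 'cV[R]_n := \col_i ((p i)%:R / N%:R - 2).

Definition weight (p : cell) (y : 'cV[R]_n) : R :=
  \prod_i hat (N%:R * y i 0 + (2 * N)%:R - (p i)%:R).

Let N0 : 0 < N%:R :> R.
Proof. by rewrite ltr0n; lia. Qed.

Lemma weight_ge0 p y : 0 <= weight p y.
Proof. by apply: prodr_ge0 => i _; exact: hat_ge0. Qed.

Lemma weight_sum y : enorm y <= 3 / 2 -> \sum_p weight p y = 1.
Proof.
move=> yr; rewrite /weight.
rewrite -(bigA_distr_bigA (fun i (c : 'I_(4 * N).+1) =>
  hat (N%:R * y i 0 + (2 * N)%:R - c%:R))) big1// => i _.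
apply: hat_sum; have := le_trans (coord_le_enorm y i) yr; rewrite ler_norml => /andP[h1 h2].
have k1 := ler_wpM2l (ltW N0) h1; have k2 := ler_wpM2l (ltW N0) h2.
have := N0; rewrite !natrM; move: (N%:R * y i 0) (N%:R : R) k1 k2 => a b k1 k2 b0; lra.
Qed.

Lemma weight_supp p y : weight p y != 0 -> forall i, `|y i 0 - center p i 0| <= N%:R^-1.
Proof.
move=> w0 i; have : hat (N%:R * y i 0 + (2 * N)%:R - (p i)%:R) != 0.
  by apply: contra_neq w0 => h; rewrite /weight (bigD1 i)//= h mul0r.
move=> /hat_supp h; rewrite -[leRHS]mul1r ler_pdivlMr// -[X in _ * X]ger0_norm ?(ltW N0)// -normrM.
rewrite (_ : _ * _ = N%:R * y i 0 + (2 * N)%:R - (p i)%:R)//.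
by rewrite mxE natrM; field; rewrite gt_eqF.
Qed.

(** This is where [4 n < N] is used: the points at which Taylor's formula is applied remain
    inside the open ball on which [g] is known to be smooth. *)
Lemma weight_box p (y z : 'cV[R]_n) : enorm y <= 3 / 2 -> weight p y != 0 ->
  (forall j, `|z j 0 - center p j 0| <= N%:R^-1) -> eball 2 z.
Proof.
move=> yr /weight_supp yp zp.
have h : enorm (z - y) <= n%:R * (2 * N%:R^-1).
  apply: enorm_le_coord => i; rewrite !mxE.
  rewrite (_ : z i 0 - y i 0 = (z i 0 - center p i 0) - (y i 0 - center p i 0)); last by ring.
  by apply: le_trans (ler_normB _ _) _; rewrite mulr_natl mulr2n lerD// distrC.
have h2 : n%:R * (2 * N%:R^-1) < 1 / 2 :> R.
  rewrite mulrA ltr_pdivrMr//; have : (4 * n)%:R < N%:R :> R by rewrite ltr_nat.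
  rewrite natrM; lra.
rewrite /eball/= -(subrK y z); apply: le_lt_trans (enormD _ _) _; lra.
Qed.

Definition hats (p : cell) : seq (@rfactor R n) := [seq hatf N i (p i) | i <- enum 'I_n].

Lemma hats_prod p y : \prod_(phi <- hats p) fval phi (vfun y) = weight p y.
Proof.
by rewrite /hats big_map big_enum; apply: eq_bigr => i _; rewrite fval_hat.
Qed.

(** The factors 1 at the end make all products equally long, so that all units run in
    lockstep. *)
Definition unit_factors (p : cell) (s : seq 'I_n) : seq (@rfactor R n) :=
  hats p ++ map (clipf (center p)) s ++ nseq (k - size s) (onef (Ordinal n0)).

Lemma unit_factors_prod p s y : 
  \prod_(phi <- unit_factors p s) fval phi (vfun y) = weight p y * monom (center p) y s.
Proof.
rewrite /unit_factors !big_cat /= hats_prod.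
have -> : \prod_(phi <- nseq (k - size s) (onef (Ordinal n0))) fval phi (vfun y) = 1.
  by rewrite big_nseq; elim: (k - size s)%N => //= j ->; rewrite fval_one mulr1.
rewrite mulr1; have [->|w0] := eqVneq (weight p y) 0; first by rewrite !mul0r.
congr (_ * _); rewrite big_map; apply: eq_bigr => i _; apply: fval_clip.
apply: le_trans (weight_supp w0 i) _; rewrite invf_le1// ler1n; lia.
Qed.

Lemma unit_factors_le1 p s j phi0 (y : 'I_n -> R) : (j < size (unit_factors p s))%N ->
  `|fval (nth phi0 (unit_factors p s) j) y| <= 1.
Proof.
move=> js; have : all (fun phi => `|fval phi y| <= 1) (unit_factors p s).
  rewrite /unit_factors !all_cat; apply/and3P; split.
  - by rewrite all_map; apply/allP => i _; exact: fval_hat_le.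
  - by rewrite all_map; apply/allP => i _; exact: fval_clip_le.
  - by rewrite all_nseq fval_one normr1 lexx orbT.
by move=> /all_nthP; apply.
Qed.

(** The products of hats form a partition of unity on the ball of radius [3 / 2], and a node
    has nonzero weight at [y] only if all its coordinates are within [1 / N] of those of
    [y]; there the Taylor polynomial at the node approximates [g] to order [N ^ -k].  A unit
    is a node together with a monomial. *)
Theorem local_taylor_approx (g : 'cV[R]_n -> 'cV[R]_m) : (0 < k)%N -> Ck_open k 2 g ->
  exists (coef : cell * 'I_(k ^ n) -> 'cV[R]_m) (fs : cell * 'I_(k ^ n) -> seq (@rfactor R n)),
  [/\ forall u, size (fs u) = (n + k)%N,
      forall u, enorm (coef u) <= Ck_norm k 2 g,
      forall u j phi0 y, (j < size (fs u))%N -> `|fval (nth phi0 (fs u) j) y| <= 1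
    & forall y, enorm y <= 3 / 2 ->
      enorm (g y - \sum_u (\prod_(phi <- fs u) fval phi (vfun y)) *: coef u) <=
      (k.+1 ^ n)%:R * (Ck_norm k 2 g * N%:R^-1 ^+ k)].
Proof.
move=> k0 gC; set G := Ck_norm k 2 g.
have al_bound := deriv_bound_Ck_norm (ltr0Sn R 1) gC.
have G0 : 0 <= G := Ck_norm_ge0 (ltr0Sn R 1) gC.
have Ni0 : 0 <= N%:R^-1 :> R by rewrite invr_ge0 ltW.
have /choice[T TP] : forall p : cell, exists T : terms n m,
   [/\ (size T <= k ^ n)%N, terms_ok T G k (enum 'I_n) &
    forall y, enorm y <= 3 / 2 -> weight p y != 0 ->
      enorm (g y - teval T (center p) y) <= (k.+1 ^ n)%:R * (G * N%:R^-1 ^+ k)].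
  move=> p.
  have [box|nbox] := pselect (forall z : 'cV[R]_n,
     (forall j, `|z j 0 - center p j 0| <= N%:R^-1) -> eball 2 z); last first.
    (* the node has zero weight on the whole ball, so that any polynomial will do *)
    exists [::]; split=> // y yr w0; exfalso; apply: nbox => z; exact: weight_box yr w0.
  have [T [T1 T2 T3]] := taylor_terms Ni0 G0 box (enum_uniq 'I_n) gC al_bound.
  rewrite size_enum_ord in T1 T3; exists T; split=> // y yr w0.
  by apply: T3 => [j|j]; [exact: weight_supp|rewrite mem_enum].
pose t0 : 'cV[R]_m * seq 'I_n := (0, [::]).
pose tm (u : cell * 'I_(k ^ n)) := nth t0 (T u.1) u.2.
have tmP u : enorm (tm u).1 <= G /\ (size (tm u).2 < k)%N.
  rewrite /tm; have [lt|ge] := ltnP u.2 (size (T u.1)).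
    by have [_ /(_ _ (mem_nth t0 lt)) [h1 h2 _] _] := TP u.1.
  by rewrite nth_default//= enorm0.
exists (fun u => (tm u).1), (fun u => unit_factors u.1 (tm u).2); split.
- move=> u; rewrite /unit_factors /hats !size_cat !size_map size_nseq -enumT -cardE card_ord.
  by have [_ h] := tmP u; lia.
- by move=> u; have [] := tmP u.
- by move=> u j phi0 y; exact: unit_factors_le1.
- move=> y yr.
  have E p : \sum_(q < k ^ n) (weight p y * monom (center p) y (tm (p, q)).2) *: (tm (p, q)).1 =
      weight p y *: teval (T p) (center p) y.
    rewrite /teval (big_nth t0) scaler_sumr big_mkord /tm /=.
    have [sT _ _] := TP p.
    rewrite (big_ord_widen _ (fun q => weight p y *: (monom (center p) y (nth t0 (T p) q).2 *:
      (nth t0 (T p) q).1)) sT) [RHS]big_mkcond /=; apply: eq_bigr => q _.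
    case: ltnP => qT; first by rewrite scalerA.
    by rewrite nth_default//= scaler0.
  rewrite (eq_bigr (fun u : cell * 'I_(k ^ n) =>
     (weight u.1 y * monom (center u.1) y (tm u).2) *: (tm u).1)); last first.
    by move=> u _; rewrite unit_factors_prod.
  rewrite (_ : \sum_(u : cell * 'I_(k ^ n)) _ =
     \sum_p \sum_(q < k ^ n) (weight p y * monom (center p) y (tm (p, q)).2) *: (tm (p, q)).1);
    last by rewrite pair_bigA; apply: eq_bigr => -[p q].
  rewrite (eq_bigr _ (fun p _ => E p)).
  have -> : g y = \sum_p weight p y *: g y.
    by rewrite -scaler_suml weight_sum// scale1r.
  rewrite -sumrB; apply: le_trans (enorm_sum _ _ _) _.
  rewrite -[leRHS]mul1r -[X in _ <= X * _](weight_sum yr) mulr_suml; apply: ler_sum => p _.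
  rewrite -scalerBr enormZ ger0_norm ?weight_ge0//.
  have [->|w0] := eqVneq (weight p y) 0; first by rewrite !mul0r.
  rewrite ler_wpM2l ?weight_ge0//.
  by have [_ _ h] := TP p; exact: h.
Qed.

End Approximation.

(** * Ingredients of the network *)

Section Pieces.
Context {R : realType}.

Lemma exp_choice (b K : R) : 1 < b -> 1 <= K ->
  exists j : nat, K <= b ^+ j /\ j%:R <= 1 + ln K / ln b.
Proof.
move=> b1 K1; have lb := ln_gt0 b1; have lK := ln_ge0 K1.
have b0 : 0 < b by exact: lt_trans b1.
have K0 : 0 < K by exact: lt_le_trans K1.
have q0 : 0 <= ln K / ln b by rewrite divr_ge0 ?(ltW lb).
pose j := (Num.truncn (ln K / ln b)).+1; exists j; split; last first.
  by rewrite /j -natr1 addrC lerD2l truncn_le.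
rewrite -ler_ln ?posrE ?exprn_gt0// lnXn// -[X in _ <= X]mulr_natl -ler_pdivrMr//.
by apply/ltW; exact: truncnS_gt.
Qed.

(** Horner's scheme, one layer per coefficient. *)
Lemma computes_poly n (v : 'cV[R]_n) W J (c : nat -> R) : (n <= W)%N ->
  computes W J (fun (X : 'M[R]_n) i => (\sum_(j < J) c j *: (X ^+ j *m v)) i 0).
Proof.
move=> nW; elim: J c => [|J IH] c.
  have := @computes_init R n W 'I_n (fun=> 0); rewrite card_ord => /(_ nW).
  by congr computes; apply/funext => X; apply/funext => i; rewrite big_ord0 mxE.
have := computes_horner (fun i => c 0%N * v i 0) (IH (fun j => c j.+1)) nW.
congr computes; apply/funext => X; apply/funext => i.
rewrite big_ord_recl mxE; congr (_ + _); first by rewrite expr0 mul1mx mxE.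
transitivity ((X *m \sum_(j < J) c j.+1 *: (X ^+ j *m v)) i 0); first by rewrite mxE.
rewrite mulmx_sumr; congr (fun_of_matrix _ i 0); apply: eq_bigr => j _.
by rewrite -scalemxAr mulmxA exprS.
Qed.

(** Taylor's formula of order 1 compares both values with the same constant, on a cube
    around [x] that the hypothesis on [n * del] keeps inside the ball. *)
Lemma Ck_lipschitz n m (g : 'cV[R]_n -> 'cV[R]_m) (x y : 'cV[R]_n) (del : R) :
  Ck_open 1 2 g -> enorm x <= 5 / 4 -> 0 <= del -> n%:R * del <= 1 / 4 ->
  enorm (y - x) <= del ->
  enorm (g y - g x) <= 2 * (2 ^ n)%:R * (Ck_norm 1 2 g * del).
Proof.
move=> gC x1 del0 ndel yx.
have al_bound := deriv_bound_Ck_norm (ltr0Sn R 1) gC.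
have G0 := Ck_norm_ge0 (ltr0Sn R 1) gC.
have x2 : eball 2 x by rewrite /eball/=; lra.
have box (z : 'cV[R]_n) : (forall j, `|z j 0 - x j 0| <= del) -> eball 2 z.
  move=> zx; rewrite /eball/= -(subrK x z); apply: le_lt_trans (enormD _ _) _.
  have : enorm (z - x) <= n%:R * del by apply: enorm_le_coord => j; rewrite !mxE.
  lra.
have [T [_ Tok TP]] := taylor_terms del0 G0 box (enum_uniq 'I_n) gC al_bound.
have sz : size (enum 'I_n) = n by rewrite size_enum_ord.
rewrite sz expr1 in TP.
pose c := \sum_(t <- T) t.1.
have TE (z : 'cV[R]_n) : teval T x z = c.
  rewrite /teval /c !big_seq; apply: eq_bigr => t /Tok[_ st _].
  by rewrite /monom; case: t.2 st => // _; rewrite big_nil scale1r.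
have inl (z : 'cV[R]_n) : forall j, j \notin enum 'I_n -> z j 0 = x j 0 by move=> j; rewrite mem_enum.
have hx : enorm (g x - c) <= (2 ^ n)%:R * (Ck_norm 1 2 g * del).
  by rewrite -(TE x); apply: TP => // j; rewrite subrr normr0.
have hy : enorm (g y - c) <= (2 ^ n)%:R * (Ck_norm 1 2 g * del).
  have yj j : `|y j 0 - x j 0| <= del.
    by apply: le_trans yx; have := coord_le_enorm (y - x) j; rewrite !mxE.
  by rewrite -(TE y); exact: TP yj (inl y).
rewrite (_ : g y - g x = (g y - c) - (g x - c)); last by rewrite opprB addrA subrK.
by apply: le_trans (enormB _ _) _; rewrite -mulrA mulr_natl mulr2n lerD.
Qed.

(** Serves when [g] is at most [eps] wherever [q(X) v] can be. *)
Lemma zero_orn n m : exists N : orn R n m 2,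
  [/\ depth N = 1%N, (width N <= m)%N & forall X, network N X = 0].
Proof.
have h0 := @computes_init R n m 'I_m (fun=> 0); rewrite card_ord in h0.
have h1 := @computes_relu R n m 0 'I_m 'I_m _ (fun _ _ => 0) (h0 (leqnn m)).
have {h0}h1 := h1 (fun=> affine_relu_map (affine_cst 'I_m 0)).
rewrite card_ord in h1; have [N [N1 N2 N3]] := computes_orn (ltn0Sn 0) (h1 (leqnn m)).
exists N; split=> // X; rewrite N3.
by apply/matrixP => i j; rewrite !mxE.
Qed.

Section Analytic.
Variables (r1 r : R) (q : R[i] -> R[i]).
Hypothesis r0 : 0 < r.
Hypothesis rr1 : r < r1.
Hypothesis q_hol : holomorphic_on (cdisk (1 + r1)) q.
Hypothesis q_le1 : forall z : R[i], cdisk (1 + r1) z -> `|q z| <= 1.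

Let t := 1 + r.
Let K := 2 / (1 - t^-1).
Let t1 : 1 < t. Proof. by rewrite ltrDl. Qed.
Let trho : t < 1 + r1. Proof. by rewrite ltrD2l. Qed.
Let hol z : cabs z < 1 + r1 -> derivable (q : R[i]^o -> R[i]^o) z 1.
Proof. by move=> zr; apply: q_hol; rewrite /cdisk/= normE ltcR. Qed.
Let le1 z : cabs z < 1 + r1 -> cabs (q z) <= 1.
Proof.
by move=> zr; have := q_le1 (z := z); rewrite /cdisk/= !normE ltcR lecR; exact.
Qed.

Definition vn_const : R := (4 * K + 4) / (1 - t^-1).

Let tau1 : 0 < 1 - t^-1. Proof. by rewrite subr_gt0 invf_lt1 ?(lt_trans ltr01). Qed.

Lemma K_gt0 : 0 < K. Proof. by rewrite divr_gt0. Qed.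
Lemma vn_const_gt0 : 0 < vn_const.
Proof. by rewrite divr_gt0//; have := K_gt0; lra. Qed.

(** By [von_neumann] these vectors stay away from the boundary of the ball of radius 2, so
    that [g] can be expanded around them. *)
Lemma tpoly_ball n (X : 'M[R]_n) (v : 'cV[R]_n) J : contractions X -> enorm v <= 1 ->
  vn_const * t^-1 ^+ J <= 9 / 16 -> K * t^-1 ^+ J <= 1 / 4 ->
  [/\ enorm (tpoly q X v J) <= 5 / 4,
      enorm (Re_mx (holo_calc q X) *m v - tpoly q X v J) <= K * t^-1 ^+ J &
      enorm (Re_mx (holo_calc q X) *m v) <= 3 / 2].
Proof.
move=> XC v1 h1 h2.
have := von_neumann t1 trho hol le1 v XC J; rewrite -/K -/vn_const => vn.
have tl := holo_calc_tail t1 trho hol le1 v XC J; rewrite -/K in tl.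
have v0 := enorm_ge0 v.
have t0 : 0 <= K * t^-1 ^+ J.
  by rewrite mulr_ge0 ?(ltW K_gt0)// exprn_ge0// invr_ge0 ltW// (lt_trans ltr01).
have p1 : enorm (tpoly q X v J) <= 5 / 4.
  rewrite -(@ler_pXn2r _ 2)// ?nnegrE ?enorm_ge0//.
  apply: le_trans vn _; apply: (@le_trans _ _ (1 * (1 + 9 / 16))); last by lra.
  apply: ler_pM; rewrite ?sqr_ge0//; last by rewrite lerD2l.
    by rewrite addr_ge0// mulr_ge0 ?(ltW vn_const_gt0)// exprn_ge0// invr_ge0 ltW// (lt_trans ltr01).
  by rewrite expr_le1.
have p2 : enorm (Re_mx (holo_calc q X) *m v - tpoly q X v J) <= K * t^-1 ^+ J.
  by apply: le_trans tl _; rewrite ler_piMr.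
split=> //; rewrite -(subrK (tpoly q X v J) (_ *m v)).
apply: le_trans (enormD _ _) _; lra.
Qed.

End Analytic.
End Pieces.

(** * The network *)

Section Realization.
Context {R : realType}.

(** The three terms of the error come from truncating the series of [q(X) v], which [g]
    amplifies by at most a multiple of its [C^1] norm, from the localized Taylor
    polynomials of [g], and from the approximate products. *)
Lemma recurrent_approx (n m k J N s : nat) (r r1 : R) (v : 'cV[R]_n)
    (q : R[i] -> R[i]) (g : 'cV[R]_n -> 'cV[R]_m) :
  (0 < n)%N -> (0 < k)%N -> 0 < r -> r < r1 ->
  holomorphic_on (cdisk (1 + r1)) q ->
  (forall z : R[i], cdisk (1 + r1) z -> `|q z| <= 1) ->
  Ck_open k 2 g -> enorm v <= 1 ->
  let tail := 2 / (1 - (1 + r)^-1) * (1 + r)^-1 ^+ J in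
  let G := Ck_norm k 2 g in
  let U := ((4 * N).+1 ^ n * k ^ n)%N in
  vn_const r * (1 + r)^-1 ^+ J <= 9 / 16 -> n%:R * tail <= 1 / 4 ->
  (4 * n < N)%N ->
  exists Nw : orn R n m 2,
  [/\ depth Nw = (J + 1 + (n + k) * (s + 4)).+1,
      (width Nw <= maxn m (U * (n + 8)))%N &
      forall X : 'M[R]_n, contractions X ->
      enorm (g (Re_mx (holo_calc q X) *m v) - network Nw X) <=
      2 * (2 ^ n)%:R * (Ck_norm 1 2 g * tail)
      + (k.+1 ^ n)%:R * (G * N%:R^-1 ^+ k)
      + U%:R * (G * ((n + k)%:R * 4^-1 ^+ s.+1))].
Proof.
move=> n0 k0 r0 rr1 qh q1 gC v1 tail G U h1 h2 nN.
have gC1 := Ck_open_le k0 gC.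
have tail0 : 0 <= tail.
  rewrite mulr_ge0//; first exact/ltW/(K_gt0 r0).
  by rewrite exprn_ge0// invr_ge0 addr_ge0// ltW.
have tail4 : tail <= 1 / 4.
  by apply: le_trans h2; rewrite ler_peMl// ler1n.
have [coef [fs [fsz cG fle ap]]] := local_taylor_approx n0 nN k0 gC.
pose V := (cell n N * 'I_(k ^ n))%type.
have cV : #|{: V}| = U.
  by rewrite card_prod card_ffun !card_ord.
pose W := maxn m (U * (n + 8)).
have U0 : (0 < U)%N by rewrite muln_gt0 !expn_gt0 k0.
have UW : (#|{: (V * ureg n)%type}| <= W)%N.
  rewrite card_prod cV (_ : #|{: ureg n}| = n + 8)%N ?leq_maxr//.
  by rewrite card_sum card_ord !card_prod !card_bool.
have nW : (n <= W)%N.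
  apply: leq_trans (leq_maxr _ _); apply: leq_trans (leq_pmull _ U0); exact: leq_addr.
have yc := computes_poly v J (recoef q) nW.
have hc := computes_products UW s (fun u o => coef u o 0) fsz (leq_maxl _ _) yc.
have [Nw [dN wN NE]] := computes_orn (ltn0Sn _) hc.
exists Nw; split=> // X XC.
pose y := tpoly q X v J; pose w := Re_mx (holo_calc q X) *m v.
have [y54 wy _] := tpoly_ball r0 rr1 qh q1 XC v1 h1 tail4.
pose Sy := \sum_u (\prod_(phi <- fs u) fval phi (vfun y)) *: coef u.
rewrite -/w (_ : g w - network Nw X =
  (g w - g y) + (g y - Sy) + (Sy - network Nw X)); last first.
  by rewrite !addrA subrK subrK.
apply: le_trans (enormD _ _) _; apply: lerD.
  apply: le_trans (enormD _ _) _; apply: lerD.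
    exact: Ck_lipschitz.
  by apply: ap; apply: le_trans y54 _; lra.
rewrite (_ : Sy - network Nw X = \sum_u
    (\prod_(phi <- fs u) fval phi (vfun y) - prodA s (fs u) (vfun y)) *: coef u).
  apply: le_trans (enorm_sum _ _ _) _.
  rewrite -cV -sum1_card natr_sum mulr_suml; apply: ler_sum => u _.
  rewrite enormZ mul1r mulrC; apply: ler_pM => //; first exact: enorm_ge0.
  have [_] := prodAP s (fun j phi0 js => fle u j phi0 (vfun y) js).
  by rewrite fsz distrC.
rewrite NE; apply/matrixP => i j; rewrite !mxE !summxE -sumrB.
by apply: eq_bigr => u _; rewrite ord1 !mxE mulrBl [coef u i 0 * _]mulrC.
Qed.

End Realization.

(** * Choice of the parameters *)

Section ParameterChoice.
Context {R : realType}.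

(** The tail of the Taylor series decays geometrically, so [J] of the order of
    [ln (G1 / eps)] terms suffice. *)
Lemma degree_choice (n : nat) (r : R) : 0 < r ->
  exists2 A : R, 1 <= A & forall G1 eps : R, 0 < eps < G1 -> exists J : nat,
  let tail := 2 / (1 - (1 + r)^-1) * (1 + r)^-1 ^+ J in
  [/\ vn_const r * (1 + r)^-1 ^+ J <= 9 / 16, n%:R * tail <= 1 / 4,
      2 * (2 ^ n)%:R * (G1 * tail) <= eps / 2 &
      J%:R <= 1 + (ln A + ln (G1 / eps)) / ln (1 + r)].
Proof.
move=> r0; set K := 2 / (1 - (1 + r)^-1).
have K0 : 0 < K := K_gt0 r0; have C0 := vn_const_gt0 r0.
set C1 := vn_const r in C0 *; set b : R := (2 ^ n)%:R.
have b0 : 0 < b by rewrite ltr0n expn_gt0.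
have n0 : 0 <= n%:R :> R by [].
have nK0 : 0 <= n%:R * K by rewrite mulr_ge0// ltW.
have bK0 : 0 < b * K by rewrite mulr_gt0.
exists (2 * C1 + 4 * (n%:R * K) + 4 * (b * K) + 1); first by lra.
set A := (_ + 1); move=> G1 eps /andP[e0 eG].
have A1 : 1 <= A by rewrite /A; lra.
have G0 : 0 < G1 by exact: lt_trans eG.
have x1 : 1 <= G1 / eps by rewrite ler_pdivlMr// mul1r ltW.
have t1 : 1 < 1 + r by rewrite ltrDl.
have t0 : 0 < 1 + r by exact: lt_trans t1.
have [J [J1 J2]] := exp_choice t1 (mulr_ege1 A1 x1).
have tJ : 0 < (1 + r) ^+ J by rewrite exprn_gt0.
have AJ : A <= (1 + r) ^+ J by apply: le_trans J1; rewrite ler_peMr// (le_trans ler01).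
exists J; rewrite /= exprVn; split.
- rewrite ler_pdivrMr//; have : A <= (1 + r) ^+ J by []; rewrite /A; lra.
- rewrite mulrA ler_pdivrMr//; move: AJ; rewrite /A; lra.
- rewrite mulrA ler_pdivrMr// in J1.
  rewrite (_ : 2 * b * _ = 2 * (b * K) * G1 / (1 + r) ^+ J); last by ring.
  rewrite ler_pdivrMr//; have : 4 * (b * K) * G1 <= A * G1.
    by rewrite ler_pM2r// /A; lra.
  lra.
- have A0 : 0 < A by exact: lt_le_trans A1.
  have x0 : 0 < G1 / eps by rewrite divr_gt0.
  by rewrite -lnM ?posrE.
Qed.

(** The mesh is [x ^ (-1 / k)] up to a constant, with [x] standing for the [C^k] norm over
    [eps]. *)
Lemma mesh_choice (n k : nat) : (0 < k)%N ->
  exists2 c : R, 1 <= c & forall x : R, 1 < x -> exists N : nat,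
  [/\ (4 * n < N)%N, 4 * (k.+1 ^ n)%:R * x <= N%:R ^+ k :> R &
      ((4 * N).+1 ^ n)%:R <= c * x `^ (n%:R / k%:R)].
Proof.
move=> k0; pose c1 : R := 4 * (k.+1 ^ n)%:R + 4 * n%:R + 1.
have a0 : 0 <= (k.+1 ^ n)%:R :> R by [].
have n0 : 0 <= n%:R :> R by [].
have c11 : 1 <= c1 by rewrite /c1; lra.
exists ((10 * c1) ^+ n); first by apply: exprn_ege1; lra.
move=> x x1; have x0 : 0 < x by exact: lt_trans x1.
pose p := x `^ (k%:R^-1).
have p1 : 1 <= p by rewrite -[leLHS](powRr0 x) ler_powR// ltW.
have p0 : 0 <= p := powR_ge0 _ _.
have pk : p ^+ k = x.
  by rewrite -powR_mulrn// -powRrM mulVf ?powRr1 ?(ltW x0)// pnatr_eq0 -lt0n.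
have pn : p ^+ n = x `^ (n%:R / k%:R) by rewrite -powR_mulrn// -powRrM mulrC.
have cp1 : 1 <= c1 * p by exact: mulr_ege1.
have cp0 : 0 <= c1 * p by exact: le_trans cp1.
pose N := (Num.truncn (c1 * p)).+1.
have N1 : c1 * p < N%:R := truncnS_gt _.
have N2 : N%:R <= 2 * (c1 * p).
  by have := truncn_le (c1 * p); rewrite cp0 /N -natr1; lra.
have c1p : c1 <= c1 * p by rewrite ler_peMr// (le_trans ler01).
exists N; split.
- by rewrite -(ltr_nat R) natrM; apply: le_lt_trans N1; move: c1p; rewrite /c1; lra.
- apply: (@le_trans _ _ ((c1 * p) ^+ k)); last first.
    by rewrite lerXn2r ?nnegrE// ltW.
  rewrite exprMn pk ler_pM2r//; apply: (@le_trans _ _ c1); first by rewrite /c1; lra.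
  by rewrite -[leLHS]expr1 ler_weXn2l.
- rewrite -pn -exprMn natrX lerXn2r ?nnegrE//.
    by rewrite mulr_ge0//; lra.
  rewrite -natr1 natrM -mulrA; move: N2 cp1; lra.
Qed.

(** Here [D * p ^+ n] stands for the number of factors in all products; its logarithm is
    again of the order of [ln x]. *)
Lemma digits_choice (D : R) (n : nat) : 1 <= D -> forall p x : R, 1 <= p -> p <= x ->
  exists s : nat, D * p ^+ n * x <= 4 ^+ s /\ s%:R <= 1 + (ln D + n.+1%:R * ln x) / ln 4.
Proof.
move=> D1 p x p1 px; have x1 := le_trans p1 px.
have [D0 p0 x0] : [/\ 0 < D, 0 < p & 0 < x] by split; exact: lt_le_trans ltr01 _.
have b4 : 1 < 4 :> R by lra.
have [s [s1 s2]] := exp_choice b4 (mulr_ege1 (mulr_ege1 D1 (exprn_ege1 n p1)) x1).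
exists s; split=> //; apply: le_trans s2 _.
rewrite lerD2l ler_pM2r ?invr_gt0 ?ln_gt0// !lnM ?posrE ?mulr_gt0 ?exprn_gt0// lnXn//.
rewrite -addrA lerD2l -[n.+1%:R]natr1 mulrDl mul1r lerD2r -[leLHS]mulr_natl.
by rewrite ler_wpM2l// ler_ln.
Qed.

End ParameterChoice.

(** * Approximation by operator recurrent networks *)

Section Ball.
Context {R : realType}.

(** Taylor polynomials of high degree are within [1 / 4] of the functional calculus. *)
Lemma holo_calc_ball (n : nat) (r r1 : R) (v : 'cV[R]_n) (q : R[i] -> R[i])
    (X : 'M[R]_n) : (0 < n)%N -> 0 < r -> r < r1 ->
  holomorphic_on (cdisk (1 + r1)) q ->
  (forall z : R[i], cdisk (1 + r1) z -> `|q z| <= 1) ->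
  enorm v <= 1 -> contractions X -> enorm (Re_mx (holo_calc q X) *m v) <= 3 / 2.
Proof.
move=> n0 r0 rr1 qh q1 v1 XC.
have [A _ /(_ 2 1)[|J [h1 h2 _ _]]] := degree_choice n r0; first by lra.
have K0 := K_gt0 r0.
have h2' : 2 / (1 - (1 + r)^-1) * (1 + r)^-1 ^+ J <= 1 / 4.
  apply: le_trans h2; rewrite ler_peMl ?ler1n//.
  by rewrite mulr_ge0 ?(ltW K0)// exprn_ge0// invr_ge0 addr_ge0// ltW.
by have [] := tpoly_ball r0 rr1 qh q1 XC v1 h1 h2'.
Qed.

Lemma value_le_Ck_norm (n m k : nat) (g : 'cV[R]_n -> 'cV[R]_m) y :
  Ck_open k 2 g -> enorm y <= 3 / 2 -> enorm (g y) <= Ck_norm k 2 g.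
Proof.
move=> gC y1; have := @mderiv_le_Ck_norm R n m k 2 g [ffun=> 0%N] y.
rewrite /mderiv (_ : foldr _ _ _ = g); last first.
  by elim: (enum 'I_n) => //= i l ->; rewrite ffunE.
by apply=> //; [rewrite big1// => i _; rewrite ffunE | rewrite /eball/=; lra].
Qed.

End Ball.

Theorem theorem2p1 (R : realType) (n k : nat) (r : R)
    (hn : (0 < n)%N) (hk : (0 < k)%N) (hr : 0 < r < 1) :
  exists2 C : R, 0 < C &
  forall (m : nat) (r1 : R) (v : 'cV[R]_n) (q : R[i] -> R[i])
         (g : 'cV[R]_n -> 'cV[R]_m) (eps : R),
    (0 < m)%N -> r < r1 -> enorm v <= 1 ->
    holomorphic_on (cdisk (1 + r1)) q ->
    (forall X : 'M[R]_n, contractions X -> real_mx (holo_calc q X)) ->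
    Ck_cball k 2 g ->
    (forall z : R[i], cdisk (1 + r1) z -> `|q z| <= 1) ->
    (forall y : 'cV[R]_n, cball 2 y -> enorm (g y) <= 1) ->
    0 < eps < 1 ->
    exists N : orn R n m 2,
      [/\ (depth N)%:R <= Num.max 1 (depth_bound k r eps C g),
          (width N)%:R <= Num.max m%:R (width_bound k eps C g)
        & forall X : 'M[R]_n, contractions X ->
            enorm (g (Re_mx (holo_calc q X) *m v) - network N X) <= eps].
Proof.
have /andP[r0 r_lt1] := hr.
have k0 : 0 < k%:R :> R by rewrite ltr0n.
have [A A1 HJ] := degree_choice n r0.
have [c c1 HN] := @mesh_choice R n k hk.
pose kn : R := (k ^ n)%:R; pose nk : R := (n + k)%:R.
have kn1 : 1 <= kn by rewrite ler1n expn_gt0 hk.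
have nk1 : 1 <= nk by rewrite ler1n addn_gt0 hn.
pose D := kn * c * nk.
have D1 : 1 <= D by rewrite mulr_ege1// mulr_ege1.
have lA := ln_ge0 A1; have lD := ln_ge0 D1.
have lt : 0 < ln (1 + r) by rewrite ln_gt0// ltrDl.
have l4 : 0 < ln 4 :> R by rewrite ln_gt0// ltr1n.
(* the depth is at most ca + cb mu + cc lam, the width at most cw (G / eps) ^ (n / k) *)
pose ca := 3 + ln A / ln (1 + r) + nk * (5 + ln D / ln 4).
pose cb := (ln (1 + r))^-1.
pose cc := nk * (n.+1%:R / ln 4).
pose cw := kn * c * (n + 8)%:R.
have cb0 : 0 < cb by rewrite invr_gt0.
have nk0 : 0 < nk by exact: lt_le_trans nk1.
have cc0 : 0 <= cc by rewrite mulr_ge0 ?(ltW nk0)// divr_ge0// ltW.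
have ca0 : 0 <= ca.
  rewrite /ca addr_ge0 ?addr_ge0 ?mulr_ge0 ?addr_ge0 ?divr_ge0 ?invr_ge0 ?(ltW nk0)//; exact: ltW.
have cw0 : 0 <= cw by rewrite !mulr_ge0// ltW// (lt_le_trans ltr01).
exists (ca + cb + cc + cw); first by lra.
move=> m r1 v q g eps m0 rr1 v1 qh _ [_ gC] q1 _ /andP[e0 e1].
have wball X := @holo_calc_ball R n r r1 v q X hn r0 rr1 qh q1 v1.
(* once g exceeds eps somewhere, so do both its norms, and all logarithms are positive *)
have [small|] := pselect (forall y : 'cV[R]_n, enorm y <= 3 / 2 -> enorm (g y) <= eps).
  have [Nw [dN wN NE]] := @zero_orn R n m.
  exists Nw; split; first by rewrite dN le_max lexx.
    by rewrite le_max ler_nat wN.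
  by move=> X XC; rewrite NE subr0; apply: small; exact: wball.
move=> /existsNP[y0 /not_implyP[y01 /negP]]; rewrite -ltNge => gy0.
have gC1 := Ck_open_le hk gC.
set G := Ck_norm k 2 g; set G1 := Ck_norm 1 2 g.
have eG : eps < G := lt_le_trans gy0 (value_le_Ck_norm gC y01).
have eG1 : eps < G1 := lt_le_trans gy0 (value_le_Ck_norm gC1 y01).
have G0 : 0 < G := lt_trans e0 eG; have G10 : 0 < G1 := lt_trans e0 eG1.
pose x := G / eps; have x1 : 1 < x by rewrite ltr_pdivlMr// mul1r.
have x0 : 0 < x := lt_trans ltr01 x1.
pose p := x `^ (k%:R^-1).
have p1 : 1 <= p by rewrite -[leLHS](powRr0 x) ler_powR// ?(ltW x1)// invr_ge0.
have px : p <= x by rewrite ler1_powR// ?(ltW x1)// invf_le1// ler1n.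
have pn : p ^+ n = x `^ (n%:R / k%:R).
  by rewrite -powR_mulrn ?powR_ge0// -powRrM mulrC.
have [J [J1 J2 J3 J4]] : _ := HJ G1 eps (introT andP (conj e0 eG1)).
have [N [N1 N2 N3]] := HN x x1.
have [s [s1 s2]] := digits_choice n D1 p1 px.
have [Nw [dN wN NE]] := recurrent_approx s hn hk r0 rr1 qh q1 gC v1 J1 J2 N1.
set lam := ln (4 ^+ k.+1 * G / eps); set mu := ln (4 * G1 / (r * eps)).
have xlam : ln x <= lam.
  rewrite /lam -mulrA ler_ln ?posrE ?mulr_gt0 ?exprn_gt0 ?invr_gt0//.
  by rewrite ler_peMl ?(ltW x0)// exprn_ege1// ler1n.
have xmu : ln (G1 / eps) <= mu.
  rewrite /mu ler_ln ?posrE ?divr_gt0 ?mulr_gt0 ?invr_gt0//.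
  rewrite (_ : 4 * G1 / _ = 4 / r * (G1 / eps)); last first.
    by rewrite invfM; ring.
  rewrite ler_peMl ?divr_ge0 ?(ltW G10) ?(ltW e0)// ler_pdivlMr//; lra.
have lx0 : 0 <= ln x by rewrite ln_ge0// ltW.
have lx10 : 0 <= ln (G1 / eps) by rewrite ln_ge0// ler_pdivlMr// mul1r ltW.
have lam0 : 0 <= lam by exact: le_trans xlam.
have mu0 : 0 <= mu by exact: le_trans xmu.
have UE : ((4 * N).+1 ^ n * k ^ n)%:R <= kn * c * p ^+ n.
  by rewrite natrM mulrC -mulrA ler_wpM2l ?(le_trans ler01)// pn.
exists Nw; split.
- rewrite le_max dN /depth_bound -/G -/G1 -/lam -/mu; apply/orP; right.
  apply: (@le_trans _ _ (ca + cb * mu + cc * lam)); last first.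
    have : 0 <= (ca + cc + cw) * mu by apply: mulr_ge0 => //; lra.
    have : 0 <= (ca + cb + cw) * lam by apply: mulr_ge0 => //; lra.
    lra.
  apply: (@le_trans _ _ (ca + cb * ln (G1 / eps) + cc * ln x)); last first.
    by rewrite lerD ?lerD2l ?ler_wpM2l// ltW.
  rewrite -natr1 !natrD natrM -/nk natrD.
  have : nk * s%:R <= nk * (1 + (ln D + n.+1%:R * ln x) / ln 4) by rewrite ler_wpM2l// ltW.
  move: J4; rewrite /ca /cb /cc; move: (ln A) (ln D) (ln x) (ln (G1 / eps)) (ln 4) (ln (1 + r)).
  move=> a d lx lx1 l4' lr; rewrite !(mulrDl, mulrDr); lra.
- apply: (@le_trans _ _ (maxn m (((4 * N).+1 ^ n * k ^ n) * (n + 8)))%:R).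
    by rewrite ler_nat.
  rewrite /maxn; case: ifP => _; last by rewrite le_max lexx.
  rewrite le_max; apply/orP; right; rewrite /width_bound -/G -/lam.
  apply: (@le_trans _ _ (cw * p ^+ n)).
    by rewrite natrM /cw mulrAC ler_wpM2r.
  set P := _ `^ _.
  have pP : p ^+ n <= P.
    pose z := 4 ^+ k.+1 * G / eps.
    have z0 : 0 <= z by rewrite divr_ge0 ?(ltW e0)// mulr_ge0 ?exprn_ge0 ?(ltW G0).
    have PE : P = z `^ (n%:R / k%:R).
      rewrite /P -invf_div -/z powRN -(powR_inv1 z0) powRAC powR_inv1 ?powR_ge0//.
      by rewrite invrK.
    have xz : x <= z.
      by rewrite /z -mulrA ler_peMl ?(ltW x0)// exprn_ege1// ler1n.
    by rewrite pn PE; apply: ge0_ler_powR => //; rewrite ?nnegrE ?(ltW x0) ?z0 // divr_ge0.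
  have P0 : 0 <= P by exact: powR_ge0.
  have q1' : 1 <= m%:R * n%:R * (lam + 1) :> R.
    rewrite mulr_ege1 ?lerDr// -natrM ler1n muln_gt0 m0//.
  rewrite (_ : _ * (lam + 1) = (ca + cb + cc + cw) * (P * (m%:R * n%:R * (lam + 1)))); last by ring.
  apply: ler_pM; rewrite ?exprn_ge0 ?powR_ge0//; first by lra.
  by apply: le_trans pP _; rewrite ler_peMr.
- move=> X XC; apply: le_trans (NE X XC) _; rewrite -/G -/G1.
  have h2 : (k.+1 ^ n)%:R * (G * N%:R^-1 ^+ k) <= eps / 4.
    have Nk : 0 < N%:R ^+ k :> R by rewrite exprn_gt0// ltr0n (leq_ltn_trans _ N1).
    rewrite exprVn !mulrA ler_pdivrMr//; move: N2; rewrite /x mulrA ler_pdivrMr//; lra.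
  have h3 : ((4 * N).+1 ^ n * k ^ n)%:R * (G * ((n + k)%:R * 4^-1 ^+ s.+1)) <= eps / 4.
    have T0 : 0 < 4 ^+ s :> R by rewrite exprn_gt0.
    have h : ((4 * N).+1 ^ n * k ^ n)%:R * nk * x <= 4 ^+ s.
      apply: le_trans s1; apply: ler_wpM2r; first exact: ltW.
      by rewrite /D mulrAC; apply: ler_wpM2r => //; exact: ltW.
    rewrite exprS exprVn -/nk; rewrite /x mulrA ler_pdivrMr// in h.
    rewrite (_ : _ * (G * _) = (((4 * N).+1 ^ n * k ^ n)%:R * nk * G / 4 ^+ s) / 4); last by ring.
    have h4 : ((4 * N).+1 ^ n * k ^ n)%:R * nk * G / 4 ^+ s <= eps.
      by rewrite ler_pdivrMr// [eps * _]mulrC.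
    by apply: ler_wpM2r.
  lra.
Qed.
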